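(* Fix $\mu\in\mathcal M^0([0,\tau])$ and choose $\beta\ge0$ such that $d_{\mu,\beta}:=\alpha_0-\Lambda_1\kappa_\mu(\beta)>0$. Let $r>0$ satisfy $\Lambda_1r\le\frac12d_{\mu,\beta}$. Then, for every $\nu\in\mathcal M^0([0,\tau])$ with $\|\nu-\mu\|_{\mathcal M([0,\tau])}\le r$, the weak solutions $u_\nu,u_\mu$ of the delay problem with kernels $\nu$ and $\mu$ and common data $u_0\in H$, $f\in L^2(0,T;V^* )$, $\psi\in L^2(-\tau,0;V)$ satisfy $$\|u_\nu-u_\mu\|_{\mathcal W(0,T)}+\|u_\nu-u_\mu\|_{\mathcal C([0,T];H)}\le 2e^{\beta T}\,\frac{1+\sqrt{\alpha_0}+\alpha_0+\Lambda_0}{d_{\mu,\beta}}\,\Lambda_1\,\|\tilde u_\mu\|_{L^2(-\tau,T;V)}\,\|\nu-\mu\|_{\mathcal M([0,\tau])}.$$ Thus, the solution map $\nu\mapsto u_\nu$ is locally Lipschitz from $\mathcal M^0([0,\tau])$ with the total-variation norm into $\mathcal W(0,T)\cap\mathcal C([0,T];H)$.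
   Context: Fix real numbers $T>0$ and $\tau>0$. $V,H$ are real separable Hilbert spaces with $V\hookrightarrow H$ continuously and densely; $H$ is identified with its dual, giving the Gelfand triple $V\hookrightarrow H\cong H^*\hookrightarrow V^*$, and $\langle\cdot,\cdot\rangle$ is the duality pairing between $V^*$ and $V$. $a_0,a_1:V\times V\to\mathbb R$ are bilinear forms and $\Lambda_0,\Lambda_1,\alpha_0>0$ are constants with $|a_i(w,v)|\le\Lambda_i\|w\|_V\|v\|_V$ for all $w,v\in V$, $i\in\{0,1\}$, and $a_0(v,v)\ge\alpha_0\|v\|_V^2$ for all $v\in V$. The operators $A_i\in\mathcal L(V,V^* )$ are given by $\langle A_iw,v\rangle=a_i(w,v)$. $\mathcal M([0,\tau])$ is the Banach space of finite signed Borel measures on $[0,\tau]$ with norm $\|\sigma\|_{\mathcal M([0,\tau])}=|\sigma|([0,\tau])$, where $|\sigma|$ is the total variation measure; $\mathcal M^0([0,\tau])=\{\sigma\in\mathcal M([0,\tau]):|\sigma|(\{0\})=0\}$. For $\beta\ge0$, $\kappa_\mu(\beta):=\int_{[0,\tau]}e^{-\beta s}\,d|\mu|(s)$. For $\sigma\in\mathcal M([0,\tau])$ and $g\in L^2(-\tau,T;V)$, $\mathcal K_\sigma g\in L^2(0,T;V^* )$ is defined by $(\mathcal K_\sigma g)(t)=\int_{[0,\tau]}A_1g(t-s)\,d\sigma(s)$ for a.e. $t\in(0,T)$ (Bochner integral, using any Borel strongly measurable representative of $g$; the resulting element of $L^2(0,T;V^* )$ does not depend on the representative). $\mathcal W(0,T)=\{u\in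 L^2(0,T;V):\partial_tu\in L^2(0,T;V^* )\}$ with norm $\|u\|_{\mathcal W(0,T)}=\bigl(\|u\|_{L^2(0,T;V)}^2+\|\partial_tu\|_{L^2(0,T;V^* )}^2\bigr)^{1/2}$; it embeds into $\mathcal C([0,T];H)$, and pointwise values refer to the $H$-continuous representative. For $u:(0,T)\to V$ the joined trajectory is $\tilde u(t)=\psi(t)$ for $-\tau<t<0$ and $\tilde u(t)=u(t)$ for $0<t<T$. For $\mu\in\mathcal M^0([0,\tau])$, the weak solution $u_\mu$ of the delay problem with kernel $\mu$ and data $(u_0,f,\psi)$ is the (unique) $u\in\mathcal W(0,T)$ with $u(0)=u_0$ in $H$ and $\partial_tu(t)+A_0u(t)+(\mathcal K_\mu\tilde u)(t)=f(t)$ in $V^*$ for a.e. $t\in(0,T)$. *)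

(* Defs.v *)
From HB Require Import structures.
From mathcomp Require Import all_boot all_order all_algebra.
From mathcomp Require Import all_classical all_reals all_analysis.

Set Implicit Arguments.
Unset Strict Implicit.
Unset Printing Implicit Defensive.

Import Order.TTheory GRing.Theory Num.Theory.
Import numFieldNormedType.Exports.

Local Open Scope classical_set_scope.
Local Open Scope ring_scope.

HB.mixin Record CompleteNormedModule_isHilbert (R : realType) V
    & CompleteNormedModule R V := {
  inner : V -> V -> R ;
  innerC : forall x y, inner x y = inner y x ;
  inner_linearl : forall (k : R) x y z,
    inner (k *: x + y) z = k * inner x z + inner y z ;
  inner_norm : forall x, inner x x = `|x| ^+ 2 }.

#[short(type=hilbertType)]
HB.structure Definition Hilbert (R : realType) :=
  { V of CompleteNormedModule_isHilbert R V & CompleteNormedModule R V }.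

Definition separable (T : topologicalType) :=
  exists D : set T, countable D /\ dense D.

(* The topological dual, as a normed space with the operator norm.            *)
Section dual.
Context {R : realType} (V : normedModType R).

Definition bounded_functional : {pred V -> R^o} :=
  [pred f | `[< linear f /\ exists M : R, forall v, `|f v| <= M * `|v| >]].

Lemma bounded_functional_submod : submod_closed bounded_functional.
Proof.
split.
  apply/asboolP; split; first by move=> k u v /=; rewrite scaler0 addr0.
  by exists 0 => v; rewrite mul0r normr0.
move=> k f g /asboolP[lf [M hM]] /asboolP[lg [N hN]].
apply/asboolP; split.
  move=> a u v /=.
  rewrite !fctE lf lg !scalerDr !scalerA [k * a]mulrC -!addrA; congr (_ + _).
  by rewrite addrCA.
exists (`|k| * M + N) => v; rewrite (le_trans (ler_normD _ _))//.
rewrite mulrDl lerD// -mulrA normrM; exact: ler_wpM2l.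
Qed.

HB.instance Definition _ := GRing.isSubmodClosed.Build R (V -> R^o)
  bounded_functional bounded_functional_submod.

Record dual := Dual {
  dual_fun :> V -> R^o ;
  dualP : dual_fun \in bounded_functional }.

HB.instance Definition _ := [isSub for dual_fun].
HB.instance Definition _ := [Choice of dual by <:].
HB.instance Definition _ := [SubChoice_isSubLmodule of dual by <:].

Definition dual_norm (f : dual) : R :=
  sup [set `|f v| | v in [set v : V | `|v| <= 1]].

Lemma dual_norm_has_sup (f : dual) :
  has_sup [set `|f v| | v in [set v : V | `|v| <= 1]].
Proof.
have [_ [M hM]] := asboolW (dualP f).
split; first by exists `|f 0|, 0 => //=; rewrite normr0.
exists `|M| => _ [v /= v1 <-]; rewrite (le_trans (hM v))//.
rewrite (@le_trans _ _ (`|M| * `|v|))//; first by rewrite ler_wpM2r// ler_norm.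
by rewrite ler_piMr.
Qed.

Lemma dual0 (f : dual) : f 0 = 0.
Proof.
have [lf _] := asboolW (dualP f).
by have := lf (-1) 0 0; rewrite scaler0 addr0 scaleN1r addNr.
Qed.

Lemma dualZ (f : dual) k v : f (k *: v) = k * f v.
Proof.
have [lf _] := asboolW (dualP f).
by have := lf k v 0; rewrite dual0 !addr0.
Qed.

Lemma dual_norm_ub (f : dual) v : `|v| <= 1 -> `|f v| <= dual_norm f.
Proof.
by move=> v1; apply: (ub_le_sup (dual_norm_has_sup f).2); exists v.
Qed.

Lemma dual_norm_le (f : dual) (M : R) :
  (forall v, `|v| <= 1 -> `|f v| <= M) -> dual_norm f <= M.
Proof.
move=> h; apply: (ge_sup (dual_norm_has_sup f).1) => _ [v /= v1 <-].
exact: h.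
Qed.

Lemma dual_normD (f g : dual) : dual_norm (f + g) <= dual_norm f + dual_norm g.
Proof.
apply: dual_norm_le => v v1.
by rewrite (le_trans (ler_normD _ _))// lerD// dual_norm_ub.
Qed.

Lemma dual_normZ (k : R) (f : dual) : dual_norm (k *: f) = `|k| * dual_norm f.
Proof.
have le1 c (g : dual) : dual_norm (c *: g) <= `|c| * dual_norm g.
  apply: dual_norm_le => v v1.
  by rewrite normrM ler_wpM2l// dual_norm_ub.
apply/eqP; rewrite eq_le le1/=.
have [->|k0] := eqVneq k 0.
  rewrite normr0 mul0r (le_trans (normr_ge0 ((0 *: f : dual) 0)))//.
  by apply: dual_norm_ub; rewrite normr0.
rewrite -ler_pdivlMl ?normr_gt0// -normfV.
by rewrite -{1}[f](@scalerK _ _ k) ?unitfE// le1.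
Qed.

Lemma dual_norm0_eq0 (f : dual) : dual_norm f = 0 -> f = 0.
Proof.
move=> f0; apply: val_inj; apply/funext => v /=.
have [->|v0] := eqVneq v 0; first exact: dual0.
have := @dual_norm_ub f (`|v|^-1 *: v).
rewrite normrZ normfV normr_id mulVf ?normr_eq0// => /(_ (lexx _)).
rewrite f0 normr_le0 dualZ mulf_eq0 invr_eq0 normr_eq0 (negbTE v0)/=.
by move/eqP.
Qed.

HB.instance Definition _ := @Lmodule_isNormed.Build R dual
  dual_norm dual_normD dual_normZ dual_norm0_eq0.

End dual.

Arguments bounded_functional {R} V.

(* The embedding of V into the pivot space H, and the induced map H -> V^*    *)
(* obtained by identifying H with its dual through the inner product.         *)
Section gelfand.
Context {R : realType} (V H : hilbertType R).

Record dense_embedding := DenseEmbedding {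
  embed :> {linear V -> H} ;
  embed_inj : injective embed ;
  embed_continuous : continuous embed ;
  embed_dense : dense (range embed) }.

Lemma inner_normM (x y : H) : `|inner x y| <= `|x| * `|y|.
Proof.
have in0 z : inner (0 : H) z = 0.
  by have := inner_linearl (-1) 0 0 z; rewrite scaler0 addr0 mulN1r addNr.
have inDl (k : R) (a b c : H) :
    inner (a - k *: b) c = inner a c - k * inner b c.
  by rewrite addrC -scaleNr inner_linearl mulNr addrC.
have [->|y0] := eqVneq y 0; first by rewrite innerC in0 !normr0 mulr0.
have ny : 0 < `|y| ^+ 2 by rewrite exprn_gt0// normr_gt0.
set k := inner x y / `|y| ^+ 2.
have : 0 <= `|x - k *: y| ^+ 2 by rewrite exprn_ge0.
rewrite -inner_norm inDl [inner x _]innerC [inner y _]innerC !inDl !inner_norm.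
rewrite [k * `|y| ^+ 2]divfK ?gt_eqF// subrr mulr0 subr0 [inner y x]innerC.
rewrite subr_ge0 /k mulrAC ler_pdivrMr// -expr2 -exprMn -real_normK ?num_real//.
by rewrite ler_pXn2r// nnegrE mulr_ge0.
Qed.

Lemma gelfand_subproof (i : dense_embedding) (h : H) :
  ((fun v => inner h (i v)) : V -> R^o) \in bounded_functional V.
Proof.
apply/asboolP; split.
  by move=> k u v; rewrite linearP innerC inner_linearl !(innerC _ h).
have /linear_boundedP[N [_ /(_ (`|N| + 1))]] : bounded_near i (nbhs (0 : V)).
  by apply: continuous_linear_bounded; exact: embed_continuous.
rewrite (le_lt_trans (ler_norm N)) ?ltrDl// => /(_ isT) iN.
exists (`|h| * (`|N| + 1)) => v.
by rewrite (le_trans (inner_normM _ _))// -mulrA ler_wpM2l.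
Qed.

Definition gelfand (i : dense_embedding) (h : H) : dual V :=
  Dual (gelfand_subproof i h).

End gelfand.

(* Bochner integral: limit of integrals of simple functions approximating the *)
(* integrand in L^1; its value is 0 when the integrand is not integrable.     *)
Section bochner.
Context d (T : measurableType d) (R : realType) (X : normedModType R).
Implicit Types (mu : {measure set T -> \bar R}) (D : set T) (s f : T -> X).

Definition simple s :=
  finite_set (range s) /\ forall x, measurable (s @^-1` [set x]).

Definition strongly_measurable D f :=
  exists2 s : nat -> T -> X, (forall n, simple (s n)) &
    forall t, D t -> s n t @[n --> \oo] --> f t.

Definition integrable_simple mu D s :=
  simple s /\ forall x, x != 0 -> (mu (D `&` s @^-1` [set x]) < +oo)%E.

Definition simple_integral mu D s : X :=
  \sum_(x \in range s) fine (mu (D `&` s @^-1` [set x])) *: x.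

Definition is_bochner mu D f (I : X) :=
  strongly_measurable D f /\
  exists s : nat -> T -> X, [/\ forall n, integrable_simple mu D (s n),
    (\int[mu]_(t in D) (`|f t - s n t|%R)%:E)%E @[n --> \oo] --> 0%E &
    simple_integral mu D (s n) @[n --> \oo] --> I].

Definition bochner mu D f : X := xget 0 (is_bochner mu D f).

End bochner.

(* Finite signed Borel measures on [0, tau] are charges on the Borel line     *)
(* that are concentrated on [0, tau].                                         *)
Section signed_measures.
Context {R : realType}.
Local Notation RT := (measurableTypeR R).
Implicit Types nu : {charge set RT -> \bar R}.

Lemma hahn_pair nu :
  {PN : set RT * set RT | hahn_decomposition nu PN.1 PN.2}.
Proof.
by apply: cid; have [P [N h]] := Hahn_decomposition nu; exists (P, N).
Qed.

Definition positive_part nu : {measure set RT -> \bar R} :=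
  jordan_pos (projT2 (hahn_pair nu)).

Definition negative_part nu : {measure set RT -> \bar R} :=
  jordan_neg (projT2 (hahn_pair nu)).

Definition total_variation nu : {measure set RT -> \bar R} :=
  charge_variation (projT2 (hahn_pair nu)).

Definition in_M (tau : R) nu := total_variation nu (~` `[0, tau]%classic) = 0%E.

Definition in_M0 (tau : R) nu :=
  in_M tau nu /\ total_variation nu [set 0] = 0%E.

Definition normM (tau : R) nu : R := fine (total_variation nu `[0, tau]%classic).

Definition kappa (tau : R) nu (beta : R) : R :=
  fine (\int[total_variation nu]_(s in `[0%R, tau]) (expR (- beta * s))%:E)%E.

Definition charge_bochner (X : normedModType R) nu (D : set RT) (f : RT -> X)
    : X :=
  bochner (positive_part nu) D f - bochner (negative_part nu) D f.

End signed_measures.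

(* Elements of L^2(a, b; X) are given by Borel strongly measurable            *)
(* representatives; their values outside ]a, b[ are irrelevant.               *)
Section L2.
Context {R : realType} (X : normedModType R).
Implicit Types (a b : R) (f : R -> X).

Definition L2 a b f :=
  strongly_measurable (T := measurableTypeR R) `]a, b[ f /\
  (\int[lebesgue_measure]_(t in `]a, b[) (`|f t|%R ^+ 2)%:E < +oo)%E.

Definition L2norm a b f : R :=
  Num.sqrt (fine (\int[lebesgue_measure]_(t in `]a, b[) (`|f t|%R ^+ 2)%:E)%E).

End L2.

Definition test_function {R : realType} (T : R) (phi : R -> R^o) :=
  (forall n t, derivable (derive1n n phi) t 1) /\
  exists a b : R, [/\ 0 < a, b < T & forall t, t \notin `[a, b] -> phi t = 0].

Section W.
Context {R : realType} (V H : hilbertType R) (i : dense_embedding V H) (T : R).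
Implicit Types (u : R -> V) (w : R -> dual V).

Definition is_weak_derivative u w :=
  forall phi, test_function T phi ->
    bochner lebesgue_measure `]0, T[
      (fun t => derive1 phi t *: gelfand i (i (u t))) =
    - bochner lebesgue_measure `]0, T[ (fun t => phi t *: w t).

Definition in_W u :=
  L2 0 T u /\ exists w, L2 0 T w /\ is_weak_derivative u w.

(* Distributional derivatives are unique up to a null set and continuous      *)
(* representatives are unique on [0, T]: the values below, and those of the   *)
(* norms, do not depend on the choice made by xget.                           *)
Definition weak_derivative u : R -> dual V :=
  xget (fun=> 0) [set w | L2 0 T w /\ is_weak_derivative u w].

Definition normW u : R :=
  Num.sqrt (L2norm 0 T u ^+ 2 + L2norm 0 T (weak_derivative u) ^+ 2).

Definition is_continuous_rep u (c : R -> H) :=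
  {within `[0, T], continuous c} /\
  {ae lebesgue_measure, forall t, t \in `]0, T[ -> c t = i (u t)}.

Definition continuous_rep u : R -> H := xget (fun=> 0) (is_continuous_rep u).

Definition normC u : R := sup [set `|continuous_rep u t| | t in `[0, T]].

End W.

Section delay_problem.
Context {R : realType} (V H : hilbertType R) (i : dense_embedding V H).
Context (T tau : R) (A0 A1 : V -> dual V).

(* The Bochner integral exists for almost every t in ]0, T[ when g is in      *)
(* L^2(-tau, T; V).                                                           *)
Definition delay (sigma : {charge set (measurableTypeR R) -> \bar R})
    (g : R -> V) (t : R) : dual V :=
  charge_bochner sigma `[0, tau] (fun s => A1 (g (t - s))).

(* The value at t = 0 is immaterial. *)
Definition joined (psi u : R -> V) (t : R) : V := if t < 0 then psi t else u t.

Definition weak_solution (mu : {charge set (measurableTypeR R) -> \bar R})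
    (u0 : H) (f : R -> dual V) (psi u : R -> V) :=
  [/\ in_W i T u,
      exists2 c, is_continuous_rep i T u c & c 0 = u0 &
      {ae lebesgue_measure, forall t, t \in `]0, T[ ->
        weak_derivative i T u t + A0 (u t) + delay mu (joined psi u) t = f t}].

End delay_problem.

(* Main.v *)
(** The difference w = u_nu - u_mu has zero initial value and zero history, and it
    solves the delay equation with kernel nu and right-hand side
    - K_(nu - mu) u~_mu.  Testing with e^(-2 beta t) w, the splitting
    e^(-beta t) = e^(-beta s) e^(-beta (t - s)) bounds the delay term by
    Lambda1 kappa_nu(beta) |w|^2 in the weighted L^2 norm, which coercivity absorbs
    with margin d_nu = alpha0 - Lambda1 kappa_nu(beta) >= d / 2.  This bounds the
    weighted L^2 norm of w by F / d_nu and sup e^(-beta t) |w(t)|_H by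
    sqrt(alpha0) F / d_nu, where F = Lambda1 |nu - mu| |u~_mu|; the equation then
    bounds the derivative.

    The energy identity |w(t)|^2 = 2 int <w', w> comes from testing the increment of
    w on [r, r + h] with w(r) + w(r + h) and letting h tend to 0, by continuity of
    translations in L^2.

    For the local Lipschitz property, |mu|({0}) = 0 gives kappa_mu(beta) -> 0, hence an
    admissible beta; the estimate with one fixed solution of the ball as reference
    then bounds |u~_nu| uniformly over the ball. *)
Require Import Defs.
From HB Require Import structures.
From mathcomp Require Import all_boot all_order all_algebra.
From mathcomp Require Import all_classical all_reals all_analysis.
From mathcomp Require Import measurable_realfun ring lra.

Import Order.TTheory GRing.Theory Num.Theory.
Import numFieldNormedType.Exports.

Set Implicit Arguments.
Unset Strict Implicit.
Unset Printing Implicit Defensive.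

Local Open Scope classical_set_scope.
Local Open Scope ring_scope.

(** * Bochner integrals with values in a dual space *)

(** The vector-valued equation is always tested with a fixed v, where a Bochner integral in the dual
    becomes a Lebesgue integral; norms come back from bounds uniform in v, so only scalar functions
    of time are estimated. Derivatives and continuous representatives are choices made by [xget], so
    the derivative of a difference is the difference of the derivatives only almost everywhere, and
    separability of V makes the exceptional set independent of v.

    The weight is not really put into the test function, which would need a product rule for
    e^(-beta t) w. The energy identity is proved unweighted; since the primitive of 2 <w', w> is
    |w|^2 >= 0 and the weight decreases, integration by parts then inserts the weight with a
    favourable sign.

    Everything is extended by zero to the whole line, where Tonelli and translation invariance hold
    without boundary terms. In the constant, 2 comes from d_nu >= d / 2 and e^(beta T) is the price
    of removing the weight on [0, T]. *)

Section strong_measurability.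
Context d (T : measurableType d) (R : realType).

(** Finiteness of the two ranges replaces any regularity of [G], so that [G] can be the
    discontinuous truncation used in [simple_approximation]. *)
Lemma simple_comp2 (X Y Z : normedModType R) (G : X -> Y -> Z)
    (s1 : T -> X) (s2 : T -> Y) :
  simple s1 -> simple s2 -> simple (fun t => G (s1 t) (s2 t)).
Proof.
move=> [f1 m1] [f2 m2]; split.
  apply: (@sub_finite_set _ _ [set G x y | x in range s1 & y in range s2]).
    by move=> _ [t _ <-]; exists (s1 t) => //; exists (s2 t).
  exact: finite_image2.
move=> z.
pose I := (range s1 `*` range s2) `&` [set p | G p.1 p.2 = z].
have -> : (fun t => G (s1 t) (s2 t)) @^-1` [set z] =
    \bigcup_(p in I) (s1 @^-1` [set p.1] `&` s2 @^-1` [set p.2]).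
  apply/seteqP; split => [t /= tz|t [[x y] [_ /= xyz] [/= -> ->]]//].
  by exists (s1 t, s2 t) => //; split.
apply: fin_bigcup_measurable.
  by apply: sub_finite_set (finite_setX f1 f2) => ? [].
by move=> p _; apply: measurableI.
Qed.

Lemma strongly_measurable_comp2 (X Y Z : normedModType R) (G : X -> Y -> Z)
    (D : set T) (f : T -> X) (g : T -> Y) :
  continuous (fun p : X * Y => G p.1 p.2) ->
  strongly_measurable D f -> strongly_measurable D g ->
  strongly_measurable D (fun t => G (f t) (g t)).
Proof.
move=> cG [s ss sf] [r sr rg]; exists (fun n t => G (s n t) (r n t)).
  by move=> n; exact: simple_comp2.
move=> t Dt; apply: (@continuous2_cvg _ _ _ _ _ _ _ _ G);
  [exact: (cG (f t, g t))|exact: sf|exact: rg].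
Qed.

Lemma strongly_measurable_comp (X Y : normedModType R) (G : X -> Y)
    (D : set T) (f : T -> X) :
  continuous G -> strongly_measurable D f -> strongly_measurable D (G \o f).
Proof.
move=> cG mf; apply: (@strongly_measurable_comp2 X X Y (fun x _ => G x) _ f f) => //.
by move=> p; apply: (@continuous_comp _ _ _ fst); [exact: cvg_fst|exact: cG].
Qed.

Lemma strongly_measurableS (X : normedModType R) (D E : set T) (f : T -> X) :
  E `<=` D -> strongly_measurable D f -> strongly_measurable E f.
Proof. by move=> ED [s ss sf]; exists s => // t /ED; exact: sf. Qed.

Lemma eq_strongly_measurable (X : normedModType R) (D : set T) (f g : T -> X) :
  {in D, f =1 g} -> strongly_measurable D f -> strongly_measurable D g.
Proof.
by move=> fg [s ss sf]; exists s => // t Dt; rewrite -fg ?inE//; exact: sf.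
Qed.

Lemma simple_cst (X : normedModType R) (x : X) : simple (cst x : T -> X).
Proof.
split; first by apply: sub_finite_set (finite_set1 x) => _ [t _ <-].
by move=> y; rewrite preimage_cst; case: ifP.
Qed.

Lemma simple_ifset (X : normedModType R) (D : set T) (f g : T -> X) :
  measurable D -> simple f -> simple g ->
  simple (fun t => if t \in D then f t else g t).
Proof.
move=> mD [ff mf] [fg mg]; split.
  apply: (@sub_finite_set _ _ (range f `|` range g)); last by rewrite finite_setU.
  by move=> _ [t _ <-]; case: ifPn => _; [left|right]; exists t.
move=> x; rewrite (_ : _ @^-1` _ = (D `&` f @^-1` [set x]) `|`
    (~` D `&` g @^-1` [set x])).
  by apply: measurableU; apply: measurableI => //; exact: measurableC.
apply/seteqP; split => t /=.
  by case: ifPn => [/set_mem|/negP tD]; [left|right; split => // /mem_set].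
by move=> [[Dt <-]|[Dt <-]]; [rewrite mem_set|rewrite memNset].
Qed.

Lemma strongly_measurable_cst (X : normedModType R) (D : set T) (x : X) :
  strongly_measurable D (cst x).
Proof.
by exists (fun=> cst x) => [n|t _]; [exact: simple_cst|exact: cvg_cst].
Qed.

Lemma strongly_measurable_ifset (X : normedModType R) (D E : set T)
    (f g : T -> X) : measurable D ->
  strongly_measurable (E `&` D) f -> strongly_measurable (E `\` D) g ->
  strongly_measurable E (fun t => if t \in D then f t else g t).
Proof.
move=> mD [s ss sf] [r sr rg].
exists (fun n t => if t \in D then s n t else r n t) => [n|t Et].
  exact: simple_ifset.
case: ifPn => [/set_mem Dt|/negP tD]; first exact: sf.
by apply: rg; split => // /mem_set.
Qed.

(** Turns an element of L^2 on an interval into a function on the whole line with the same norm,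
    ready for translations and Tonelli. *)
Definition zext (X : normedModType R) (D : set T) (f : T -> X) (t : T) : X :=
  if t \in D then f t else 0.

Lemma zext_in (X : normedModType R) (D : set T) (f : T -> X) t :
  D t -> zext D f t = f t.
Proof. by move=> Dt; rewrite /zext mem_set. Qed.

Lemma zext_out (X : normedModType R) (D : set T) (f : T -> X) t :
  ~ D t -> zext D f t = 0.
Proof. by move=> Dt; rewrite /zext memNset. Qed.

Lemma strongly_measurable_zext (X : normedModType R) (D : set T) (f : T -> X) :
  measurable D -> strongly_measurable D f ->
  strongly_measurable setT (zext D f).
Proof.
move=> mD mf; apply: strongly_measurable_ifset => //; first by rewrite setTI.
exact: strongly_measurable_cst.
Qed.

Lemma integral_zext_sqr (X : normedModType R) (mu : {measure set T -> \bar R})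
    (D : set T) (f : T -> X) :
  (\int[mu]_t (`|zext D f t| ^+ 2)%:E = \int[mu]_(t in D) (`|f t| ^+ 2)%:E)%E.
Proof.
rewrite [RHS]integral_mkcond; apply: eq_integral => t _; rewrite !patchE /zext.
by case: ifP => // _; rewrite normr0 expr0n.
Qed.

Lemma simple_measurable (s : T -> R^o) : simple s ->
  measurable_fun setT (s : T -> R).
Proof.
move=> [fs ms] _ A mA; rewrite setTI.
have -> : s @^-1` A = \bigcup_(x in range s `&` A) s @^-1` [set x].
  by apply/seteqP; split => [t At|t [x [_ Ax] /= ->]//]; exists (s t).
apply: fin_bigcup_measurable => [|x _]; last exact: ms.
by apply: sub_finite_set fs => ? [].
Qed.

Lemma strongly_measurable_measurable (D : set T) (f : T -> R^o) : measurable D ->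
  strongly_measurable D f -> measurable_fun D (f : T -> R).
Proof.
move=> mD [s ss sf]; apply: (measurable_fun_cvg (h := s)) => [n|t Dt].
  by apply: measurable_funTS; exact: simple_measurable.
exact: sf.
Qed.

Import HBSimple.
Lemma measurable_strongly_measurable (D : set T) (f : T -> R) : measurable D ->
  measurable_fun D f -> strongly_measurable D (f : T -> R^o).
Proof.
move=> mD /measurable_EFinP/(approximation_sfun mD)[g gf].
exists (fun n => g n : T -> R^o) => [n|t Dt].
  split; first exact: fimfunP.
  by move=> x; exact: measurable_sfunP.
have := gf _ Dt; exact: fine_cvg.
Qed.

Lemma strongly_measurable_norm (X : normedModType R) (D : set T) (f : T -> X) :
  measurable D -> strongly_measurable D f ->
  measurable_fun D (fun t => `|f t|).
Proof.
move=> mD mf; apply: strongly_measurable_measurable => //.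
apply: (@strongly_measurable_comp _ R^o (@Num.norm _ X)) => //.
exact: norm_continuous.
Qed.

Lemma strongly_measurableB (X : normedModType R) (D : set T) (f g : T -> X) :
  strongly_measurable D f -> strongly_measurable D g ->
  strongly_measurable D (f \- g).
Proof.
apply: (@strongly_measurable_comp2 _ _ _ (fun x y => x - y)) => p.
by apply: continuousB; [exact: cvg_fst|exact: cvg_snd].
Qed.

Lemma strongly_measurableZ (X : normedModType R) (D : set T) (k : T -> R)
    (f : T -> X) : measurable D -> measurable_fun D k ->
  strongly_measurable D f -> strongly_measurable D (fun t => k t *: f t).
Proof.
move=> mD mk mf.
apply: (@strongly_measurable_comp2 R^o _ _ (fun x y => x *: y)) => //.
  by move=> p; apply: continuousZ; [exact: cvg_fst|exact: cvg_snd].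
exact: measurable_strongly_measurable.
Qed.

End strong_measurability.

Lemma strongly_measurable_precomp d d' (T : measurableType d)
    (T' : measurableType d') (R : realType) (X : normedModType R)
    (h : T' -> T) (D : set T) (f : T -> X) : measurable_fun setT h ->
  strongly_measurable D f -> strongly_measurable (h @^-1` D) (f \o h).
Proof.
move=> mh [s ss sf]; exists (fun n => s n \o h) => [n|t Dt]; last exact: sf.
have [fs ms] := ss n; split.
  by apply: sub_finite_set fs => _ [t _ <-]; exists (h t).
by move=> x; rewrite comp_preimage -[_ @^-1` _]setTI; apply: mh => //; exact: ms.
Qed.

Section lipschitz.
Context (R : realType) (X Y : normedModType R) (G : X -> Y).

Lemma lipschitz_continuous (M : R) : 0 <= M ->
  (forall x y, `|G x - G y| <= M * `|x - y|) -> continuous G.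
Proof.
move=> M0 lG x; apply/cvgrPdist_lt => e e0.
have M1 : 0 < M + 1 by rewrite ltr_wpDl.
near=> y.
rewrite (le_lt_trans (lG _ _))// (@le_lt_trans _ _ ((M + 1) * `|x - y|))//.
  by rewrite ler_wpM2r// lerDl.
rewrite mulrC -ltr_pdivlMr//; near: y.
by apply: cvgr_dist_lt; [exact: cvg_id|exact: divr_gt0].
Unshelve. all: by end_near. Qed.

Lemma continuous_cvg_seq (s : nat -> X) (x : X) : continuous G ->
  s n @[n --> \oo] --> x -> G (s n) @[n --> \oo] --> G x.
Proof. by move=> cG sx; apply: (cvg_comp _ _ sx); exact: cG. Qed.

End lipschitz.

Section dual_theory.
Context (R : realType) (V : normedModType R).

Lemma dualB (f g : dual V) v : (f - g) v = f v - g v.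
Proof. by []. Qed.

Lemma dual_addr (f : dual V) v w : f (v + w) = f v + f w.
Proof.
have [lf _] := asboolW (dualP f).
by have := lf 1 v w; rewrite !scale1r.
Qed.

Lemma dual_oppr (f : dual V) v : f (- v) = - f v.
Proof. by rewrite -scaleN1r dualZ mulN1r. Qed.

Lemma dual_subr (f : dual V) v w : f (v - w) = f v - f w.
Proof. by rewrite dual_addr dual_oppr. Qed.

Lemma dual_sum (I : Type) (r : seq I) (P : pred I) (F : I -> dual V) v :
  (\sum_(i <- r | P i) F i) v = \sum_(i <- r | P i) F i v.
Proof. by elim/big_rec2 : _ => //= i y x _ <-. Qed.

Lemma le_dual_norm (f : dual V) v : `|f v| <= `|f| * `|v|.
Proof.
have [->|v0] := eqVneq v 0; first by rewrite dual0 !normr0 mulr0.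
rewrite -ler_pdivrMr ?normr_gt0// mulrC -[X in X * _](ger0_norm (x := `|v|^-1))//.
rewrite -normrM -dualZ; apply: dual_norm_ub.
by rewrite normrZ normfV normr_id mulVf// normr_eq0.
Qed.

Lemma dual_norm_le_mul (f : dual V) (M : R) : 0 <= M ->
  (forall v, `|f v| <= M * `|v|) -> `|f| <= M.
Proof.
move=> M0 h; apply: dual_norm_le => v v1.
by rewrite (le_trans (h v))// ler_piMr.
Qed.

Lemma dual_continuous (f : dual V) : continuous (f : V -> R^o).
Proof.
apply: (@lipschitz_continuous _ _ _ _ `|f|) => // v w.
by rewrite -dual_subr le_dual_norm.
Qed.

Lemma dual_app_continuous (v : V) : continuous (fun g : dual V => g v : R^o).
Proof.
apply: (@lipschitz_continuous _ _ _ _ `|v|) => // f g.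
by rewrite (_ : f v - g v = (f - g) v)// mulrC le_dual_norm.
Qed.

(** Joint continuity is what makes t -> <w(t), u(t)> measurable for strongly measurable [w] and
    [u]. *)
Lemma dual_pairing_continuous :
  continuous (fun p : dual V * V => p.1 p.2 : R^o).
Proof.
move=> [f v]; have cf : fst q @[q --> (f, v)] --> f by exact: cvg_fst.
have cv : snd q @[q --> (f, v)] --> v by exact: cvg_snd.
move/cvgrPdist_lt in cf; move/cvgrPdist_lt in cv.
apply/cvgrPdist_lt => e e0 /=; near=> p.
(* One variable moves at a time; the mixed term is quadratically small, so |f - p.1| < 1 is enough
   for it. *)
have -> : f v - p.1 p.2 = (f - p.1) v + ((p.1 - f) (v - p.2) + f (v - p.2)).
  by rewrite !dualB !dual_subr; ring.
have f1 : 0 < `|f| + 1 by rewrite ltr_wpDl.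
have v1 : 0 < `|v| + 1 by rewrite ltr_wpDl.
have fp : `|f - p.1| < e / 3 / (`|v| + 1).
  near: p; apply: cf.
  by rewrite !divr_gt0.
have fp1 : `|f - p.1| < 1.
  by near: p; apply: cf.
have vp1 : `|v - p.2| < e / 3 / (`|f| + 1).
  near: p; apply: cv.
  by rewrite !divr_gt0.
have vp : `|v - p.2| < e / 3.
  near: p; apply: cv.
  by rewrite divr_gt0.
have h1 : `|(f - p.1) v| < e / 3.
  rewrite (le_lt_trans (le_dual_norm _ _))//.
  rewrite (@le_lt_trans _ _ (`|f - p.1| * (`|v| + 1)))//.
    by rewrite ler_wpM2l// lerDl.
  by rewrite -ltr_pdivlMr.
have h2 : `|(p.1 - f) (v - p.2)| < e / 3.
  rewrite (le_lt_trans (le_dual_norm _ _))//.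
  rewrite (le_lt_trans _ vp)// distrC ler_piMl//; exact: ltW.
have h3 : `|f (v - p.2)| < e / 3.
  rewrite (le_lt_trans (le_dual_norm _ _))//.
  rewrite (@le_lt_trans _ _ ((`|f| + 1) * `|v - p.2|))//.
    by rewrite ler_wpM2r// lerDl.
  by rewrite mulrC -ltr_pdivlMr.
rewrite (le_lt_trans (ler_normD _ _))//.
have := ler_normD ((p.1 - f) (v - p.2)) (f (v - p.2)).
lra.
Unshelve. all: by end_near. Qed.

End dual_theory.

(** * Bochner integrals in the dual, computed by testing *)

Section bochner_dual.
Context d (T : measurableType d) (R : realType) (V : normedModType R).
Variables (mu : {measure set T -> \bar R}) (D : set T).
Hypotheses (mD : measurable D) (muD : (mu D < +oo)%E).

Lemma integrable_simple_finite (X : normedModType R) (s : T -> X) :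
  simple s -> integrable_simple mu D s.
Proof.
move=> ss; split=> // x _; rewrite (le_lt_trans _ muD)//.
by apply: le_measure; rewrite ?inE//; apply: measurableI => //; exact: ss.2.
Qed.

Lemma simple_integral_dual (s : T -> dual V) v : simple s ->
  simple_integral mu D s v = \int[mu]_(t in D) s t v.
Proof.
move=> [fs ms]; rewrite /simple_integral fsbig_finite//= dual_sum.
rewrite /Rintegral.
have fin x : mu (D `&` s @^-1` [set x]) \is a fin_num.
  rewrite ge0_fin_numE//; have [_ h] := integrable_simple_finite (conj fs ms).
  rewrite (le_lt_trans _ muD)//.
  by apply: le_measure; rewrite ?inE//; apply: measurableI => //; exact: ms.
pose r := finmap.enum_fset (fset_set (range s)).
have ur : uniq r by exact: finmap.fset_uniq.
have intx (x : dual V) : mu.-integrable D (fun t => (x v)%:E * (\1_(s @^-1` [set x]) t)%:E)%E.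
  apply: integrableZl => //; apply/integrableP; split.
    by apply/measurable_EFinP; apply: measurable_indic; exact: ms.
  under eq_integral do rewrite /= ger0_norm//.
  rewrite integral_indic//= setIC (le_lt_trans _ muD)//.
  by apply: le_measure; rewrite ?inE//; apply: measurableI => //; exact: ms.
transitivity (fine (\int[mu]_(t in D)
    (\sum_(x <- r) ((x v)%:E * (\1_(s @^-1` [set x]) t)%:E)))%E).
  rewrite integral_sum//=.
  have E (x : dual V) : (\int[mu]_(t in D) ((x v)%:E * (\1_(s @^-1` [set x]) t)%:E) =
      (x v)%:E * mu (D `&` s @^-1` [set x]))%E.
    rewrite integralZl//=; first by rewrite integral_indic//= setIC.
    apply/integrableP; split.
      by apply/measurable_EFinP; apply: measurable_indic; exact: ms.
    under eq_integral do rewrite /= ger0_norm//.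
    by rewrite integral_indic//= setIC -ge0_fin_numE.
  under [in RHS]eq_bigr do rewrite E.
  rewrite -sum_fine => [|x _]; last by rewrite fin_numM.
  by apply: eq_bigr => x _; rewrite fineM//= mulrC.
congr fine; apply: eq_integral => t tD.
have str : s t \in r by rewrite in_fset_set// inE; exists t.
rewrite (bigD1_seq (s t))//= big1 ?adde0 => [|x xst].
  by rewrite indicE mem_set// mule1.
by rewrite indicE memNset ?mule0//= => /esym; exact/eqP.
Qed.

Lemma integrable_dual_app (f : T -> dual V) v : strongly_measurable D f ->
  (\int[mu]_(t in D) `|f t|%:E < +oo)%E ->
  mu.-integrable D (fun t => (f t v)%:E).
Proof.
move=> mf intf; have mfv : measurable_fun D (fun t => f t v).
  apply: strongly_measurable_measurable => //.
  exact: (@strongly_measurable_comp _ _ _ _ R^o (fun g : dual V => g v)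
    _ _ (@dual_app_continuous _ _ v)).
have mnf := strongly_measurable_norm mD mf.
apply/integrableP; split; first exact/measurable_EFinP.
apply: (@le_lt_trans _ _ (\int[mu]_(t in D) ((`|v|)%:E * `|f t|%:E))%E).
  apply: ge0_le_integral => //=.
  - by apply/measurable_EFinP; exact: measurableT_comp.
  - by apply: measurable_funeM; exact/measurable_EFinP.
  - by move=> t _; rewrite -EFinM lee_fin mulrC le_dual_norm.
rewrite ge0_integralZl//=; first by rewrite lte_mul_pinfty// lee_fin.
  exact/measurable_EFinP.
Qed.

(** The error is the L^1 distance times |v|. Being uniform in v, it serves both to identify a
    Bochner integral and to prove convergence in the dual norm. *)
Lemma simple_integral_dist (f : T -> dual V) (s : T -> dual V) v :
  strongly_measurable D f -> (\int[mu]_(t in D) `|f t|%:E < +oo)%E ->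
  simple s -> (\int[mu]_(t in D) `|f t - s t|%:E < +oo)%E ->
  `|\int[mu]_(t in D) f t v - simple_integral mu D s v| <=
    fine (\int[mu]_(t in D) `|f t - s t|%:E)%E * `|v|.
Proof.
move=> mf intf ss intfs; rewrite simple_integral_dual//.
have ms : strongly_measurable D s by exists (fun=> s) => // t _; exact: cvg_cst.
have mfs := strongly_measurableB mf ms.
have ifs := integrable_dual_app v mfs intfs.
have if' := integrable_dual_app v mf intf.
have is' : mu.-integrable D (fun t => (s t v)%:E).
  rewrite (_ : (fun _ => _) = (fun t => (f t v)%:E - ((f \- s) t v)%:E)%E).
    exact: integrableB.
  apply/funext => t; rewrite -EFinB; congr EFin.
  by rewrite (dualB (f t) (s t)) opprB addrC subrK.
rewrite -RintegralB//.
rewrite (_ : (fun _ => _) = (fun t => (f \- s) t v)); last first.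
  by apply/funext => t; rewrite (dualB (f t) (s t)).
rewrite (le_trans (le_normr_Rintegral _ ifs))//.
have -> : fine (\int[mu]_(t in D) `|f t - s t|%:E)%E = \int[mu]_(t in D) `|f t - s t|.
  by [].
have iN : mu.-integrable D (fun t => (`|f t - s t|)%:E).
  apply/integrableP; split.
    by apply/measurable_EFinP; exact: (strongly_measurable_norm mD mfs).
  by under eq_integral do rewrite /= normr_id.
rewrite -RintegralZr//; apply: le_Rintegral => //.
- exact: integrable_norm.
- rewrite (_ : (_ \o _) = (fun t => (`|v|)%:E * (`|f t - s t|)%:E)%E).
    exact: integrableZl.
  by apply/funext => t; rewrite /= -EFinM mulrC.
- by move=> t _; exact: le_dual_norm.
Qed.

Lemma is_bochner_dual (f : T -> dual V) (I : dual V) v :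
  (\int[mu]_(t in D) `|f t|%:E < +oo)%E -> is_bochner mu D f I ->
  I v = \int[mu]_(t in D) f t v.
Proof.
move=> intf [mf [s [ss sf sI]]].
have c1 : simple_integral mu D (s n) v @[n --> \oo] --> (I v : R^o).
  exact: (continuous_cvg_seq (@dual_app_continuous _ _ v) sI).
suff : simple_integral mu D (s n) v @[n --> \oo] --> \int[mu]_(t in D) f t v.
  by apply: cvg_unique c1; exact: Rhausdorff.
apply/cvgrPdist_le => e e0.
have /fine_cvgP[fin /cvgr0Pnorm_le cv] := sf.
have ev : 0 < e / (`|v| + 1) by rewrite divr_gt0// ltr_wpDl.
near=> n.
have fn : (\int[mu]_(t in D) `|f t - s n t|%:E)%E \is a fin_num.
  by near: n; exact: fin.
rewrite (le_trans (simple_integral_dist _ _ _ _ _))//.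
  exact: (ss n).1.
  by rewrite ltey_eq fn.
have : fine (\int[mu]_(t in D) `|f t - s n t|%:E)%E <= e / (`|v| + 1).
  rewrite -[leLHS]ger0_norm ?fine_ge0 ?integral_ge0//.
  by near: n; exact: cv.
move=> h; rewrite (le_trans (ler_wpM2r _ h))// -mulrA ler_piMr//; first exact: ltW.
by rewrite mulrC ler_pdivrMr ?mul1r ?lerDl// ltr_wpDl.
Unshelve. all: by end_near. Qed.

(** Supplies the candidate for the Bochner integral directly as a functional, so that existence does
    not go through Cauchy sequences in the dual. *)
Lemma Rintegral_dual_linear (f : T -> dual V) : strongly_measurable D f ->
  (\int[mu]_(t in D) `|f t|%:E < +oo)%E ->
  (fun v => \int[mu]_(t in D) f t v) \in bounded_functional V.
Proof.
move=> mf intf; apply/asboolP; split.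
  move=> k v w /=; rewrite -[X in _ = X + _]/(k * _).
  rewrite -RintegralZl//; last exact: integrable_dual_app.
  rewrite -RintegralD//=; first last.
  - exact: integrable_dual_app.
  - rewrite (_ : _ \o _ = (fun t => k%:E * (f t v)%:E)%E)//.
    by apply: integrableZl => //; exact: integrable_dual_app.
  by congr fine; apply: eq_integral => t _; rewrite dual_addr dualZ.
exists (\int[mu]_(t in D) `|f t|) => v.
have iN : mu.-integrable D (fun t => (`|f t|)%:E).
  apply/integrableP; split.
    by apply/measurable_EFinP; exact: strongly_measurable_norm.
  by under eq_integral do rewrite /= normr_id.
rewrite (le_trans (le_normr_Rintegral _ (integrable_dual_app _ mf intf)))//.
rewrite -RintegralZr//; apply: le_Rintegral => //.
- by apply: integrable_norm; exact: integrable_dual_app.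
- rewrite (_ : (_ \o _) = (fun t => (`|v|)%:E * (`|f t|)%:E)%E).
    exact: integrableZl.
  by apply/funext => t; rewrite /= -EFinM mulrC.
- by move=> t _; exact: le_dual_norm.
Qed.

Import HBNNSimple.
(** Strong measurability gives simple approximants without a majorant, which dominated convergence
    requires. They are cut to 0 where they exceed twice a simple minorant [a n] of |f|; since |s_n|
    and [a n] both tend to |f|, the cut is eventually inactive wherever f is nonzero. *)
Lemma simple_approximation (X : normedModType R) (f : T -> X) :
  strongly_measurable D f ->
  exists s : nat -> T -> X, [/\ forall n, simple (s n),
    forall n t, D t -> `|s n t| <= 2 * `|f t| &
    forall t, D t -> s n t @[n --> \oo] --> f t].
Proof.
move=> mf; have [s ss sf] := mf.
have /measurable_EFinP mnf := strongly_measurable_norm mD mf.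
have nf0 t : D t -> (0%R%:E <= (`|f t|%R)%:E)%E by rewrite lee_fin.
pose a := nnsfun_approx mD mnf.
exists (fun n t => if `|s n t| <= 2 * a n t then s n t else 0); split => [n|n t Dt|t Dt].
- apply: (@simple_comp2 _ _ _ X R^o X (fun x y => if `|x| <= 2 * y then x else 0)) => //.
- have h : a n t <= `|f t|.
    rewrite -lee_fin /a nnsfun_approxE.
    exact: (@le_approx _ _ _ _ (fun t => (`|f t|)%:E)).
  case: ifPn => [/le_trans -> //|_]; rewrite ?ler_wpM2l//.
  by rewrite normr0 mulr_ge0.
have ca : a n t @[n --> \oo] --> `|f t|.
  by have := cvg_nnsfun_approx mD mnf nf0 Dt; exact: fine_cvg.
have cs := sf _ Dt.
have [f0|f0] := eqVneq (f t) 0.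
  rewrite f0; apply/cvgr0Pnorm_le => e e0; near=> n.
  case: ifPn => [_|_]; last by rewrite normr0 ltW.
  near: n; move: cs; rewrite f0 => /cvgr0Pnorm_le; exact.
have fp : 0 < `|f t| / 2 by rewrite divr_gt0// normr_gt0.
apply: cvg_trans (cs); apply: near_eq_cvg; near=> n.
rewrite ifT//.
have h1 : `|f t - s n t| < `|f t| / 2 by near: n; move/cvgrPdist_lt : cs; exact.
have h2 : `| `|f t| - a n t| < `|f t| / 2 / 2.
  by near: n; move/cvgrPdist_lt : ca; apply; rewrite divr_gt0.
have := ler_normB (s n t - f t) (- f t).
rewrite opprK subrK normrN distrC => h3.
have := ler_norm (`|f t| - a n t).
lra.
Unshelve. all: by end_near. Qed.

Lemma is_bochner_dual_exists (f : T -> dual V) : strongly_measurable D f ->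
  (\int[mu]_(t in D) `|f t|%:E < +oo)%E -> exists I, is_bochner mu D f I.
Proof.
move=> mf intf; have [s [ss sle sf]] := simple_approximation mf.
exists (Dual (Rintegral_dual_linear mf intf)); split=> //; exists s.
have mnf := strongly_measurable_norm mD mf.
have msn n : strongly_measurable D (s n).
  by exists (fun=> s n) => // t _; exact: cvg_cst.
have mfs n := strongly_measurable_norm mD (strongly_measurableB mf (msn n)).
(* The majorant of |f - s_n|, from |s_n| <= 2 |f|. *)
have iN : mu.-integrable D (fun t => (3 * `|f t|)%:E).
  rewrite (_ : (fun _ => _) = (fun t => 3%:E * (`|f t|)%:E)%E); last first.
    by apply/funext => t; rewrite EFinM.
  apply: integrableZl => //; apply/integrableP; split.
    exact/measurable_EFinP.
  by under eq_integral do rewrite /= normr_id.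
have dom n t : D t -> (`|(`|f t - s n t|)%:E| <= (3 * `|f t|)%:E)%E.
  move=> Dt; rewrite /= normr_id lee_fin (le_trans (ler_normB _ _))//.
  have := sle n t Dt; lra.
have c0 : (\int[mu]_(t in D) (`|f t - s n t|)%:E)%E @[n --> \oo] --> 0%E.
  rewrite -[X in _ --> X](integral0 mu D).
  apply: (dominated_cvg mD (g := fun t => (3 * `|f t|)%:E)) => //.
    by move=> n; apply/measurable_EFinP; exact: mfs.
  move=> t Dt; apply/fine_cvgP; split; first by near=> n.
  apply/cvgr0Pnorm_le => e e0; near=> n; rewrite /= normr_id.
  by near: n; move/cvgrPdist_le : (sf _ Dt); exact.
have lt n : (\int[mu]_(t in D) (`|f t - s n t|)%:E < +oo)%E.
  move/integrableP : iN => [_]; apply: le_lt_trans.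
  apply: ge0_le_integral => //=.
  - by apply/measurable_EFinP; exact: mfs.
  - by apply/measurable_EFinP; apply: measurableT_comp => //; exact: measurable_funM.
  - move=> t Dt; have := dom n t Dt; rewrite /= normr_id => /le_trans; apply.
    by rewrite lee_fin ler_norm.
split => //; first by move=> n; exact: integrable_simple_finite.
apply/cvgrPdist_le => e e0.
have /fine_cvgP[_ /cvgr0Pnorm_le cv] := c0.
near=> n; have h : fine (\int[mu]_(t in D) (`|f t - s n t|)%:E)%E <= e.
  by rewrite (le_trans (ler_norm _))//; near: n; exact: cv.
apply: dual_norm_le_mul; first exact: ltW.
move=> v; rewrite dualB (le_trans (simple_integral_dist _ _ _ _ _))//.
by rewrite ler_wpM2r.
Unshelve. all: by end_near. Qed.

(** The bridge to scalar integration: through it the Bochner integrals in the weak derivative and in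
    the delay operator are read as Lebesgue integrals. *)
Lemma bochner_dualE (f : T -> dual V) v : strongly_measurable D f ->
  (\int[mu]_(t in D) `|f t|%:E < +oo)%E ->
  bochner mu D f v = \int[mu]_(t in D) f t v.
Proof.
move=> mf intf; apply: is_bochner_dual => //; rewrite /bochner.
have [I hI] := is_bochner_dual_exists mf intf.
exact: (xgetPex 0 (ex_intro _ I hI)).
Qed.

End bochner_dual.

(** * Delayed products and signed measures *)

Section cauchy_schwarz.
Context d (T : measurableType d) (R : realType).
Variables (mu : {measure set T -> \bar R}) (D : set T).
Hypothesis (mD : measurable D).

(** Young's inequality with weights G / F and F / G divides by quantities that may vanish; they are
    perturbed by a positive e, which is removed here. *)
Lemma lee_mul_eps (x : \bar R) (F G : R) : 0 <= F -> 0 <= G ->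
  (forall e, 0 < e -> (x <= ((F + e) * (G + e))%:E)%E) -> (x <= (F * G)%:E)%E.
Proof.
move=> F0 G0 h; apply/lee_addgt0Pr => e e0.
(* As c <= 1, (F + c) (G + c) exceeds F G by at most c (F + G + 1). *)
pose c := Num.min 1 (e / (F + G + 1)).
have FG : 0 < F + G + 1 by rewrite ltr_wpDl// addr_ge0.
have c0 : 0 < c by rewrite lt_min ltr01 divr_gt0.
apply: le_trans (h c c0) _; rewrite -EFinD lee_fin.
have c1 : c <= 1 by rewrite ge_min lexx.
have ce : c * (F + G + 1) <= e by rewrite -ler_pdivlMr// ge_min lexx orbT.
nra.
Qed.

Lemma cauchy_schwarz_le (f g : T -> R) (F G : R) :
  measurable_fun D f -> measurable_fun D g ->
  (forall t, D t -> 0 <= f t) -> (forall t, D t -> 0 <= g t) ->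
  0 <= F -> 0 <= G ->
  (\int[mu]_(t in D) (f t ^+ 2)%:E <= (F ^+ 2)%:E)%E ->
  (\int[mu]_(t in D) (g t ^+ 2)%:E <= (G ^+ 2)%:E)%E ->
  (\int[mu]_(t in D) (f t * g t)%:E <= (F * G)%:E)%E.
Proof.
move=> mf mg f0 g0 F0 G0 hF hG; apply: lee_mul_eps => // e e0.
have Fe : 0 < F + e by rewrite ltr_wpDl.
have Ge : 0 < G + e by rewrite ltr_wpDl.
(* These weights make each of the two halves equal to (F + e) (G + e) / 2. *)
pose a := (G + e) / (F + e) / 2; pose b := (F + e) / (G + e) / 2.
have a0 : 0 <= a by rewrite !divr_ge0// ltW.
have b0 : 0 <= b by rewrite !divr_ge0// ltW.
have mf2 : measurable_fun D (fun t => f t ^+ 2) by exact: measurable_funX.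
have mg2 : measurable_fun D (fun t => g t ^+ 2) by exact: measurable_funX.
apply: (@le_trans _ _ (\int[mu]_(t in D)
    (a%:E * (f t ^+ 2)%:E + b%:E * (g t ^+ 2)%:E))%E).
  apply: ge0_le_integral => //.
  - by move=> t Dt; rewrite lee_fin mulr_ge0 ?f0 ?g0.
  - by apply/measurable_EFinP; exact: measurable_funM.
  - by apply: emeasurable_funD; apply: measurable_funeM; exact/measurable_EFinP.
  - move=> t Dt; rewrite -!EFinM -EFinD lee_fin.
    have -> : a * f t ^+ 2 + b * g t ^+ 2 = f t * g t +
        (2 * (F + e) * (G + e))^-1 * ((G + e) * f t - (F + e) * g t) ^+ 2.
      by rewrite /a /b; field; rewrite ?gt_eqF.
    by rewrite lerDl mulr_ge0 ?sqr_ge0// invr_ge0 !mulr_ge0 ?ltW.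
rewrite ge0_integralD//=; first last.
- by apply: measurable_funeM; exact/measurable_EFinP.
- by move=> t Dt; rewrite mule_ge0 ?lee_fin ?sqr_ge0.
- by apply: measurable_funeM; exact/measurable_EFinP.
- by move=> t Dt; rewrite mule_ge0 ?lee_fin ?sqr_ge0.
rewrite !ge0_integralZl_EFin//=; last 4 first.
- by move=> t Dt; rewrite lee_fin sqr_ge0.
- exact/measurable_EFinP.
- by move=> t Dt; rewrite lee_fin sqr_ge0.
- exact/measurable_EFinP.
apply: (@le_trans _ _ (a%:E * ((F + e) ^+ 2)%:E + b%:E * ((G + e) ^+ 2)%:E)%E).
  apply: leeD; apply: lee_wpmul2l; rewrite ?lee_fin//.
    by apply: le_trans hF _; rewrite lee_fin; nra.
  by apply: le_trans hG _; rewrite lee_fin; nra.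
rewrite -!EFinM -EFinD lee_fin le_eqVlt; apply/orP; left; apply/eqP.
by rewrite /a /b; field; rewrite ?gt_eqF.
Qed.

End cauchy_schwarz.

Section translation.
Context (R : realType).
Local Notation mu := (@lebesgue_measure R).

(** The image of Lebesgue measure under a translation agrees with it on half-open intervals, hence
    equals it by uniqueness. *)
Lemma ge0_integral_translate (f : R -> \bar R) (a : R) :
  measurable_fun [set: R] f -> (forall x, (0 <= f x)%E) ->
  (\int[mu]_x f (x + a)%R = \int[mu]_x f x)%E.
Proof.
move=> mf f0.
pose tr (x : measurableTypeR R) : measurableTypeR R := x + a.
have mtr : measurable_fun [set: measurableTypeR R] tr by exact: measurable_funD.
pose tr' : {mfun _ >-> _} := HB.pack tr (isMeasurableFun.Build _ _ _ _ _ mtr).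
have -> : (\int[mu]_x f x = \int[pushforward mu tr']_x f x)%E.
  apply: eq_measure_integral => A mA _.
  apply: (@lebesgue_measure_unique R (pushforward mu tr')) => // _ [[p q] _ <-].
  transitivity (mu `]p - a, q - a]%classic).
    rewrite !lebesgue_measure_itv/= !lte_fin ltrD2r.
    by case: ifP => // _; rewrite -!EFinB; congr EFin; ring.
  congr (mu _); apply/seteqP; split => x; rewrite /tr' /tr /= !in_itv/=;
    by rewrite ltrBlDr lerBrDr.
rewrite (@ge0_integral_pushforward _ _ _ _ R tr mtr mu setT f)//.
Qed.

(* Young's convolution inequality: Tonelli, then Cauchy-Schwarz in t for each s. *)
Lemma delay_bilinear_le (m : {finite_measure set (measurableTypeR R) -> \bar R})
    (p g z : R -> R) (K G Z : R) :
  measurable_fun setT p -> measurable_fun setT g -> measurable_fun setT z ->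
  (forall s, 0 <= p s) -> (forall s, 0 <= g s) -> (forall s, 0 <= z s) ->
  0 <= G -> 0 <= Z ->
  (\int[m]_s (p s)%:E <= K%:E)%E ->
  (\int[mu]_t (g t ^+ 2)%:E <= (G ^+ 2)%:E)%E ->
  (\int[mu]_t (z t ^+ 2)%:E <= (Z ^+ 2)%:E)%E ->
  (\int[mu]_t ((\int[m]_s (p s * g (t - s)%R)%:E) * (z t)%:E) <=
    (K * (G * Z))%:E)%E.
Proof.
move=> mp mg mz p0 g0 z0 G0 Z0 hK hG hZ.
have mgt (s : R) : measurable_fun setT (fun t : R => g (t - s)).
  by apply: (measurableT_comp mg); exact: measurable_funB.
have mgs (t : R) : measurable_fun setT (fun s : R => g (t - s)).
  by apply: (measurableT_comp mg); exact: measurable_funB.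
have mpg (t : R) : measurable_fun [set: measurableTypeR R]
    (fun s => (p s * g (t - s))%:E).
  by apply/measurable_EFinP; exact: (measurable_funM mp (mgs t)).
pose F (ts : R * measurableTypeR R) := ((p ts.2 * g (ts.1 - ts.2)) * z ts.1)%:E.
have mF : measurable_fun setT F.
  apply/measurable_EFinP; apply: measurable_funM; last exact: measurableT_comp.
  apply: measurable_funM; first exact: measurableT_comp.
  by apply: (measurableT_comp mg); apply: measurable_funB.
have F0 x : (0 <= F x)%E by rewrite lee_fin !mulr_ge0.
under eq_integral => t _.
  rewrite -ge0_integralZr//=; last 2 first.
  - by move=> s _; rewrite lee_fin mulr_ge0.
  - by rewrite lee_fin.
  under eq_integral do rewrite -EFinM.
  over.
rewrite (@fubini_tonelli _ _ _ _ R mu m F mF F0) /F /=.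
apply: (@le_trans _ _ (\int[m]_s ((G * Z)%:E * (p s)%:E)%E)%E).
  apply: ge0_le_integral => //=.
  - by move=> s _; apply: integral_ge0 => t _; exact: (F0 (t, s)).
  - exact: (@measurable_fun_fubini_tonelli_G _ _ _ _ R mu F).
  - by apply: measurable_funeM; exact/measurable_EFinP.
  move=> s _; under eq_integral do rewrite -mulrA EFinM.
  rewrite ge0_integralZl_EFin//=; last 2 first.
  - by move=> t _; rewrite lee_fin mulr_ge0.
  - by apply/measurable_EFinP; exact: (measurable_funM (mgt s) mz).
  rewrite muleC; apply: lee_wpmul2r; rewrite ?lee_fin//.
  apply: cauchy_schwarz_le => //.
    exact: mgt.
  have mg2 : measurable_fun [set: R] (fun t => (g t ^+ 2)%:E).
    by apply/measurable_EFinP; exact: measurable_funX.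
  by rewrite (ge0_integral_translate (- s) mg2)// => t; rewrite lee_fin sqr_ge0.
rewrite ge0_integralZl_EFin//=; last 3 first.
- by move=> t _; rewrite lee_fin.
- exact/measurable_EFinP.
- by rewrite mulr_ge0.
have -> : ((K * (G * Z))%:E = (G * Z)%:E * K%:E)%E by rewrite -EFinM mulrC.
by apply: lee_wpmul2l; rewrite ?lee_fin ?mulr_ge0.
Qed.

End translation.

(** * Total variation and integration against signed measures *)

Section charges.
Context (R : realType).
Local Notation RT := (measurableTypeR R).
Local Notation total_variation := Defs.total_variation.
Implicit Types (nu : {charge set RT -> \bar R}) (A D : set RT).

Lemma total_variation_fin nu A : measurable A ->
  total_variation nu A \is a fin_num.
Proof.
move=> mA; rewrite /total_variation /charge_variation/=.
by rewrite fin_numD !fin_num_measure.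
Qed.

(** The total variation again, carrying its finiteness as a structure: Tonelli's theorem asks for
    it. *)
Definition tv_measure nu : {finite_measure set RT -> \bar R} :=
  HB.pack (charge_variation (projT2 (hahn_pair nu)))
    (@Measure_isFinite.Build _ RT R (charge_variation (projT2 (hahn_pair nu)))
       (@total_variation_fin nu)).

Lemma total_variationE nu A :
  total_variation nu A = (positive_part nu A + negative_part nu A)%E.
Proof. by []. Qed.

Lemma le_total_variation nu A : measurable A ->
  (`|nu A| <= total_variation nu A)%E.
Proof. exact: abse_charge_variation. Qed.

Lemma charge_parts nu A : measurable A ->
  nu A = (positive_part nu A - negative_part nu A)%E.
Proof.
move=> mA; rewrite [LHS](jordan_decomp (projT2 (hahn_pair nu)) mA).
by rewrite /cadd/= cscaleN1.
Qed.

(** The total variation is the least measure dominating |nu(B)|: on each Hahn set the corresponding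
    Jordan part is nu up to sign. The triangle inequalities follow from this, although the Hahn sets
    of the measures involved are unrelated. *)
Lemma total_variation_minimal nu (m : {measure set RT -> \bar R}) A :
  (forall B, measurable B -> (`|nu B| <= m B)%E) -> measurable A ->
  (total_variation nu A <= m A)%E.
Proof.
move=> num mA; rewrite total_variationE /positive_part /negative_part.
case: (hahn_pair nu) => -[P N]/= nuPN.
have [[mP _] [mN _] PN PN0] := nuPN.
rewrite jordan_posE jordan_negE cjordan_posE cjordan_negE /crestr0 mem_set// /crestr.
have -> : (m A = m (A `&` P) + m (A `&` N))%E.
  rewrite -measureU//; first by rewrite -setIUr PN setIT.
  - exact: measurableI.
  - exact: measurableI.
  - by rewrite setIACA PN0 setI0.
apply: leeD; first by rewrite (le_trans (lee_abs _))// num//; exact: measurableI.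
by rewrite (le_trans (lee_abs _))// abseN num//; exact: measurableI.
Qed.

Lemma total_variation_triangle nu nu1 nu2 A :
  (forall B, measurable B -> (`|nu B| <= `|nu1 B| + `|nu2 B|)%E) ->
  measurable A ->
  (total_variation nu A <= total_variation nu1 A + total_variation nu2 A)%E.
Proof.
move=> nuD mA; rewrite -measure_addE.
apply: total_variation_minimal => // B mB.
rewrite [X in (_ <= X)%E](measure_addE (total_variation nu1) (total_variation nu2)).
by rewrite (le_trans (nuD _ mB))//; apply: leeD; exact: le_total_variation.
Qed.

Lemma caddNE nu1 nu2 A : cadd nu1 (copp nu2) A = (nu1 A - nu2 A)%E.
Proof. by []. Qed.

Lemma total_variation_addB nu mu A : measurable A ->
  (total_variation nu A <=
   total_variation mu A + total_variation (cadd nu (copp mu)) A)%E.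
Proof.
apply: total_variation_triangle => B mB.
rewrite [X in (_ <= _ + `|X|)%E](caddNE nu mu).
rewrite -{1}(@subeK _ (nu B) (mu B)) ?fin_num_measure//.
by rewrite [leRHS]addeC lee_abs_add.
Qed.

Lemma total_variationB nu1 nu2 mu A : measurable A ->
  (total_variation (cadd nu1 (copp nu2)) A <=
   total_variation (cadd nu1 (copp mu)) A +
   total_variation (cadd nu2 (copp mu)) A)%E.
Proof.
apply: total_variation_triangle => B mB.
rewrite [X in (`|X| <= _)%E](caddNE nu1 nu2) [X in (_ <= `|X| + _)%E](caddNE nu1 mu).
rewrite [X in (_ <= _ + `|X|)%E](caddNE nu2 mu).
have fin (c : {charge set RT -> \bar R}) : c B = (fine (c B))%:E.
  by rewrite fineK// fin_num_measure.
rewrite (fin nu1) (fin nu2) (fin mu) -!EFinB lee_fin.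
have := ler_normB (fine (nu1 B) - fine (mu B)) (fine (nu2 B) - fine (mu B)).
by rewrite opprB addrA subrK.
Qed.

Lemma total_variation_integral nu D (f : RT -> \bar R) : measurable D ->
  (forall x, D x -> (0 <= f x)%E) -> measurable_fun D f ->
  (\int[total_variation nu]_(x in D) f x = \int[positive_part nu]_(x in D) f x
   + \int[negative_part nu]_(x in D) f x)%E.
Proof.
move=> mD f0 mf; rewrite -ge0_integral_measure_add//.
by apply: eq_measure_integral => A mA AD;
  rewrite [RHS](measure_addE (positive_part nu) (negative_part nu)).
Qed.

Lemma integrable_parts nu D (f : RT -> \bar R) : measurable D ->
  (total_variation nu).-integrable D f ->
  (positive_part nu).-integrable D f /\ (negative_part nu).-integrable D f.
Proof.
move=> mD /integrableP[mf]; rewrite total_variation_integral//; last first.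
  exact: measurableT_comp.
move=> h; split; apply/integrableP; split => //.
  by apply: le_lt_trans h; rewrite leeDl// integral_ge0.
by apply: le_lt_trans h; rewrite leeDr// integral_ge0.
Qed.

Definition charge_integral nu D (f : RT -> R) : R :=
  \int[positive_part nu]_(x in D) f x - \int[negative_part nu]_(x in D) f x.

Lemma charge_integralD nu D (f g : RT -> R) : measurable D ->
  (total_variation nu).-integrable D (EFin \o f) ->
  (total_variation nu).-integrable D (EFin \o g) ->
  charge_integral nu D (fun x => f x + g x) =
  charge_integral nu D f + charge_integral nu D g.
Proof.
move=> mD /(integrable_parts mD)[fp fn] /(integrable_parts mD)[gp gn].
by rewrite /charge_integral !RintegralD//; ring.
Qed.

Lemma le_charge_integral nu D (f : RT -> R) : measurable D ->
  (total_variation nu).-integrable D (EFin \o f) ->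
  (`|charge_integral nu D f|%:E <=
   \int[total_variation nu]_(x in D) (`|f x|)%:E)%E.
Proof.
move=> mD intf; have [fp fn] := integrable_parts mD intf.
have /integrableP[mf _] := intf.
have mnf : measurable_fun D (fun x => (`|f x|)%:E).
  by apply/measurable_EFinP; apply: measurableT_comp => //; exact/measurable_EFinP.
rewrite total_variation_integral//.
apply: (@le_trans _ _ (`|\int[positive_part nu]_(x in D) f x| +
  `|\int[negative_part nu]_(x in D) f x|)%:E).
  by rewrite lee_fin ler_normB.
by rewrite EFinD !EFin_normr_Rintegral//; apply: leeD; apply: le_abse_integral.
Qed.

Lemma charge_integral_cadd nu mu D (f : RT -> R) : measurable D ->
  (total_variation nu).-integrable D (EFin \o f) ->
  (total_variation mu).-integrable D (EFin \o f) ->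
  (total_variation (cadd nu (copp mu))).-integrable D (EFin \o f) ->
  charge_integral nu D f - charge_integral mu D f =
  charge_integral (cadd nu (copp mu)) D f.
Proof.
move=> mD inu imu id.
have mf : measurable_fun D (EFin \o f) by case/integrableP : inu.
have [np nn] := integrable_parts mD inu.
have [mp mn] := integrable_parts mD imu.
have [dp dn] := integrable_parts mD id.
have iadd (m1 m2 : {measure set RT -> \bar R}) :
    m1.-integrable D (EFin \o f) -> m2.-integrable D (EFin \o f) ->
    (measure_add m1 m2).-integrable D (EFin \o f).
  move=> /integrableP[_ i1] /integrableP[_ i2]; apply/integrableP; split => //.
  rewrite ge0_integral_measure_add//; first by rewrite lte_add_pinfty.
  exact: measurableT_comp.
(* Jordan parts are not additive. Moving the negative parts across nu - mu = d gives nu+ + mu- + d-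
   = mu+ + nu- + d+, an identity between measures that can be integrated. *)
have E : (\int[measure_add (measure_add (positive_part nu) (negative_part mu))
      (negative_part (cadd nu (copp mu)))]_(x in D) (f x)%:E =
    \int[measure_add (measure_add (positive_part mu) (negative_part nu))
      (positive_part (cadd nu (copp mu)))]_(x in D) (f x)%:E)%E.
  apply: eq_measure_integral => A mA _.
  rewrite [LHS]measure_addE [RHS]measure_addE.
  rewrite [X in (X + _)%E = _]measure_addE [X in _ = (X + _)%E]measure_addE.
  have := charge_parts (cadd nu (copp mu)) mA.
  rewrite [LHS](caddNE nu mu) (charge_parts nu mA) (charge_parts mu mA).
  have fin (c : {charge set RT -> \bar R}) : positive_part c A \is a fin_num /\
      negative_part c A \is a fin_num.
    have : total_variation c A \is a fin_num by exact: total_variation_fin.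
    by rewrite total_variationE fin_numD => /andP.
  have [] := fin nu; have [] := fin mu; have [] := fin (cadd nu (copp mu)).
  move=> /fineK <- /fineK <- /fineK <- /fineK <- /fineK <- /fineK <-.
  rewrite -!EFinB => -[] h; rewrite -!EFinD; congr EFin; lra.
move: E; rewrite !integral_measure_add//; [|exact: iadd|exact: iadd].
rewrite /charge_integral /Rintegral.
have fi (m : {measure set RT -> \bar R}) : m.-integrable D (EFin \o f) ->
    (\int[m]_(x in D) (f x)%:E = (fine (\int[m]_(x in D) (f x)%:E))%:E)%E.
  by move=> h; rewrite fineK//; exact: integrable_fin_num.
rewrite (fi _ np) (fi _ nn) (fi _ mp) (fi _ mn) (fi _ dp) (fi _ dn).
rewrite -!EFinD => -[] h; rewrite /=; lra.
Qed.

End charges.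

(** * Test functions *)

Section flat_functions.
Context (R : realType).

(* Derivatives of combinations of flat functions are again such combinations:
   this closure property is what [smooth] records below. *)
Definition flat (k : nat) (x : R) : R :=
  if 0 < x then x^-1 ^+ k * expR (- x^-1) else 0.

Lemma flat_ge0 k x : 0 <= flat k x.
Proof.
rewrite /flat; case: ifP => // x0.
by rewrite mulr_ge0 ?expR_ge0// exprn_ge0// invr_ge0 ltW.
Qed.

(** A single term of the exponential series, e^(1/x) >= x^(-(k+1)) / (k+1)!, already gives the
    linear bound. *)
Lemma flat_le k x : 0 <= x -> flat k x <= k.+1`!%:R * x.
Proof.
rewrite le_eqVlt => /predU1P[<-|x0]; first by rewrite /flat ltxx mulr0.
rewrite /flat x0 expRN ler_pdivrMr ?expR_gt0//.
have := @expR_ge1Dxn R x^-1 k (ltW (eq_ind_r _ x0 (invr_gt0 x))).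
move=> h; apply: le_trans (_ : k.+1`!%:R * x * (x^-1 ^+ k.+1 / k.+1`!%:R) <= _).
  rewrite exprS [leRHS](_ : _ = x^-1 ^+ k)//; field.
  by rewrite (gt_eqF x0) andbT pnatr_eq0 -lt0n fact_gt0.
rewrite ler_wpM2l//; first by rewrite mulr_ge0// ltW.
by apply: le_trans h; rewrite lerDr.
Qed.

Lemma flat_norm_le k x : `|flat k x| <= k.+1`!%:R * `|x|.
Proof.
rewrite ger0_norm ?flat_ge0//; case: (ltP 0 x) => x0.
  by rewrite (gtr0_norm x0) flat_le// ltW.
by rewrite {1}/flat ltNge x0/= mulr_ge0.
Qed.

Lemma flatS_mul k x : x * flat k.+1 x = flat k x.
Proof.
rewrite /flat; case: ifPn => x0; last by rewrite mulr0.
by rewrite exprS !mulrA divff ?gt_eqF// mul1r.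
Qed.

(** The difference quotient of [flat k] at 0 is [flat k.+1], which is O(h). *)
Lemma is_derive_flat0 k : is_derive (0 : R) 1 (flat k : R -> R) 0.
Proof.
have f0 : flat k 0 = 0 by rewrite /flat ltxx.
have c : h^-1 *: ((flat k \o shift (0:R)) (h *: (1:R)) - flat k (0:R)) @[h --> (0:R)^'] --> (0 : R).
  apply/cvgrPdist_le => e e0; near=> h.
  rewrite /= f0 subr0 addr0 sub0r normrN [_ *: 1]mulr1.
  have h0 : h != 0 by near: h; exact: nbhs_dnbhs_neq.
  rewrite -(flatS_mul k h) [_ *: _]mulrA mulVf// mul1r.
  rewrite (le_trans (flat_norm_le _ _))// mulrC -ler_pdivlMr; last first.
    by rewrite ltr0n fact_gt0.
  near: h; apply: dnbhs0_le.
  by rewrite divr_gt0// ltr0n fact_gt0.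
split; first by apply/cvg_ex; exists 0.
by apply: cvg_lim; [exact: Rhausdorff|exact: c].
Unshelve. all: by end_near. Qed.

Lemma is_derive_flat k (x : R) :
  is_derive x 1 (flat k : R -> R) (flat k.+2 x - k%:R * flat k.+1 x).
Proof.
case: (ltgtP x 0) => x0.
- have -> : flat k.+2 x - k%:R * flat k.+1 x = 0.
    by rewrite /flat ltNge (ltW x0)/= mulr0 subr0.
  apply: near_eq_is_derive (is_derive_cst (0 : R) x 1).
  near=> y; rewrite /flat ltNge ifF//; apply/negbTE; rewrite negbK.
  by apply: ltW; near: y; exact: lt_nbhsl.
- suff main : is_derive x (1 : R) (fun y : R => y^-1 ^+ k * expR (- y^-1) : R)
      (flat k.+2 x - k%:R * flat k.+1 x).
    apply: near_eq_is_derive main.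
    near=> y; rewrite /flat ifT//; near: y; exact: lt_nbhsr.
  have x0' : x != 0 by rewrite gt_eqF.
  have dV := is_deriveV x0' (is_derive_id x (1 : R)).
  have dE := @is_derive1_comp R expR (- (fun y : R => y^-1)) x _ _
    (is_derive_expR (- x^-1)) (is_deriveN dV).
  have := is_deriveM (is_deriveX k dV) dE.
  rewrite (_ : _ * _ = (fun y => y^-1 ^+ k * expR (- y^-1))); last first.
    by apply/funext => y; rewrite !fctE.
  move=> h; apply: (is_derive_eq h).
  rewrite /flat x0 fctE /= !scaler1 !exprVn.
  rewrite -[X in _ + X *: _]/(expR (- x^-1)).
  rewrite -[LHS]/(x ^- k * (expR (- x^-1) * - - x ^- 2) +
    expR (- x^-1) * ((k%:R / x ^+ k.-1) * - x ^- 2)).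
  rewrite -!exprVn; move: (expR (- x^-1)) x^-1 => e y.
  by case: k {h dV dE} => [|k] /=; rewrite ?mul0r ?mulr0 !exprS; ring.
- rewrite x0 (_ : flat _ _ - _ = 0); first exact: is_derive_flat0.
  by rewrite /flat ltxx mulr0 subr0.
Unshelve. all: by end_near. Qed.

Inductive smooth : (R -> R) -> Prop :=
| smooth_flat k : smooth (flat k)
| smooth_cst c : smooth (cst c)
| smooth_add f g : smooth f -> smooth g -> smooth (fun x => f x + g x)
| smooth_mul f g : smooth f -> smooth g -> smooth (fun x => f x * g x)
| smooth_affine f a b : smooth f -> smooth (fun x => f (a * x + b))
| smooth_inv f : (forall x, f x != 0) -> smooth f -> smooth (fun x => (f x)^-1).

Lemma smooth_is_derive f : smooth f ->
  exists2 g, smooth g & forall x : R, is_derive x (1 : R) (f : R -> R) (g x).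
Proof.
elim => [k|c|{}f g sf [f' sf' df] sg [g' sg' dg]|{}f g sf [f' sf' df] sg [g' sg' dg]
  |{}f a b sf [f' sf' df]|{}f f0 sf [f' sf' df]].
- exists (fun x => flat k.+2 x + (- k%:R) * flat k.+1 x).
    apply: smooth_add; first exact: smooth_flat.
    by apply: smooth_mul; [exact: smooth_cst|exact: smooth_flat].
  by move=> x; rewrite mulNr; exact: is_derive_flat.
- by exists (cst 0) => [|x]; [exact: smooth_cst|exact: is_derive_cst].
- exists (fun x => f' x + g' x); first exact: smooth_add.
  by move=> x; exact: is_deriveD.
- exists (fun x => f x * g' x + g x * f' x).
    by apply: smooth_add; exact: smooth_mul.
  by move=> x; exact: is_deriveM.
- exists (fun x => f' (a * x + b) * a).
    by apply: smooth_mul; [exact: smooth_affine|exact: smooth_cst].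
  move=> x.
  have := is_deriveD (is_deriveZ a (is_derive_id x (1 : R))) (is_derive_cst (b : R) x 1).
  rewrite addr0 [_ *: 1]mulr1 => da.
  have := @is_derive1_comp _ f (fun x => a * x + b) x _ _ (df _) da.
  by [].
- exists (fun x => (-1) * ((f x)^-1 * (f x)^-1) * f' x).
    apply: smooth_mul => //; apply: smooth_mul; first exact: smooth_cst.
    by apply: smooth_mul; exact: smooth_inv.
  move=> x; apply: (is_derive_eq (is_deriveV (f0 x) (df x))).
  by rewrite [_ *: _]/(_ * _) mulN1r expr2 invfM.
Qed.

Lemma smooth_derivable f n (t : R) : smooth f ->
  derivable (derive1n n (f : R -> R^o)) t 1.
Proof.
elim: n f => [|n IHn] f sf.
  by have [g _ df] := smooth_is_derive sf; case: (df t).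
rewrite derive1Sn; have [g sg df] := smooth_is_derive sf.
rewrite (_ : derive1 (f : R -> R^o) = g); first exact: IHn.
by apply/funext => x; rewrite derive1E; case: (df x).
Qed.

Lemma smooth_continuous f : smooth f -> continuous f.
Proof.
move=> sf t; have [g _ df] := smooth_is_derive sf.
by apply: differentiable_continuous; apply/derivable1_diffP; case: (df t).
Qed.

Definition smooth_step (x : R) : R :=
  flat 0 x * (flat 0 x + flat 0 (- 1 * x + 1))^-1.

(** The quotient rule after cancellation: written this way, the derivative is visibly nonnegative
    and visibly a combination of flat functions. *)
Definition smooth_step' (x : R) : R :=
  (flat 2 x * flat 0 (- 1 * x + 1) + flat 0 x * flat 2 (- 1 * x + 1)) *
  ((flat 0 x + flat 0 (- 1 * x + 1))^-1 * (flat 0 x + flat 0 (- 1 * x + 1))^-1).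

Lemma flat_gt0 k x : 0 < x -> 0 < flat k x.
Proof. by move=> x0; rewrite /flat x0 mulr_gt0 ?expR_gt0// exprn_gt0// invr_gt0. Qed.

Lemma flat_eq0 k x : x <= 0 -> flat k x = 0.
Proof. by rewrite /flat ltNge => ->. Qed.

Lemma smooth_step_den_gt0 (x : R) : 0 < flat 0 x + flat 0 (- 1 * x + 1).
Proof.
have [x0|x0] := ltP 0 x; first by rewrite ltr_pwDl ?flat_gt0 ?flat_ge0.
by rewrite ltr_wpDl ?flat_ge0// flat_gt0; lra.
Qed.

Lemma smooth_smooth_step : smooth smooth_step.
Proof.
apply: smooth_mul; first exact: smooth_flat.
apply: smooth_inv => [x|]; first by rewrite gt_eqF// smooth_step_den_gt0.
by apply: smooth_add; [exact: smooth_flat|apply: smooth_affine; exact: smooth_flat].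
Qed.

Lemma smooth_smooth_step' : smooth smooth_step'.
Proof.
have sa k : smooth (fun x => flat k (- 1 * x + 1)).
  by apply: smooth_affine; exact: smooth_flat.
have sd : smooth (fun x => (flat 0 x + flat 0 (- 1 * x + 1))^-1).
  apply: smooth_inv => [x|]; first by rewrite gt_eqF// smooth_step_den_gt0.
  by apply: smooth_add => //; exact: smooth_flat.
apply: smooth_mul; last exact: smooth_mul.
by apply: smooth_add; apply: smooth_mul => //; exact: smooth_flat.
Qed.

Lemma is_derive_affine (a b x : R) : is_derive x (1 : R) (fun x : R => a * x + b : R) a.
Proof.
have := is_deriveD (is_deriveZ a (is_derive_id x (1 : R))) (is_derive_cst (b : R) x 1).
by rewrite addr0 [_ *: 1]mulr1.
Qed.

Lemma is_derive_smooth_step (x : R) :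
  is_derive x (1 : R) (smooth_step : R -> R) (smooth_step' x).
Proof.
have d1 := is_derive_flat 0 x.
have d2 := @is_derive1_comp _ (flat 0) (fun x : R => - 1 * x + 1) x _ _
  (is_derive_flat 0 (- 1 * x + 1)) (is_derive_affine (- 1) 1 x).
have d0 : flat 0 x + flat 0 (- 1 * x + 1) != 0.
  by rewrite gt_eqF// smooth_step_den_gt0.
have := is_deriveM d1 (@is_deriveV _ (fun x => flat 0 x + flat 0 (- 1 * x + 1)) x _ _ d0
  (is_deriveD d1 d2)).
move=> h; apply: (is_derive_eq h).
rewrite -[LHS]/(flat 0 x * (- (flat 0 x + flat 0 (- 1 * x + 1)) ^- 2 *
    ((flat 2 x - 0%:R * flat 1 x) +
    (flat 2 (- 1 * x + 1) - 0%:R * flat 1 (- 1 * x + 1)) * - 1)) +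
  (flat 0 x + flat 0 (- 1 * x + 1))^-1 * (flat 2 x - 0%:R * flat 1 x)).
by rewrite /smooth_step' !mul0r !subr0; field.
Qed.

Lemma smooth_step'_ge0 (x : R) : 0 <= smooth_step' x.
Proof.
have h := smooth_step_den_gt0 x.
by rewrite /smooth_step' mulr_ge0// ?addr_ge0 ?mulr_ge0 ?flat_ge0// invr_ge0 ltW.
Qed.

Lemma smooth_step_ge0 (x : R) : 0 <= smooth_step x.
Proof.
by rewrite /smooth_step mulr_ge0 ?flat_ge0// invr_ge0 ltW// smooth_step_den_gt0.
Qed.

Lemma smooth_step_le1 (x : R) : smooth_step x <= 1.
Proof.
by rewrite /smooth_step ler_pdivrMr ?smooth_step_den_gt0// mul1r lerDl flat_ge0.
Qed.

Lemma smooth_step_eq0 (x : R) : x <= 0 -> smooth_step x = 0.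
Proof. by move=> x0; rewrite /smooth_step (flat_eq0 _ x0) mul0r. Qed.

Lemma smooth_step_eq1 (x : R) : 1 <= x -> smooth_step x = 1.
Proof.
move=> x1; rewrite /smooth_step (@flat_eq0 _ (- 1 * x + 1)) ?addr0; last lra.
by rewrite divff// gt_eqF// flat_gt0//; lra.
Qed.

Lemma smooth_step'_eq0l (x : R) : x <= 0 -> smooth_step' x = 0.
Proof. by move=> x0; rewrite /smooth_step' !(flat_eq0 _ x0) !mul0r addr0 mul0r. Qed.

Lemma smooth_step'_eq0r (x : R) : 1 <= x -> smooth_step' x = 0.
Proof.
move=> x1; rewrite /smooth_step' !(@flat_eq0 _ (- 1 * x + 1)) ?mulr0 ?addr0 ?mul0r//; lra.
Qed.

(** A transition from 0 to 1 across [a, a + e]. Its derivative is a nonnegative bump of mass one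
    there, an approximate Dirac mass at a from the right. *)
Definition step_at (e a t : R) : R := smooth_step (e^-1 * t + (- (a / e))).
Definition step_at' (e a t : R) : R := smooth_step' (e^-1 * t + (- (a / e))) * e^-1.

Lemma is_derive_step_at (e a t : R) :
  is_derive t (1 : R) (step_at e a : R -> R) (step_at' e a t).
Proof.
exact: (@is_derive1_comp _ smooth_step (fun t : R => e^-1 * t + (- (a / e))) t _ _
  (is_derive_smooth_step _) (is_derive_affine _ _ _)).
Qed.

Lemma smooth_step_at e a : smooth (step_at e a).
Proof. by apply: smooth_affine; exact: smooth_smooth_step. Qed.

Lemma smooth_step_at' e a : smooth (step_at' e a).
Proof.
apply: smooth_mul; last exact: smooth_cst.
by apply: smooth_affine; exact: smooth_smooth_step'.
Qed.

Lemma step_at_eq0 e a t : 0 < e -> t <= a -> step_at e a t = 0.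
Proof.
move=> e0 ta; apply: smooth_step_eq0.
by rewrite subr_le0 mulrC ler_wpM2r// invr_ge0 ltW.
Qed.

Lemma step_at_eq1 e a t : 0 < e -> a + e <= t -> step_at e a t = 1.
Proof.
move=> e0 ta; apply: smooth_step_eq1.
by rewrite mulrC -mulrBl ler_pdivlMr// mul1r; lra.
Qed.

Lemma step_at'_eq0 e a t : 0 < e -> t \notin `[a, a + e] -> step_at' e a t = 0.
Proof.
move=> e0; rewrite in_itv/= negb_and -!ltNge => /orP[ta|ta].
  rewrite /step_at' smooth_step'_eq0l ?mul0r//.
  by rewrite subr_le0 mulrC ler_wpM2r ?invr_ge0// ltW.
rewrite /step_at' smooth_step'_eq0r ?mul0r//.
by rewrite mulrC -mulrBl ler_pdivlMr// mul1r; lra.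
Qed.

Lemma step_at'_ge0 e a t : 0 < e -> 0 <= step_at' e a t.
Proof. by move=> e0; rewrite mulr_ge0 ?smooth_step'_ge0// invr_ge0 ltW. Qed.

Lemma integral_step_at' e a : 0 < e ->
  (\int[lebesgue_measure]_(t in `[a, (a + e)%R]) (step_at' e a t)%:E = 1)%E.
Proof.
move=> e0; rewrite (@continuous_FTC2 _ _ (step_at e a)) ?ltrDl//.
- by rewrite step_at_eq1// step_at_eq0// sube0.
- by apply: continuous_subspaceT; exact: smooth_continuous (smooth_step_at' e a).
- have c := smooth_continuous (smooth_step_at e a).
  split.
  + by move=> x _; case: (is_derive_step_at e a x).
  + by apply: cvg_at_right_filter; exact: c.
  + by apply: cvg_at_left_filter; exact: c.
- by move=> x _; rewrite derive1E; case: (is_derive_step_at e a x).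
Qed.

End flat_functions.

(** * From distributional identities to increments *)

Section test_functions.
Context (R : realType).
Local Notation mu := (@lebesgue_measure R).

Lemma test_function_step (T a b e : R) : 0 < e -> 0 < a -> a <= b -> b + e < T ->
  test_function T (fun t => step_at e a t - step_at e b t).
Proof.
move=> e0 a0 ab beT; split.
  move=> n t; apply: smooth_derivable.
  rewrite (_ : (fun _ => _) = (fun t => step_at e a t + (- 1) * step_at e b t)).
    apply: smooth_add; first exact: smooth_step_at.
    by apply: smooth_mul; [exact: smooth_cst|exact: smooth_step_at].
  by apply/funext => s; rewrite mulN1r.
exists a, (b + e); split=> // t; rewrite in_itv/= negb_and -!ltNge => /orP[ta|bt].
  by rewrite !step_at_eq0 ?subrr// (le_trans (ltW ta)).
by rewrite !step_at_eq1 ?subrr// ltW// (le_lt_trans _ bt)// lerD2r.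
Qed.

Lemma derive1_test_function_step (a b e t : R) :
  derive1 (fun t => step_at e a t - step_at e b t : R^o) t =
  step_at' e a t - step_at' e b t.
Proof.
rewrite derive1E.
by have [] := is_deriveB (is_derive_step_at e a t) (is_derive_step_at e b t).
Qed.

Lemma integrable_continuous_mul (T : R) (y : R -> R) (f : R -> R) :
  {within `[0, T], continuous y} -> continuous f ->
  mu.-integrable `]0, T[ (fun t => (f t * y t)%:E).
Proof.
move=> cy cf.
have : mu.-integrable `[0, T] (fun t => (f t * y t)%:E).
  apply: continuous_compact_integrable; first exact: segment_compact.
  move=> t; apply: (@continuousM _ (subspace `[0, T]) f y t); last exact: cy.
  by have := continuous_subspaceT cf; exact.
apply: integrableS => //; exact: subset_itv_oo_cc.
Qed.

Lemma integral_step_at'_cvg (T a r : R) (y : R -> R) : 0 < a -> a < T ->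
  {within `[0, T], continuous y} -> 0 < r ->
  exists2 e0, 0 < e0 & forall e, 0 < e -> e < e0 ->
    `|\int[mu]_(t in `]0, T[) (step_at' e a t * y t) - y a| <= r.
Proof.
move=> a0 aT cy r0.
have cya : {for a, continuous y}.
  have [+ _ _] := (continuous_within_itvP y (lt_trans a0 aT)).1 cy.
  by apply; rewrite in_itv/= a0.
have /cvgrPdist_le/(_ _ r0) := cya.
rewrite near_simpl => /nbhs_ballP[d /= d0 hd].
exists (Num.min d (T - a)); first by rewrite lt_min d0 subr_gt0.
move=> e e0; rewrite lt_min => /andP[ed eT].
have sub : `[a, a + e] `<=` `]0, T[ .
  move=> t /=; rewrite !in_itv/= => /andP[h1 h2]; apply/andP; split; lra.
have cs : continuous (step_at' e a).
  by apply: smooth_continuous; exact: smooth_step_at'.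
have E (f : R -> R) : \int[mu]_(t in `]0, T[) (step_at' e a t * f t) =
    \int[mu]_(t in `[a, a + e]) (step_at' e a t * f t).
  rewrite Rintegral_mkcond [RHS]Rintegral_mkcond; congr fine.
  apply: eq_integral => t _; rewrite !patchE; case: ifPn => [h|h].
    case: ifPn => // /negP h'; rewrite step_at'_eq0 ?mul0r//.
    by apply/negP => h2; apply: h'; rewrite inE.
  by rewrite ifF//; apply/negP => /set_mem/sub h2; move/negP : h; apply; exact: mem_set.
have i1 : mu.-integrable `[a, a + e] (fun t => (step_at' e a t)%:E).
  apply: continuous_compact_integrable; first exact: segment_compact.
  exact: continuous_subspaceT.
have i2 : mu.-integrable `[a, a + e] (fun t => (step_at' e a t * y t)%:E).
  by apply: integrableS (integrable_continuous_mul cy cs).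
have i3 : mu.-integrable `[a, a + e] (fun t => (step_at' e a t * y a)%:E).
  rewrite (_ : (fun _ => _) = (fun t => (y a)%:E * (step_at' e a t)%:E)%E).
    exact: integrableZl.
  by apply/funext => t; rewrite -EFinM mulrC.
have I1 : \int[mu]_(t in `[a, a + e]) step_at' e a t = 1.
  by rewrite /Rintegral integral_step_at'.
have -> : y a = \int[mu]_(t in `[a, a + e]) (step_at' e a t * y a).
  by rewrite RintegralZr// I1 mul1r.
rewrite E -RintegralB//.
apply: le_trans (le_normr_Rintegral _ (integrableB _ i2 i3)) _ => //.
apply: (@le_trans _ _ (\int[mu]_(t in `[a, a + e]) (step_at' e a t * r))); last first.
  by rewrite RintegralZr// I1 mul1r.
apply: le_Rintegral => //.
- by apply: integrable_norm; exact: (integrableB _ i2 i3).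
- rewrite (_ : _ \o _ = (fun t => r%:E * (step_at' e a t)%:E)%E).
    exact: integrableZl.
  by apply/funext => t; rewrite /= -EFinM mulrC.
- move=> t /=; rewrite in_itv/= => /andP[h1 h2].
  rewrite -mulrBr normrM ger0_norm ?step_at'_ge0// ler_wpM2l ?step_at'_ge0//.
  rewrite distrC; apply: hd; rewrite /ball /= distrC ger0_norm; lra.
Qed.

(** Differences of two steps are smooth approximations of the indicator of ]a, b]. Their derivatives
    tend to a Dirac mass at a minus one at b, which turns the distributional identity into an
    identity of increments. *)
Lemma integral_test_functions (T a b : R) (y g : R -> R) : 0 < a -> a < b -> b < T ->
  {within `[0, T], continuous y} -> mu.-integrable `]0, T[ (EFin \o g) ->
  (forall phi : R -> R^o, test_function T phi ->
    \int[mu]_(t in `]0, T[) (derive1 phi t * y t) =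
    - \int[mu]_(t in `]0, T[) (phi t * g t)) ->
  \int[mu]_(t in `]a, b]) g t = y b - y a.
Proof.
move=> a0 ab bT cy ig hyp.
have mg : measurable_fun `]0, T[ g by case/integrableP : ig => /measurable_EFinP.
(* The factor (T - b) / 2 keeps the support [a, b + e n] inside ]0, T[ for every n. *)
pose e n : R := (T - b) / 2 * n.+1%:R^-1.
have e0 n : 0 < e n by rewrite !mulr_gt0 ?invr_gt0// subr_gt0.
have eT n : b + e n < T.
  have : e n <= (T - b) / 2 by rewrite ler_piMr ?invf_le1 ?ler1n// divr_ge0// subr_ge0 ltW.
  by move=> ?; lra.
have e_cvg : e n @[n --> \oo] --> 0.
  rewrite -(mulr0 ((T - b) / 2)); apply: cvgM; first exact: cvg_cst.
  exact: cvg_harmonic.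
pose phi n t : R := step_at (e n) a t - step_at (e n) b t.
have aT : a < T by lra.
have b0 : 0 < b by lra.
have c1 : \int[mu]_(t in `]0, T[) (derive1 (phi n : R -> R^o) t * y t) @[n --> \oo]
    --> y a - y b.
  have Ey n : \int[mu]_(t in `]0, T[) (derive1 (phi n : R -> R^o) t * y t) =
      \int[mu]_(t in `]0, T[) (step_at' (e n) a t * y t) -
      \int[mu]_(t in `]0, T[) (step_at' (e n) b t * y t).
    rewrite -RintegralB//.
    - congr fine; apply: eq_integral => t _.
      by rewrite derive1_test_function_step mulrBl.
    - apply: integrable_continuous_mul => //.
      by apply: smooth_continuous; exact: smooth_step_at'.
    - apply: integrable_continuous_mul => //.
      by apply: smooth_continuous; exact: smooth_step_at'.
  under eq_fun do rewrite Ey.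
  have c (x : R) : 0 < x -> x < T ->
      \int[mu]_(t in `]0, T[) (step_at' (e n) x t * y t) @[n --> \oo] --> y x.
    move=> x0 xT; apply/cvgrPdist_le => r r0.
    have [d d0 hd] := integral_step_at'_cvg x0 xT cy r0.
    near=> n; rewrite distrC; apply: hd => //.
    near: n; move/cvgr0Pnorm_lt : e_cvg => /(_ _ d0); apply: filterS => n.
    by rewrite gtr0_norm.
  by apply: cvgB; exact: c.
have c2 : \int[mu]_(t in `]0, T[) (phi n t * g t) @[n --> \oo] -->
    \int[mu]_(t in `]0, T[) (\1_(`]a, b]%classic) t * g t).
  have phi1 n t : `|phi n t| <= 1.
    rewrite /phi ler_norml; have := smooth_step_ge0 ((e n)^-1 * t + - (a / e n)).
    have := smooth_step_ge0 ((e n)^-1 * t + - (b / e n)).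
    have := smooth_step_le1 ((e n)^-1 * t + - (a / e n)).
    have := smooth_step_le1 ((e n)^-1 * t + - (b / e n)).
    by rewrite /step_at => *; apply/andP; split; lra.
  have mphi n : measurable_fun `]0, T[ (phi n).
    apply: measurable_funTS; apply: continuous_measurable_fun.
    have ca := smooth_continuous (smooth_step_at (e n) a).
    have cb := smooth_continuous (smooth_step_at (e n) b).
    by move=> t; apply: continuousB; [exact: ca|exact: cb].
  have dcv : (\int[mu]_(t in `]0%R, T[) (phi n t * g t)%:E)%E @[n --> \oo] -->
      (\int[mu]_(t in `]0%R, T[) (\1_(`]a, b]%classic) t * g t)%:E)%E.
    apply: (@dominated_cvg _ _ _ mu _ _ _ _ (fun t => (`|g t|)%:E)) => //.
    - by move=> n; apply/measurable_EFinP; exact: (measurable_funM (mphi n) mg).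
    - move=> t _; apply: cvg_EFin; first by near=> n.
      apply: cvgMl; rewrite indicE /=.
      have stepc (x : R) : x < t -> step_at (e n) x t @[n --> \oo] --> (1 : R).
        move=> xt; apply: cvg_near_cst; near=> n; apply: step_at_eq1 => //.
        rewrite -lerBrDl; near: n; move/cvgr0Pnorm_le : e_cvg => /(_ (t - x)).
        rewrite subr_gt0 => /(_ xt); apply: filterS => n.
        by rewrite gtr0_norm.
      have step0 (x : R) : t <= x -> step_at (e n) x t @[n --> \oo] --> (0 : R).
        by move=> tx; apply: cvg_near_cst; near=> n; exact: step_at_eq0.
      have [ta|ta] := leP t a.
        rewrite memNset /=; last by rewrite in_itv/= ltNge ta.
        by rewrite -[X in _ --> X](subrr (0 : R)); apply: cvgB; apply: step0 => //; lra.
      have [tb|tb] := leP t b.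
        rewrite mem_set /=; last by rewrite in_itv/= ta.
        by rewrite -[X in _ --> X](subr0 (1 : R)); apply: cvgB; [exact: stepc|exact: step0].
      rewrite memNset /=; last by rewrite in_itv/= ta leNgt tb.
      by rewrite -[X in _ --> X](subrr (1 : R)); apply: cvgB; exact: stepc.
    - exact: integrable_norm.
    - by move=> n t _; rewrite /= lee_fin normrM ler_piMl.
  have i1g : mu.-integrable `]0, T[ (fun t => (\1_(`]a, b]%classic) t * g t)%:E).
    apply: (le_integrable _ _ _ ig) => //.
      apply/measurable_EFinP; apply: (measurable_funM _ mg).
      by apply: measurable_funTS; exact: measurable_indic.
    move=> t _; rewrite /= lee_fin indicE.
    by case: (boolP (t \in `]a, b]%classic)) => _ /=; rewrite ?mul1r// mul0r normr0.
  apply: fine_cvg; rewrite fineK//; exact: integrable_fin_num.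
have E : \int[mu]_(t in `]0, T[) (\1_(`]a, b]%classic) t * g t) =
    \int[mu]_(t in `]a, b]) g t.
  rewrite Rintegral_mkcond [RHS]Rintegral_mkcond; congr fine.
  apply: eq_integral => t _; rewrite !patchE indicE.
  case: ifPn => [|] h; first by case: ifPn => _; rewrite ?mul1r ?mul0r.
  rewrite ifF//; apply/negP; rewrite inE /= in_itv /= => /andP[h1 h2].
  by move/negP : h; apply; rewrite inE /= in_itv/=; apply/andP; split; lra.
rewrite -E.
have hyp' n := hyp (phi n) (test_function_step (e0 n) a0 (ltW ab) (eT n)).
move: c1; under eq_fun do rewrite hyp'.
move=> c1; have h : y a - y b = - \int[mu]_(t in `]0, T[) (\1_(`]a, b]%classic) t * g t).
  by apply: (cvg_unique _ c1 (cvgN c2)); exact: Rhausdorff.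
by rewrite -[LHS]opprK -h opprB.
Unshelve. all: by end_near. Qed.

End test_functions.

(** * The energy identity *)

Section translation_continuity.
Context (R : realType).
Local Notation mu := (@lebesgue_measure R).

Lemma sqr_le_sum3 (a b c d : R) : 0 <= a -> a <= b + (c + d) ->
  a ^+ 2 <= 3 * (b ^+ 2 + (c ^+ 2 + d ^+ 2)).
Proof.
move=> a0 abcd; apply: (@le_trans _ _ ((b + (c + d)) ^+ 2)).
  by rewrite ler_pXn2r ?nnegrE// (le_trans a0).
have := sqr_ge0 (b - c); have := sqr_ge0 (b - d); have := sqr_ge0 (c - d).
rewrite !expr2; lra.
Qed.

Lemma measurable_indic_translate (C : set R) (h : R) : measurable C ->
  measurable_fun [set: R] (fun x => \1_C (x + h) : R).
Proof.
move=> mC; have mf : measurable_fun [set: R] (\1_C : R -> R) by exact: measurable_indic.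
by apply: (measurableT_comp mf); exact: measurable_funD.
Qed.

(** With K compact, U open and K included in B included in U, a small translation keeps K inside U.
    A point where the two indicators differ then lies in U \ K before or after the translation, and
    U \ K has measure at most e / 2. *)
Lemma indic_translation_cvg (B : set R) (e : R) : measurable B ->
  (mu B < +oo)%E -> 0 < e ->
  \forall h \near (0 : R),
    (\int[mu]_x (`|\1_B (x + h)%R - \1_B x|)%:E <= e%:E)%E.
Proof.
move=> mB finB e0; have e4 : 0 < e / 4 by rewrite divr_gt0.
have [U [oU BU UB]] := lebesgue_measure.lebesgue_regularity_outer mB finB e4.
have [K [cK KB BK]] := lebesgue_measure.lebesgue_regularity_inner mB finB e4.
have mU : measurable U by exact: open_measurable.
have mK : measurable K by exact: compact_measurable.
have mUK : measurable (U `\` K) by exact: measurableD.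
have UK : (mu (U `\` K) <= (e / 2)%:E)%E.
  apply: (@le_trans _ _ (mu (U `\` B) + mu (B `\` K))%E).
    apply: le_trans (measureU2 _ _ _) => //; [|exact: measurableD..].
    apply: le_measure; rewrite ?inE//.
      by apply: measurableU; exact: measurableD.
    move=> x [Ux Kx]; have [Bx|Bx] := pselect (B x); by [right|left].
  have -> : ((e / 2)%:E = (e / 4)%:E + (e / 4)%:E)%E.
    by rewrite -EFinD; congr EFin; field.
  by apply: leeD; exact: ltW.
(* Compactness gives one range of h valid for all x in K. It is used with s = 1 and s = -1, as a
   point may enter B or leave it. *)
have near_sub (s : R) : \forall h \near (0 : R), forall x, K x -> U (x + s * h).
  have := (compact_near_coveringP K).1 cK R (nbhs (0 : R)) (fun h x => U (x + s * h)).
  apply => x Kx.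
  have c : (fun p : R * R => p.1 + s * p.2) p @[p --> (x, 0 : R)] --> x.
    rewrite -[X in _ --> X](addr0 x) -[X in _ + X](mulr0 s).
    apply: cvgD; first exact: cvg_fst.
    by apply: cvgM; [exact: cvg_cst|exact: cvg_snd].
  by apply: c; apply: open_nbhs_nbhs; split => //; exact: BU (KB _ Kx).
near=> h.
have hp x : K x -> U (x + h).
  by move=> Kx; rewrite -[h]mul1r; move: x Kx; near: h; exact: near_sub.
have hm x : K x -> U (x - h).
  by move=> Kx; rewrite -[- h]mulN1r; move: x Kx; near: h; exact: near_sub.
have mi (C : set R) : measurable C -> measurable_fun [set: R] (fun x => (\1_C x : R)%:E).
  by move=> mC; apply/measurable_EFinP; exact: measurable_indic.
have mih (C : set R) : measurable C -> measurable_fun [set: R] (fun x => (\1_C (x + h) : R)%:E).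
  by move=> mC; apply/measurable_EFinP; exact: measurable_indic_translate.
apply: (@le_trans _ _ (\int[mu]_x
    ((\1_(U `\` K) x)%:E + (\1_(U `\` K) (x + h)%R)%:E))%E).
  apply: ge0_le_integral => //=.
  - apply/measurable_EFinP; apply: measurableT_comp => //.
    by apply: measurable_funB; apply/measurable_EFinP; [exact: mih|exact: mi].
  - by apply: emeasurable_funD; [exact: mi|exact: mih].
  move=> x _; rewrite -EFinD lee_fin !indicE.
  have [Bh|Bh] := pselect (B (x + h)); have [Bx|Bx] := pselect (B x).
  - by rewrite (mem_set Bh) (mem_set Bx) subrr normr0 addr_ge0.
  - rewrite (mem_set Bh) (memNset Bx) subr0 normr1.
    have [Kh|Kh] := pselect (K (x + h)); last first.
      have P : (U `\` K) (x + h) by split => //; exact: BU.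
      by rewrite (mem_set P) lerDr.
    have P : (U `\` K) x.
      by split; [rewrite -(addrK h x); exact: hm|move=> /KB].
    by rewrite (mem_set P) lerDl.
  - rewrite (memNset Bh) (mem_set Bx) sub0r normrN1.
    have [Kx|Kx] := pselect (K x); last first.
      have P : (U `\` K) x by split => //; exact: BU.
      by rewrite (mem_set P) lerDl.
    have P : (U `\` K) (x + h) by split; [exact: hp|move=> /KB].
    by rewrite (mem_set P) lerDr.
  - by rewrite (memNset Bh) (memNset Bx) subrr normr0 addr_ge0.
rewrite ge0_integralD//=; [|exact: mi|exact: mih].
rewrite (@ge0_integral_translate _ (fun x => (\1_(U `\` K) x)%:E) h)//; last first.
  exact: mi.
rewrite integral_indic// setIT.
have -> : (e%:E = (e / 2)%:E + (e / 2)%:E)%E by rewrite -EFinD -splitr.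
exact: leeD.
Unshelve. all: by end_near. Qed.

Lemma sum_indic_translation_cvg (I : Type) (r : seq I) (B : I -> set R) (e : R) :
  (forall i, measurable (B i)) -> (forall i, (mu (B i) < +oo)%E) -> 0 < e ->
  \forall h \near (0 : R),
    (\sum_(i <- r) \int[mu]_x (`|\1_(B i) (x + h)%R - \1_(B i) x|)%:E <= e%:E)%E.
Proof.
move=> mB finB; elim: r e => [|i r IH] e e0.
  by near=> h; rewrite big_nil lee_fin ltW.
have e2 : 0 < e / 2 by rewrite divr_gt0.
have := IH _ e2; have := indic_translation_cvg (mB i) (finB i) e2.
apply: filterS2 => h h1 h2; rewrite big_cons.
have -> : (e%:E = (e / 2)%:E + (e / 2)%:E)%E by rewrite -EFinD -splitr.
exact: leeD.
Unshelve. all: by end_near. Qed.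

Lemma simple_translation_cvg (X : normedModType R) (s : measurableTypeR R -> X) (e : R) :
  simple s -> (forall y, y != 0 -> (mu (s @^-1` [set y]) < +oo)%E) -> 0 < e ->
  \forall h \near (0 : R),
    (\int[mu]_x (`|s (x + h)%R - s x| ^+ 2)%:E <= e%:E)%E.
Proof.
move=> [fs ms] fin e0.
(* The value 0 is left out because its fibre has infinite measure. Nothing is lost: if s(x + h) and
   s(x) differ, one of them is nonzero and its indicator changes. *)
pose r := [seq y <- finmap.enum_fset (fset_set (range s)) | y != 0].
pose B y := if y != 0 then s @^-1` [set y] else set0.
have mB y : measurable (B y) by rewrite /B; case: ifP.
have finB y : (mu (B y) < +oo)%E.
  by rewrite /B; case: ifPn => [/fin//|_]; rewrite measure0.
have [M M0 sM] : exists2 M : R, 0 < M & forall x, `|s x| <= M.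
  exists (1 + \sum_(y <- finmap.enum_fset (fset_set (range s))) `|y|) => [|x].
    by rewrite ltr_pwDl// sumr_ge0.
  have sx : s x \in finmap.enum_fset (fset_set (range s)).
    by rewrite in_fset_set// inE; exists x.
  rewrite (bigD1_seq (s x))//=; last exact: finmap.fset_uniq.
  by rewrite addrCA lerDl addr_ge0// sumr_ge0.
have C0 : 0 < (2 * M) ^+ 2 by rewrite exprn_gt0// mulr_gt0.
have := sum_indic_translation_cvg r mB finB (divr_gt0 e0 C0).
apply: filterS => h hh.
have mI y : measurable_fun [set: R] (fun x => (`|\1_(B y) (x + h)%R - \1_(B y) x : R|)%:E).
  apply/measurable_EFinP; apply: measurableT_comp => //.
  apply: measurable_funB; first exact: (measurable_indic_translate h (mB y)).
  exact: (@measurable_indic _ (measurableTypeR R) R setT (B y) (mB y)).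
have mS : measurable_fun [set: R] (fun x => (`|s (x + h)%R - s x| ^+ 2)%:E).
  apply/measurable_EFinP; apply: measurable_funX.
  apply: strongly_measurable_norm => //; apply: strongly_measurableB.
    apply: (@strongly_measurable_precomp _ _ _ _ _ _ (fun x : measurableTypeR R => x + h : measurableTypeR R) setT).
      exact: measurable_funD.
    by exists (fun=> s) => // t _; exact: cvg_cst.
  by exists (fun=> s) => // t _; exact: cvg_cst.
apply: (@le_trans _ _ (\int[mu]_x (((2 * M) ^+ 2)%:E *
    \sum_(y <- r) (`|\1_(B y) (x + h)%R - \1_(B y) x|)%:E))%E).
  apply: ge0_le_integral => //=.
  - by apply: measurable_funeM; exact: emeasurable_sum.
  move=> x _.
  have sum0 : (0 <= \sum_(y <- r) (`|\1_(B y) (x + h)%R - \1_(B y) x : R|)%:E)%E.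
    by apply: sume_ge0 => y _; rewrite lee_fin.
  have [sx|sx] := eqVneq (s (x + h)) (s x).
    by rewrite sx subrr normr0 expr0n/= mule_ge0// lee_fin ltW.
  suff [y yr yh] : exists2 y, y \in r & `|\1_(B y) (x + h)%R - \1_(B y) x : R| = 1.
    apply: (@le_trans _ _ (((2 * M) ^+ 2)%:E * 1)%E).
      rewrite mule1 lee_fin ler_pXn2r ?nnegrE//; last by rewrite mulr_ge0// ltW.
      by rewrite (le_trans (ler_normB _ _))// mulr_natl mulr2n lerD.
    apply: lee_wpmul2l; first by rewrite lee_fin ltW.
    have ur : uniq r by rewrite filter_uniq//; exact: finmap.fset_uniq.
    rewrite (bigD1_seq y)//= yh leeDl//.
    by apply: sume_ge0 => z _; rewrite lee_fin.
  have inr z : s z != 0 -> s z \in r.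
    by move=> sz; rewrite mem_filter sz in_fset_set// inE; exists z.
  have [s0|s0] := eqVneq (s x) 0.
    have sh0 : s (x + h) != 0 by rewrite -s0.
    exists (s (x + h)); first exact: inr.
    rewrite /B sh0 !indicE mem_set// memNset ?subr0 ?normr1//=.
    by move=> /esym/eqP; exact/negP.
  exists (s x); first exact: inr.
  rewrite /B s0 !indicE memNset ?mem_set// ?sub0r ?normrN1//=.
  exact/eqP.
rewrite ge0_integralZl//=; first last.
- by rewrite lee_fin ltW.
- by move=> x _; apply: sume_ge0 => y _; rewrite lee_fin.
- exact: emeasurable_sum.
rewrite ge0_integral_sum//.
apply: (@le_trans _ _ (((2 * M) ^+ 2)%:E * (e / (2 * M) ^+ 2)%:E)%E).
  by apply: lee_wpmul2l => //; rewrite lee_fin ltW.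
by rewrite -EFinM lee_fin mulrC divfK// gt_eqF.
Qed.

Lemma translation_cvg (X : normedModType R) (u : measurableTypeR R -> X) (e : R) :
  strongly_measurable setT u -> (\int[mu]_x (`|u x| ^+ 2)%:E < +oo)%E -> 0 < e ->
  \forall h \near (0 : R),
    (\int[mu]_x (`|u (x + h)%R - u x| ^+ 2)%:E <= e%:E)%E.
Proof.
move=> mu' intu e0.
have [s [ss sle sf]] := simple_approximation (@measurableT _ (measurableTypeR R)) mu'.
have mn := strongly_measurable_norm measurableT mu'.
have msn n : strongly_measurable setT (s n).
  by exists (fun=> s n) => // t _; exact: cvg_cst.
have mus n := strongly_measurable_norm measurableT (strongly_measurableB mu' (msn n)).
(* Three error terms of size e / 9, with the factor 3 of [sqr_le_sum3], add up to e. *)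
have e9 : 0 < e / 9 by rewrite divr_gt0.
have c0 : (\int[mu]_x (`|u x - s n x| ^+ 2)%:E)%E @[n --> \oo] --> 0%E.
  rewrite -[X in _ --> X](integral0 mu setT).
  apply: (dominated_cvg measurableT (g := fun t => (9%:E * (`|u t| ^+ 2)%:E)%E)) => //.
  - by move=> n; apply/measurable_EFinP; apply: measurable_funX; exact: mus.
  - move=> t _; apply: cvg_EFin; first by near=> n.
    have c : `|u t - s n t| @[n --> \oo] --> (0 : R).
      rewrite -[X in _ --> X](@normr0 _ X); apply: cvg_norm.
      by rewrite -(subrr (u t)); apply: cvgB; [exact: cvg_cst|exact: sf].
    suff : `|u t - s n t| * `|u t - s n t| @[n --> \oo] --> (0 : R).
      by apply: cvg_trans; apply: near_eq_cvg; near=> n; rewrite /= expr2.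
    by rewrite -[X in _ --> X](mulr0 (0 : R)); exact: cvgM.
  - apply: integrableZl => //; apply/integrableP; split.
      by apply/measurable_EFinP; exact: measurable_funX.
    by under eq_integral do rewrite /= ger0_norm ?sqr_ge0//.
  - move=> n t _; rewrite /= ger0_norm ?sqr_ge0// -EFinM lee_fin.
    rewrite (_ : 9 = 3 ^+ 2); last by ring.
    rewrite -exprMn ler_pXn2r ?nnegrE ?mulr_ge0//.
    by rewrite (le_trans (ler_normB _ _))//; have := sle n t I; lra.
have [n hn] : exists n, (\int[mu]_x (`|u x - s n x| ^+ 2)%:E <= (e / 9)%:E)%E.
  have /fine_cvgP[fin /cvgr0Pnorm_le/(_ _ e9) cv] := c0.
  near \oo => n; exists n.
  rewrite -[leLHS]fineK; last by near: n.
  by rewrite lee_fin (le_trans (ler_norm _))//; near: n.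
(* Chebyshev's inequality, from |s_n| <= 2 |u| and the finite L^2 norm of u. *)
have fins y : y != 0 -> (mu (s n @^-1` [set y]) < +oo)%E.
  move=> y0; have ms : measurable (s n @^-1` [set y]) by exact: (ss n).2.
  have y2 : 0 < `|y| ^+ 2 by rewrite exprn_gt0// normr_gt0.
  have h : ((`|y| ^+ 2)%:E * mu (s n @^-1` [set y]) <=
      4%:E * \int[mu]_x (`|u x| ^+ 2)%:E)%E.
    rewrite -ge0_integralZl//=; last by apply/measurable_EFinP; exact: measurable_funX.
    rewrite -[X in mu X]setIT -(integral_indic mu measurableT ms).
    rewrite -ge0_integralZl//=; last by apply/measurable_EFinP; exact: measurable_indic.
    apply: ge0_le_integral => //=.
    - by apply: measurable_funeM; apply/measurable_EFinP; exact: measurable_indic.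
    - by apply: measurable_funeM; apply/measurable_EFinP; exact: measurable_funX.
    move=> t _; rewrite -!EFinM lee_fin indicE.
    have [st|st] := pselect (s n t = y); last first.
      by rewrite memNset// mulr0 mulr_ge0// sqr_ge0.
    rewrite mem_set// mulr1 -st (_ : 4 = 2 ^+ 2); last by ring.
    by rewrite -exprMn ler_pXn2r ?nnegrE ?mulr_ge0//; exact: sle.
  rewrite ltey; apply/eqP => E; move: h; rewrite E gt0_muley ?lte_fin//.
  rewrite leye_eq => /eqP E2;
  have h4 : (4%:E * \int[mu]_x (`|u x| ^+ 2)%:E < +oo)%E by rewrite lte_mul_pinfty.
  by rewrite E2 in h4.
have := simple_translation_cvg (ss n) fins e9.
apply: filterS => h hh.
have mh : measurable_fun [set: measurableTypeR R] (fun x : measurableTypeR R => x + h : measurableTypeR R).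
  exact: measurable_funD.
have m1 : measurable_fun [set: R] (fun x => (`|u (x + h) - s n (x + h)| ^+ 2)%:E).
  apply/measurable_EFinP; apply: measurable_funX.
  exact: (measurableT_comp (mus n) mh).
have m2 : measurable_fun [set: R] (fun x => (`|s n (x + h) - s n x| ^+ 2)%:E).
  apply/measurable_EFinP; apply: measurable_funX.
  apply: strongly_measurable_norm => //; apply: strongly_measurableB; last exact: msn.
  exact: (strongly_measurable_precomp mh (msn n)).
have m3 : measurable_fun [set: R] (fun x => (`|u x - s n x| ^+ 2)%:E).
  by apply/measurable_EFinP; apply: measurable_funX; exact: mus.
have m0 : measurable_fun [set: R] (fun x => (`|u (x + h) - u x| ^+ 2)%:E).
  apply/measurable_EFinP; apply: measurable_funX.
  apply: strongly_measurable_norm => //; apply: strongly_measurableB; last exact: mu'.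
  exact: (strongly_measurable_precomp mh mu').
have sq0 (a : R) : (0 <= (a ^+ 2)%:E)%E by rewrite lee_fin sqr_ge0.
apply: (@le_trans _ _ (\int[mu]_x (3%:E * ((`|u (x + h)%R - s n (x + h)%R| ^+ 2)%:E +
    ((`|s n (x + h)%R - s n x| ^+ 2)%:E + (`|u x - s n x| ^+ 2)%:E))))%E).
  apply: ge0_le_integral => //=.
    by apply: measurable_funeM; apply: emeasurable_funD => //; exact: emeasurable_funD.
  move=> x _; rewrite -!EFinD -EFinM lee_fin.
  have : `|u (x + h) - u x| <= `|u (x + h) - s n (x + h)| +
      (`|s n (x + h) - s n x| + `|u x - s n x|).
    rewrite (_ : u (x + h) - u x = (u (x + h) - s n (x + h)) +
        ((s n (x + h) - s n x) - (u x - s n x))).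
      by rewrite (le_trans (ler_normD _ _))// lerD2l ler_normB.
    by rewrite opprB [X in _ = _ + X]addrA subrK addrA subrK.
  exact: sqr_le_sum3.
rewrite ge0_integralZl//=; last 2 first.
- by apply: emeasurable_funD => //; exact: emeasurable_funD.
- by move=> x _; rewrite !adde_ge0.
rewrite ge0_integralD//=; last 2 first.
- by move=> x _; rewrite adde_ge0.
- exact: emeasurable_funD.
rewrite ge0_integralD//=.
have -> : (\int[mu]_x (`|u (x + h)%R - s n (x + h)%R| ^+ 2)%:E =
    \int[mu]_x (`|u x - s n x| ^+ 2)%:E)%E.
  exact: (@ge0_integral_translate _ (fun x => (`|u x - s n x| ^+ 2)%:E) h m3).
apply: (@le_trans _ _ (3%:E * ((e / 9)%:E + ((e / 9)%:E + (e / 9)%:E)))%E).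
  by apply: lee_wpmul2l => //; apply: leeD => //; exact: leeD.
rewrite -!EFinD -EFinM lee_fin; lra.
Unshelve. all: by end_near. Qed.

End translation_continuity.

(** * Second differences in the mean *)

Section remainder.
Context (R : realType).
Local Notation RT := (measurableTypeR R).
Local Notation mu := (@lebesgue_measure R).

Lemma integral_translate (f : R -> \bar R) (a : R) :
  measurable_fun [set: R] f -> (\int[mu]_x f (x + a)%R = \int[mu]_x f x)%E.
Proof.
move=> mf; rewrite integralE [RHS]integralE; congr (_ - _)%E.
- rewrite -(ge0_integral_translate a (measurable_funepos mf))//.
  by apply: eq_integral => x _; rewrite ?funeposE ?funenegE.
- rewrite -(ge0_integral_translate a (measurable_funeneg mf))//.
  by apply: eq_integral => x _; rewrite ?funeposE ?funenegE.
Qed.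

Lemma strongly_measurable_shift (X : normedModType R) (u : RT -> X) (a : R) :
  strongly_measurable setT u -> strongly_measurable setT (fun x : RT => u (x + a)).
Proof.
move=> su; apply: (@strongly_measurable_precomp _ _ RT RT R X (fun x => x + a) setT u) => //.
exact: measurable_funD.
Qed.

Lemma second_difference_split (X : normedModType R) (a b c : X) :
  a + b - 2 *: c = (a - c) - (c - b).
Proof. by rewrite opprB scaler_nat mulr2n opprD addrACA. Qed.

(** The second difference is a translation increment by h - s, taken at x + s, minus one by s, taken
    at x; both shifts are shorter than d. *)
Lemma second_difference_le (X : normedModType R) (u : RT -> X) (e d h s : R) :
  strongly_measurable setT u ->
  (forall h, `|h| < d -> (\int[mu]_x (`|u (x + h)%R - u x| ^+ 2)%:E <= (e ^+ 2)%:E)%E) ->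
  0 < s <= h -> h < d ->
  (\int[mu]_x (`|u (x + h)%R + u x - 2 *: u (x + s)%R| ^+ 2)%:E <= ((2 * e) ^+ 2)%:E)%E.
Proof.
move=> su ue /andP[s0 sh] hd.
have m1 (a b : R) : measurable_fun [set: R] (fun x => (`|u (x + a) - u (x + b)| ^+ 2)%:E).
  apply/measurable_EFinP; apply: measurable_funX.
  apply: (@strongly_measurable_norm _ RT R X setT) => //.
  by apply: strongly_measurableB; exact: strongly_measurable_shift.
have m0 (a : R) : measurable_fun [set: R] (fun x => (`|u (x + a) - u x| ^+ 2)%:E).
  by have := m1 a 0; under eq_fun do rewrite addr0.
have m2 : measurable_fun [set: R] (fun x => (`|u (x + h)%R + u x - 2 *: u (x + s)%R| ^+ 2)%:E).
  apply/measurable_EFinP; apply: measurable_funX.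
  apply: (@strongly_measurable_norm _ RT R X setT) => //.
  have -> : (fun x => u (x + h) + u x - 2 *: u (x + s)) =
      (fun x => (u (x + h) - u (x + s)) - (u (x + s) - u x)).
    by apply/funext => x; exact: second_difference_split.
  apply: (@strongly_measurableB _ RT); apply: strongly_measurableB => //.
  - exact: strongly_measurable_shift.
  - exact: strongly_measurable_shift.
  - exact: strongly_measurable_shift.
apply: (@le_trans _ _ (\int[mu]_x (2%:E * ((`|u (x + h)%R - u (x + s)%R| ^+ 2)%:E +
    (`|u (x + s)%R - u x| ^+ 2)%:E)))%E).
  apply: ge0_le_integral => //=.
  - by apply: measurable_funeM; exact: (emeasurable_funD (m1 h s) (m0 s)).
  move=> x _; rewrite -EFinD -EFinM lee_fin.
  have : `|u (x + h) + u x - 2 *: u (x + s)| <=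
      `|u (x + h) - u (x + s)| + `|u (x + s) - u x|.
    by rewrite second_difference_split ler_normB.
  move: (normr_ge0 (u (x + h) + u x - 2 *: u (x + s))).
  set a := `|_|; set b := `|_|; set c := `|_| => a0 abc.
  apply: (@le_trans _ _ ((b + c) ^+ 2)).
    by rewrite ler_pXn2r ?nnegrE// (le_trans a0).
  have := sqr_ge0 (b - c); rewrite !expr2; lra.
rewrite ge0_integralZl//=; last 2 first.
- exact: (emeasurable_funD (m1 h s) (m0 s)).
- by move=> x _; rewrite adde_ge0// lee_fin sqr_ge0.
rewrite ge0_integralD//=; [|exact: (m1 h s)|exact: m0].
have -> : (\int[mu]_x (`|u (x + h)%R - u (x + s)%R| ^+ 2)%:E =
    \int[mu]_x (`|u (x + (h - s))%R - u x| ^+ 2)%:E)%E.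
  rewrite -(@ge0_integral_translate _ (fun x => (`|u (x + (h - s))%R - u x| ^+ 2)%:E) s)//.
  by apply: eq_integral => x _; rewrite -addrA [s + _]addrC subrK.
apply: (@le_trans _ _ (2%:E * ((e ^+ 2)%:E + (e ^+ 2)%:E))%E).
  apply: lee_wpmul2l => //; apply: leeD; apply: ue; rewrite ger0_norm; lra.
rewrite -EFinD -EFinM lee_fin exprMn; lra.
Qed.

(* Replacing the average of u(r) and u(r + h) by u(r + s), 0 < s <= h, costs o(h)
   after integration against w, since translations are continuous in L^2. *)
Lemma remainder_le (X : normedModType R) (u : RT -> X) (w : R -> R) (K e : R) :
  strongly_measurable setT u -> (\int[mu]_x (`|u x| ^+ 2)%:E < +oo)%E ->
  measurable_fun setT w -> (forall x, 0 <= w x) -> 0 <= K ->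
  (\int[mu]_x (w x ^+ 2)%:E <= (K ^+ 2)%:E)%E -> 0 < e ->
  exists2 d, 0 < d & forall h, 0 < h -> h < d ->
    measurable_fun [set: R] (fun r : R => \int[mu]_s (\1_(`]0%R, h]%classic) s *
      (w (r + s)%R * `|u (r + h)%R + u r - 2 *: u (r + s)%R|))%:E)%E /\
    (\int[mu]_r \int[mu]_s (\1_(`]0%R, h]%classic) s * (w (r + s)%R *
      `|u (r + h)%R + u r - 2 *: u (r + s)%R|))%:E <= (e * h)%:E)%E.
Proof.
move=> su uL2 mw w0 K0 hK e0.
(* Tonelli and Cauchy-Schwarz will give the bound 2 K e' h; the added 1 covers K = 0. *)
pose e' := e / (2 * K + 1).
have K1 : 0 < 2 * K + 1 by rewrite ltr_wpDl// mulr_ge0.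
have e'0 : 0 < e' by rewrite divr_gt0.
have := @translation_cvg R X u (e' ^+ 2) su uL2 (exprn_gt0 _ e'0).
move=> /nbhs_ballP[d /= d0 hd].
exists d => // h h0 hlt.
have ud s : `|s| < d -> (\int[mu]_x (`|u (x + s)%R - u x| ^+ 2)%:E <= (e' ^+ 2)%:E)%E.
  by move=> sd; apply: hd; rewrite /ball/= sub0r normrN.
pose F (z : R * R) : \bar R := (\1_(`]0%R, h]%classic) z.2 * (w (z.1 + z.2) *
  `|u (z.1 + h) + u z.1 - 2 *: u (z.1 + z.2)|))%:E.
have sp (p : RT * RT -> RT) : measurable_fun setT p -> strongly_measurable setT (u \o p).
  by move=> mp; exact: (@strongly_measurable_precomp _ _ RT _ R X p setT u).
have mF : measurable_fun [set: RT * RT] F.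
  apply/measurable_EFinP; apply: measurable_funM.
    apply: (@measurableT_comp _ _ _ _ _ _ (\1_(`]0%R, h]%classic) : R -> R)) => //.
  apply: measurable_funM.
    by apply: (measurableT_comp mw); exact: measurable_funD.
  apply: (@strongly_measurable_norm _ _ R X setT) => //.
  have -> : (fun z : RT * RT => u (z.1 + h) + u z.1 - 2 *: u (z.1 + z.2)) =
      (fun z => (u (z.1 + h) - u (z.1 + z.2)) - (u (z.1 + z.2) - u z.1)).
    by apply/funext => x; exact: second_difference_split.
  apply: strongly_measurableB; apply: strongly_measurableB.
  - apply: (sp (fun z => z.1 + h)); exact: measurable_funD.
  - apply: (sp (fun z => z.1 + z.2)); exact: measurable_funD.
  - apply: (sp (fun z => z.1 + z.2)); exact: measurable_funD.
  - by apply: (sp (fun z => z.1)); exact: measurable_fst.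
have F0 z : (0 <= F z)%E by rewrite lee_fin !mulr_ge0.
split; first exact: (@measurable_fun_fubini_tonelli_F _ _ RT RT R mu F).
rewrite (@fubini_tonelli _ _ RT RT R mu mu F mF F0) /F /=.
apply: (@le_trans _ _ (\int[mu]_s ((K * (2 * e'))%:E * (\1_(`]0%R, h]%classic) s)%:E))%E).
  apply: ge0_le_integral => //=.
  - by move=> s _; apply: integral_ge0 => r _; exact: (F0 (r, s)).
  - exact: (@measurable_fun_fubini_tonelli_G _ _ RT RT R mu F).
  - by apply: measurable_funeM; apply/measurable_EFinP; exact: measurable_indic.
  move=> s _; rewrite indicE.
  have [sh|sh] := boolP (s \in `]0%R, h]%classic); last first.
    by under eq_integral do rewrite mul0r; rewrite integral0 mule0.
  under eq_integral do rewrite mul1r.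
  rewrite mule1; move: sh; rewrite inE/= in_itv/= => sh.
  apply: cauchy_schwarz_le => //.
  - apply: (measurableT_comp mw); exact: measurable_funD.
  - apply: (@strongly_measurable_norm _ RT R X setT) => //.
    have -> : (fun x => u (x + h) + u x - 2 *: u (x + s)) =
        (fun x => (u (x + h) - u (x + s)) - (u (x + s) - u x)).
      by apply/funext => x; exact: second_difference_split.
    apply: (@strongly_measurableB _ RT); apply: strongly_measurableB => //.
    + exact: strongly_measurable_shift.
    + exact: strongly_measurable_shift.
    + exact: strongly_measurable_shift.
  - by rewrite mulr_ge0// ltW.
  - have mw2 : measurable_fun [set: R] (fun x => (w x ^+ 2)%:E).
      by apply/measurable_EFinP; exact: measurable_funX.
    by rewrite (ge0_integral_translate s mw2)// => x; rewrite lee_fin sqr_ge0.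
  - exact: second_difference_le ud _ _.
rewrite ge0_integralZl//=; first last.
- by rewrite lee_fin mulr_ge0// mulr_ge0// ltW.
- by apply/measurable_EFinP; exact: measurable_indic.
rewrite integral_indic//= setIT lebesgue_measure_itv/= lte_fin h0 -EFinB subr0.
rewrite -EFinM lee_fin; apply: ler_wpM2r; first exact: ltW.
rewrite /e' mulrA mulrA ler_pdivrMr//; nra.
Qed.

End remainder.

Section almost_everywhere.
Context d (T : measurableType d) (R : realType) (mu : {measure set T -> \bar R}).

Lemma ae_imply (P Q : T -> Prop) : (forall x, P x -> Q x) ->
  {ae mu, forall x, P x} -> {ae mu, forall x, Q x}.
Proof. by move=> PQ; apply: negligibleS => x /= nQ Px; exact: nQ (PQ _ Px). Qed.

Lemma ae_conj (P Q : T -> Prop) : {ae mu, forall x, P x} ->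
  {ae mu, forall x, Q x} -> {ae mu, forall x, P x /\ Q x}.
Proof.
move=> aP aQ; apply: negligibleS (negligibleU aP aQ) => x /= /not_andP.
by move=> [?|?]; [left|right].
Qed.

End almost_everywhere.

Lemma ae_translate (R : realType) (P : R -> Prop) (h : R) :
  {ae (@lebesgue_measure R), forall x, P x} ->
  {ae (@lebesgue_measure R), forall x, P (x + h)}.
Proof.
move=> [A [mA A0 PA]]; pose B : set (measurableTypeR R) := (fun x => x + h) @^-1` A.
have mB : measurable B.
  rewrite -[X in measurable X]setTI.
  by apply: (measurable_funD (@measurable_id _ R setT) (@measurable_cst _ _ R R setT h)).
exists B; split => //; last by move=> x /= nP; exact: PA.
have mI : measurable_fun [set: R] (fun x => (\1_A x : R)%:E).
  by apply/measurable_EFinP; exact: (@measurable_indic _ (measurableTypeR R) R setT A mA).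
have IB := integral_indic (@lebesgue_measure R) measurableT mB.
have IA := integral_indic (@lebesgue_measure R) measurableT mA.
rewrite setIT in IB; rewrite setIT in IA.
rewrite -[LHS]IB -[RHS]A0 -[RHS]IA.
by apply: (ge0_integral_translate h mI) => x; rewrite lee_fin.
Qed.

(** * Continuous functions with small increments in the mean *)

Section increments.
Context (R : realType).
Local Notation mu := (@lebesgue_measure R).

Lemma Rintegral_shift_itv (f : R -> R) (a b h : R) :
  measurable_fun `]a + h, b + h]%classic f ->
  \int[mu]_(t in `]a, b]) f (t + h) = \int[mu]_(t in `]a + h, b + h]) f t.
Proof.
move=> mf; rewrite Rintegral_mkcond [RHS]Rintegral_mkcond /Rintegral.
have mf' : measurable_fun [set: R] (fun x => ((f \_ `]a + h, b + h]%classic) x)%:E).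
  by apply/measurable_EFinP; exact/(measurable_restrictT _ _).1.
rewrite -(integral_translate h mf'); congr fine; apply: eq_integral => x _.
rewrite !patchE; congr EFin; rewrite !mem_setE !in_itv/= ltrD2r lerD2r.
by [].
Qed.

Lemma Rintegral_itv_chasles (f : R -> R) (a b c : R) : a <= b -> b <= c ->
  mu.-integrable `]a, c] (EFin \o f) ->
  \int[mu]_(t in `]a, c]) f t =
  \int[mu]_(t in `]a, b]) f t + \int[mu]_(t in `]b, c]) f t.
Proof.
move=> ab bc intf.
by rewrite -(@Rintegral_itvB _ f (BRight a) (BRight c) b)// addrC subrK.
Qed.

Lemma Rintegral_itv_mean (f : R -> R) (a h k e : R) : 0 < h ->
  mu.-integrable `]a, a + h] (EFin \o f) ->
  (forall t, t \in `]a, a + h] -> `|f t - k| <= e) ->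
  `|\int[mu]_(t in `]a, a + h]) f t - h * k| <= e * h.
Proof.
move=> h0 intf fk.
have mI : fine (mu `]a, a + h]%classic) = h.
  by rewrite lebesgue_measure_itv/= lte_fin ltrDl h0 -EFinB/= addrC addKr.
have fin : (mu `]a, (a + h)%R]%classic < +oo)%E.
  by rewrite lebesgue_measure_itv/= lte_fin ltrDl h0 -EFinB ltry.
have ick (r : R) : mu.-integrable `]a, a + h] (fun=> r%:E).
  by apply/integrableP; split => //; rewrite integral_cst//= lte_mul_pinfty.
have -> : h * k = \int[mu]_(t in `]a, a + h]) k.
  by rewrite Rintegral_cst//= mulrC mI.
rewrite -RintegralB//.
apply: le_trans (le_normr_Rintegral _ (integrableB _ intf (ick k))) _ => //.
rewrite -[X in _ <= e * X]mI -Rintegral_cst//.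
apply: le_Rintegral => //.
- by apply: integrable_norm; exact: (integrableB _ intf (ick k)).
- exact: ick.
- exact: ick.
Qed.

(* F is only controlled in the mean: the bound on the average over r of
   |F (r + h) - F r| is transferred to |F t - F s| by comparing the averages of F
   over the intervals ]s, s + h] and ]t, t + h]. *)
Lemma constant_of_increments (F : R -> R) (T : R) :
  {within `[0, T], continuous F} ->
  (forall e, 0 < e -> exists2 d, 0 < d & forall h, 0 < h -> h < d ->
    exists rho : R -> \bar R, [/\ measurable_fun setT rho,
      forall r, (0 <= rho r)%E,
      {ae mu, forall r, 0 < r -> r + h < T ->
         ((`|F (r + h) - F r|)%:E <= rho r)%E} &
      (\int[mu]_r rho r <= (e * h)%:E)%E]) ->
  forall s t, 0 < s -> s < t -> t < T -> F t = F s.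
Proof.
move=> cF hF s t s0 st tT; apply/eqP; rewrite -subr_eq0 -normr_eq0.
rewrite -[_ == _]negbK; apply/negP => n0.
have k0 : 0 < `|F t - F s| by rewrite lt_neqAle eq_sym n0 normr_ge0.
(* The comparison of averages ends with three errors of size e h, so a quarter of the gap already
   gives a contradiction. *)
pose e := `|F t - F s| / 4; have e0 : 0 < e by rewrite divr_gt0.
have T0 : 0 < T by lra.
have [cF' _ _] := (continuous_within_itvP F T0).1 cF.
have near_const x : 0 < x -> x < T -> exists2 d, 0 < d &
    forall y, x <= y -> y < x + d -> `|F y - F x| <= e.
  move=> x0 xT; have cx : {for x, continuous F} by apply: cF'; rewrite in_itv/= x0.
  have /cvgrPdist_le/(_ _ e0) := cx.
  rewrite near_simpl => /nbhs_ballP[d /= d0 hd]; exists d => // y xy yd.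
  by rewrite distrC; apply: hd; rewrite /ball/= distrC ger0_norm; lra.
have [ds ds0 hds] := near_const s s0 (lt_trans st tT).
have [dt dt0 hdt] := near_const t (lt_trans s0 st) tT.
have [d d0 hd] := hF e e0.
pose m := Num.min (Num.min ds dt) (Num.min d (Num.min (t - s) (T - t))).
have m0 : 0 < m by rewrite !lt_min ds0 dt0 d0 !subr_gt0 st tT.
pose h := m / 2; have h0 : 0 < h by rewrite divr_gt0.
have hm : h < m by rewrite /h; lra.
have := hm; rewrite !lt_min => /andP[/andP[hs ht] /andP[hdd /andP[hts hTt]]].
have hTs : t + h < T by lra.
have {}hTt : t + h <= T by exact: ltW.
have [s0' t0'] : 0 <= s /\ 0 <= t by split; lra.
have tT' : t <= T by lra.
have shT : s + h <= T by lra.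
have le1 : s <= t by lra.
have le2 : t <= t + h by lra.
have le3 : s <= s + h by lra.
have le4 : s + h <= t + h by lra.
have sh0 : 0 <= s + h by lra.
have [rho [mrho rho0 Frho Irho]] := hd h h0 hdd.
have intF a b : 0 <= a -> b <= T -> mu.-integrable `]a, b] (EFin \o F).
  move=> a0 bT; have : mu.-integrable `[0, T] (EFin \o F).
    by apply: continuous_compact_integrable => //; exact: segment_compact.
  apply: integrableS => // x /=; rewrite !in_itv/= => /andP[x1 x2].
  by clear -x1 x2 a0 bT; apply/andP; split; lra.
have mF a b : 0 <= a -> b <= T -> measurable_fun `]a, b]%classic F.
  by move=> a0 bT; have /integrableP[/measurable_EFinP] := intF a b a0 bT.
have intFh : mu.-integrable `]s, t] (EFin \o (fun r => F (r + h))).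
  have : mu.-integrable `[s, t] (EFin \o (fun r => F (r + h))).
    apply: continuous_compact_integrable; first exact: segment_compact.
    apply: continuous_in_subspaceT => r; rewrite inE/= in_itv/= => /andP[r1 r2].
    have crh : {for r + h, continuous F}
      by apply: cF'; rewrite in_itv/=; clear -s0 r1 h0 r2 hTs; apply/andP; split; lra.
    apply: (@continuous_comp _ _ _ (fun r => r + h) F) => //.
    by apply: cvgD; [exact: cvg_id|exact: cvg_cst].
  by apply: integrableS => //; exact: subset_itv_oc_cc.
(* The integral of the increments telescopes: the overlap of the two translated intervals cancels
   and only two intervals of length h remain. *)
have E1 : \int[mu]_(r in `]s, t]) (F (r + h) - F r) =
    \int[mu]_(r in `]t, t + h]) F r - \int[mu]_(r in `]s, s + h]) F r.
  rewrite RintegralB//; last exact: intF.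
  rewrite Rintegral_shift_itv; last exact: mF.
  have := @Rintegral_itv_chasles F s (s + h) (t + h).
  have := @Rintegral_itv_chasles F s t (t + h).
  have it : mu.-integrable `]s, t + h] (EFin \o F) by exact: intF.
  move=> /(_ le1 le2 it) -> /(_ le3 le4 it) h1.
  by apply/eqP; rewrite subr_eq addrAC eq_sym subr_eq addrC h1 addrC.
have E2 : `|\int[mu]_(r in `]s, t]) (F (r + h) - F r)| <= e * h.
  have ist : mu.-integrable `]s, t] (EFin \o F) by exact: intF.
  have id : mu.-integrable `]s, t] (EFin \o (fun r => F (r + h) - F r)).
    exact: (integrableB _ intFh ist).
  rewrite -lee_fin EFin_normr_Rintegral//.
  apply: le_trans (le_abse_integral _ _ _) _ => //.
    by case/integrableP : id.
  apply: le_trans Irho; apply: le_trans (_ : \int[mu]_(r in `]s, t]) rho r <= _)%E; last first.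
    exact: ge0_subset_integral.
  apply: ae_ge0_le_integral => //.
  - by apply: measurableT_comp => //; case/integrableP : id.
  - exact: measurable_funTS.
  apply: ae_imply Frho => r hr /=; rewrite in_itv/= => /andP[r1 r2].
  by apply: hr; clear -s0 r1 r2 hTs; lra.
have E3 : `|\int[mu]_(r in `]t, t + h]) F r - h * F t| <= e * h.
  apply: Rintegral_itv_mean => //; first exact: intF.
  by move=> x; rewrite in_itv/= => /andP[x1 x2]; apply: hdt; clear -x1 x2 ht; lra.
have E4 : `|\int[mu]_(r in `]s, s + h]) F r - h * F s| <= e * h.
  apply: Rintegral_itv_mean => //; first exact: intF.
  by move=> x; rewrite in_itv/= => /andP[x1 x2]; apply: hds; clear -x1 x2 hs; lra.
have : `|h * (F t - F s)| <= 3 * e * h.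
  move: E1 E2 E3 E4.
  move: (\int[mu]_(r in `]s, t]) (F (r + h) - F r)).
  move: (\int[mu]_(r in `]t, t + h]) F r) (\int[mu]_(r in `]s, s + h]) F r).
  move=> A B C ->; rewrite !ler_norml => /andP[? ?] /andP[? ?] /andP[? ?].
  by apply/andP; split; lra.
rewrite normrM (gtr0_norm h0) mulrC ler_pM2r// /e; lra.
Qed.

Lemma constant_closure (F : R -> R) (T : R) : 0 < T ->
  {within `[0, T], continuous F} ->
  (forall s t, 0 < s -> s < t -> t < T -> F t = F s) ->
  forall t, t \in `[0, T] -> F t = F 0.
Proof.
move=> T0 cF hF; have [_ cF0 cFT] := (continuous_within_itvP F T0).1 cF.
have T2 : 0 < T / 2 by rewrite divr_gt0.
have TT : T / 2 < T by lra.
have cst_in t : 0 < t -> t < T -> F t = F (T / 2).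
  move=> t0 tT; have [tt|tt|->//] := ltgtP t (T / 2).
    by rewrite (hF t (T / 2)).
  by rewrite (hF (T / 2) t).
have F0 : F 0 = F (T / 2).
  apply: (cvg_unique _ cF0); first exact: Rhausdorff.
  apply: cvg_near_cst; near=> x; apply: cst_in.
    by near: x; exact: nbhs_right_gt.
  by near: x; exact: nbhs_right_lt.
have FT : F T = F (T / 2).
  apply: (cvg_unique _ cFT); first exact: Rhausdorff.
  apply: cvg_near_cst; near=> x; apply: cst_in.
    by near: x; exact: nbhs_left_gt.
  by near: x; exact: nbhs_left_lt.
move=> t; rewrite in_itv/= F0 le_eqVlt => /andP[/predU1P[<-//|t0]].
rewrite le_eqVlt => /predU1P[->//|tT]; exact: cst_in.
Unshelve. all: by end_near. Qed.

End increments.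

Section inner_product.
Context (R : realType) (H : hilbertType R).
Implicit Types x y z : H.

Lemma innerDl x y z : inner (x + y) z = inner x z + inner y z.
Proof. by have := inner_linearl 1 x y z; rewrite scale1r mul1r. Qed.

Lemma innerBl x y z : inner (x - y) z = inner x z - inner y z.
Proof.
by have := inner_linearl (-1) y x z; rewrite scaleN1r mulN1r addrC => ->; rewrite addrC.
Qed.

Lemma innerDr x y z : inner z (x + y) = inner z x + inner z y.
Proof. by rewrite innerC innerDl !(innerC z). Qed.

(** The reason for testing with w(r) + w(r + h): by symmetry of the inner product it makes the
    increment of the squared norm exact. *)
Lemma sqr_normB_inner x y : `|x| ^+ 2 - `|y| ^+ 2 = inner x (x + y) - inner y (x + y).
Proof. by rewrite -!inner_norm !innerDr (innerC y x); ring. Qed.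

Lemma innerl_continuous z : continuous (fun x : H => inner x z : R^o).
Proof.
apply: (@lipschitz_continuous _ _ _ _ `|z|) => // x y.
by rewrite -innerBl mulrC inner_normM.
Qed.

End inner_product.

Lemma continuous_sqr_norm (R : realType) (X : topologicalType)
    (Y : normedModType R) (f : X -> Y) :
  continuous f -> continuous (fun t => `|f t| ^+ 2).
Proof.
move=> cf t; have cn : `|f s| @[s --> t] --> `|f t| by apply: cvg_norm; exact: cf.
exact: (cvgM cn cn).
Qed.

Lemma L2_integral_norm (R : realType) (X : normedModType R) (a b : R) (f : R -> X) : L2 a b f ->
  (\int[lebesgue_measure]_(t in `]a, b[) `|f t|%:E < +oo)%E.
Proof.
move=> [sf intf]; have mf := strongly_measurable_norm (measurable_itv `]a, b[) sf.
apply: (@le_lt_trans _ _ (\int[lebesgue_measure]_(t in `]a, b[) (1 + (`|f t| ^+ 2)%:E))%E).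
  apply: ge0_le_integral => //=.
  - by apply/measurable_EFinP.
  - apply: emeasurable_funD => //.
    by apply/measurable_EFinP; exact: measurable_funX.
  - move=> t _; rewrite -EFinD lee_fin; have := sqr_ge0 (`|f t| - 1/2).
    rewrite expr2; lra.
rewrite ge0_integralD//=.
- rewrite integral_cst// mul1e lte_add_pinfty//.
  have := @lebesgue_measure_itv R `]a, b[; rewrite /= => ->.
  by case: ifP => // _; rewrite -EFinB ltry.
- by apply/measurable_EFinP; exact: measurable_funX.
Qed.

Section energy_identity.
Context (R : realType) (V H : hilbertType R) (i : dense_embedding V H) (T : R).
Hypothesis T0 : 0 < T.
Local Notation RT := (measurableTypeR R).
Local Notation mu := (@lebesgue_measure R).
Variables (u : R -> V) (w : R -> dual V) (c : R -> H).
Hypotheses (L2u : L2 0 T u) (L2w : L2 0 T w).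
Hypothesis cc : {within `[0, T], continuous c}.
Hypothesis cu : {ae mu, forall t, t \in `]0, T[ -> c t = i (u t)}.
Hypothesis incr : forall v a b, 0 < a -> a < b -> b < T ->
  \int[mu]_(t in `]a, b]) w t v = inner (c b) (i v) - inner (c a) (i v).

Let I0T := `]0, T[%classic : set RT.
Let U : RT -> V := zext I0T u.
Let W : RT -> dual V := zext I0T w.
Let g (t : R) : R := 2 * W t (U t).

Let mI0T : measurable I0T.
Proof. exact: measurable_itv. Qed.

Let sU : strongly_measurable setT U.
Proof. by apply: strongly_measurable_zext => //; case: L2u. Qed.

Let sW : strongly_measurable setT W.
Proof. by apply: strongly_measurable_zext => //; case: L2w. Qed.

Let L2U : (\int[mu]_t (`|U t| ^+ 2)%:E < +oo)%E.
Proof. by rewrite integral_zext_sqr; case: L2u. Qed.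

Let L2W : (\int[mu]_t (`|W t| ^+ 2)%:E < +oo)%E.
Proof. by rewrite integral_zext_sqr; case: L2w. Qed.

Let mg : measurable_fun [set: R] g.
Proof.
apply: measurable_funM => //.
apply: (@strongly_measurable_measurable _ RT) => //.
by apply: (strongly_measurable_comp2 (@dual_pairing_continuous R V)).
Qed.

Let mnU : measurable_fun [set: R] (fun t => `|U t|).
Proof. exact: (@strongly_measurable_norm _ RT). Qed.

Let mnW : measurable_fun [set: R] (fun t => `|W t|).
Proof. exact: (@strongly_measurable_norm _ RT). Qed.

Let integrable_sqr (f : R -> R) : measurable_fun [set: R] f ->
  (\int[mu]_t (f t ^+ 2)%:E < +oo)%E -> mu.-integrable setT (fun t => (f t ^+ 2)%:E).
Proof.
move=> mf h; apply/integrableP; split.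
  by apply/measurable_EFinP; exact: measurable_funX.
by under eq_integral do rewrite /= ger0_norm ?sqr_ge0//.
Qed.

Lemma integrable_energy_density :
  mu.-integrable setT (fun t => (2 * zext `]0, T[ w t (zext `]0, T[ u t))%:E).
Proof.
have iD : mu.-integrable setT (fun t => (`|W t| ^+ 2 + `|U t| ^+ 2)%:E).
  exact: (integrableD measurableT (integrable_sqr mnW L2W) (integrable_sqr mnU L2U)).
apply: (le_integrable _ _ _ iD) => //; first exact/measurable_EFinP.
move=> t _; rewrite /= lee_fin normrM (ger0_norm (x := 2))//.
rewrite [leRHS]ger0_norm ?addr_ge0 ?sqr_ge0//.
apply: (@le_trans _ _ (2 * (`|W t| * `|U t|))).
  by rewrite ler_wpM2l// le_dual_norm.
have := sqr_ge0 (`|W t| - `|U t|); rewrite !expr2; lra.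
Qed.

Let intg : mu.-integrable setT (EFin \o g).
Proof. exact: integrable_energy_density. Qed.

Let K := Num.sqrt (fine (\int[mu]_t (`|W t| ^+ 2)%:E)%E).

Let KW : (\int[mu]_t (`|W t| ^+ 2)%:E <= (K ^+ 2)%:E)%E.
Proof.
have p0 : (0 <= \int[mu]_t (`|W t| ^+ 2)%:E)%E.
  by apply: integral_ge0 => t _; rewrite lee_fin sqr_ge0.
by rewrite sqr_sqrtr ?fine_ge0// fineK// ge0_fin_numE.
Qed.

Let integrable_Wz z : mu.-integrable I0T (fun t => (w t z)%:E).
Proof.
by case: (L2w) => sw' _; apply: integrable_dual_app => //; exact: L2_integral_norm.
Qed.

Let F h (r s : R) : \bar R := (\1_(`]0%R, h]%classic) s * (`|W (r + s)| *
      `|U (r + h) + U r - 2 *: U (r + s)|))%:E.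

(* |c(r + h)|^2 - |c(r)|^2 is the integral over ]r, r + h] of w tested with
   u(r + h) + u(r). *)
Let pointwise r h : 0 < h -> 0 < r -> r + h < T ->
  c r = i (u r) -> c (r + h) = i (u (r + h)) ->
  ((`| `|c (r + h)| ^+ 2 - `|c r| ^+ 2 - \int[mu]_(t in `]r, r + h]) g t|)%:E <=
    \int[mu]_s F h r s)%E.
Proof.
move=> h0 r0 rhT cr crh.
have rr : r < r + h by rewrite ltrDl.
have sub : `]r, r + h] `<=` I0T.
  move=> t /=; rewrite /I0T/= !in_itv/= => /andP[t1 t2].
  by rewrite (lt_trans r0 t1) (le_lt_trans t2 rhT).
have Wt t : `]r, r + h]%classic t -> W t = w t.
  by move=> /sub tI; rewrite /W zext_in.
set z := u (r + h) + u r.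
have rI : I0T r by rewrite /I0T/= in_itv/= r0 (lt_trans rr rhT).
have rhI : I0T (r + h) by rewrite /I0T/= in_itv/= addr_gt0.
have Uz : z = U (r + h) + U r by rewrite /U !zext_in.
have -> : `|c (r + h)| ^+ 2 - `|c r| ^+ 2 = \int[mu]_(t in `]r, r + h]) w t z.
  by rewrite incr// sqr_normB_inner cr crh -linearD.
have iwz : mu.-integrable `]r, r + h] (fun t => (w t z)%:E).
  by apply: (@integrableS _ _ _ _ I0T) => //; exact: integrable_Wz.
have ig : mu.-integrable `]r, r + h] (fun t => (g t)%:E).
  by apply: (@integrableS _ _ _ _ setT).
have id : mu.-integrable `]r, r + h] (fun t => (w t z)%:E - (g t)%:E)%E.
  by apply: integrableB.
rewrite -RintegralB// EFin_normr_Rintegral//.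
apply: le_trans (le_abse_integral _ _ _) _ => //; first by case/integrableP : id.
have mz : measurable_fun [set: R] (fun t => (`|W t| * `|z - 2 *: U t|)%:E).
  apply/measurable_EFinP; apply: measurable_funM => //.
  apply: (@strongly_measurable_norm _ RT R V setT) => //.
  apply: (@strongly_measurableB _ RT); first exact: strongly_measurable_cst.
  by apply: (@strongly_measurableZ _ RT R V setT (cst 2)).
have -> : (\int[mu]_s F h r s = \int[mu]_(t in `]r, (r + h)%R])
    (`|W t| * `|z - 2 *: U t|)%:E)%E.
  rewrite [RHS]integral_mkcond.
  have mzp : measurable_fun [set: R] ((fun t => (`|W t| * `|z - 2 *: U t|)%:E)
      \_ `]r, r + h]%classic).
    by apply/(measurable_restrictT _ _).1 => //; exact: measurable_funTS.
  rewrite -(ge0_integral_translate r mzp); last first.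
    by move=> x; rewrite patchE; case: ifP => // _; rewrite lee_fin mulr_ge0.
  apply: eq_integral => s _; rewrite /F patchE indicE !mem_setE !in_itv/=.
  rewrite [s + r]addrC ltrDl lerD2l -Uz.
  by case: ifP => _; rewrite ?mul1r ?mul0r.
apply: ge0_le_integral => //=.
- case/integrableP : id => + _ => mid.
  apply/measurable_EFinP; apply: measurableT_comp => //.
  exact/measurable_EFinP.
- exact: measurable_funTS.
move=> t tI; rewrite lee_fin -(Wt t tI) /g -dualZ -dual_subr.
exact: le_dual_norm.
Qed.

Let intg_itv (A : set RT) : measurable A -> mu.-integrable A (EFin \o g).
Proof. by move=> mA; apply: integrableS intg. Qed.

(** The increments of the defect [P] over a step h are dominated, for almost every position, by the
    remainder of [remainder_le], whose integral is at most e h. Hence [P] is constant inside the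
    interval, and by continuity up to its ends. *)
Theorem energy_identity t : t \in `[0, T] ->
  `|c t| ^+ 2 = `|c 0| ^+ 2 + \int[mu]_(r in `[0, t]) g r.
Proof.
move=> t0T; pose P t : R := `|c t| ^+ 2 - \int[mu]_(r in `[0, t]) g r.
suff -> : `|c 0| ^+ 2 = P t by rewrite /P subrK.
have cP : {within `[0, T], continuous P}.
  have cI := parameterized_integral_continuous (ltW T0) (intg_itv (measurable_itv `[0, T])).
  have cn := @continuous_sqr_norm R (subspace `[0, T]) H c cc.
  by move=> x; exact: (cvgB (cn x) (cI x)).
have -> : `|c 0| ^+ 2 = P 0.
  by rewrite /P set_itv1 Rintegral_set1 subr0.
apply/esym; move: t t0T; apply: constant_closure => //.
apply: constant_of_increments => //.
move=> e e0.
have [d d0 hd] := @remainder_le R V U (fun t => `|W t|) K e sU L2U mnW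
  (fun t => normr_ge0 (W t)) (sqrtr_ge0 _) KW e0.
exists d => // h h0 hlt; have [mrho Irho] := hd h h0 hlt.
exists (fun r => \int[mu]_s F h r s)%E; split => //.
  by move=> r; apply: integral_ge0 => s _; rewrite lee_fin !mulr_ge0.
apply: ae_imply (ae_conj cu (ae_translate h cu)) => r [cr crh] r0 rhT.
apply: le_trans (pointwise h0 r0 rhT _ _).
- rewrite lee_fin /P.
  rewrite -(@Rintegral_itvB _ g (BLeft 0) (BRight (r + h)) r).
  + rewrite le_eqVlt; apply/orP; left; apply/eqP; congr `|_|; ring.
  + exact: intg_itv.
  + by rewrite bnd_simp ltW.
  + by rewrite bnd_simp lerDl ltW.
- by apply: cr; rewrite in_itv/= r0 (lt_trans _ rhT)// ltrDl.
- by apply: crh; rewrite in_itv/= rhT andbT addr_gt0.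
Qed.

End energy_identity.

(** * Weak derivatives *)

Section continuous_on_interval.
Context (R : realType).
Local Notation mu := (@lebesgue_measure R).

Lemma test_function_continuous (T : R) (phi : R -> R^o) :
  test_function T phi -> continuous phi /\ continuous (derive1 phi).
Proof.
by move=> [d _]; split=> t; apply: differentiable_continuous; apply/derivable1_diffP;
  [exact: (d 0)|exact: (d 1)].
Qed.

Lemma continuous_bounded_itv (f : R -> R^o) (a b : R) : a <= b -> continuous f ->
  exists2 M : R, 0 <= M & forall t, t \in `[a, b] -> `|f t| <= M.
Proof.
move=> ab cf.
have cn : {within `[a, b], continuous (fun t => `|f t|)}.
  by apply: continuous_subspaceT => t; apply: cvg_norm; exact: cf.
have ne : (`[a, b]%classic : set R) !=set0 by exists a; rewrite /= in_itv/= lexx.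
have [c _ hc] := compact_EVT_max ne (@segment_compact _ a b) cn.
by exists `|f c| => // t tab; apply: hc; rewrite inE.
Qed.

(* Lebesgue differentiation: the primitive is constant and its derivative is f. *)
Lemma ae_eq0_increments (f : R -> R) (T : R) :
  mu.-integrable `]0, T[ (EFin \o f) ->
  (forall a b, 0 < a -> a < b -> b < T -> \int[mu]_(t in `]a, b]) f t = 0) ->
  {ae mu, forall t, t \in `]0, T[ -> f t = 0}.
Proof.
move=> intf f0; pose g := f \_ `]0, T[.
have intg : mu.-integrable [set: R] (EFin \o g).
  rewrite /g -restrict_EFin.
  by apply: (proj1 (integrable_mkcond _ _)) => //.
have intgy y : mu.-integrable `]-oo, y] (EFin \o g).
  by apply: (@integrableS _ _ _ _ setT).
have locg : locally_integrable [set: R] g.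
  exact: integrable_locally_restrict.
pose F y := \int[mu]_(t in `]-oo, y]) g t.
have Fab a b : 0 < a -> a < b -> b < T -> F b = F a.
  move=> a0 ab bT; apply/eqP; rewrite -subr_eq0; apply/eqP.
  rewrite /F (@Rintegral_itvB _ g -oo%O (BRight b) a)//; last by rewrite bnd_simp ltW.
  rewrite -[RHS](f0 _ _ a0 ab bT); apply: eq_Rintegral => t.
  rewrite inE/= in_itv/= => /andP[ta tb]; rewrite /g patchE mem_set//=.
  by rewrite in_itv/= (lt_trans a0 ta) (le_lt_trans tb bT).
have := FTC1Ny intgy locg.
apply: ae_imply => x [dx gx] xI; move: (xI).
rewrite in_itv/= => /andP[x0 xT].
have <- : g x = f x by rewrite /g patchE mem_set.
rewrite -{}gx derive1E (@near_eq_derive _ _ _ _ (cst (F x))); first exact: derive_cst.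
near=> y.
have : y \in `]0, T[ by near: y; exact: near_in_itvoo.
rewrite in_itv/= => /andP[y0 yT].
by have [yx|yx|->//] := ltgtP y x; [apply/esym|]; apply: Fab.
Unshelve. all: by end_near. Qed.

(** Inside the interval, a nonzero difference would persist on a ball of positive measure; the
    endpoints follow by continuity. *)
Lemma eq_continuous_ae (Y : normedModType R) (T : R) (c d : R -> Y) : 0 < T ->
  {within `[0, T], continuous c} -> {within `[0, T], continuous d} ->
  {ae mu, forall t, t \in `]0, T[ -> c t = d t} ->
  forall t, t \in `[0, T] -> c t = d t.
Proof.
move=> T0 cc cd cdae.
pose y t : R := `|c t - d t|.
have cy : {within `[0, T], continuous y}.
  by move=> t; apply: cvg_norm; exact: (cvgB (cc t) (cd t)).
have yae : {ae mu, forall t, t \in `]0, T[ -> y t = 0}.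
  by apply: ae_imply cdae => t + tI => /(_ tI); rewrite /y => ->; rewrite subrr normr0.
suff y0 t : t \in `]0, T[ -> y t = 0.
  have yc : forall t, t \in `[0, T] -> y t = y 0.
    apply: constant_closure => // s r s0 sr rT.
    by rewrite !y0// in_itv/= ?s0 ?(lt_trans s0 sr)// (lt_trans sr rT).
  have y00 : y 0 = 0.
    rewrite -(yc (T / 2)); last by rewrite in_itv/=; lra.
    by apply: y0; rewrite in_itv/=; lra.
  by move=> t /yc /eqP; rewrite y00 normr_eq0 subr_eq0 => /eqP.
move=> tI; apply/eqP/negPn/negP => yt0.
have cyt : y s @[s --> t] --> y t := within_continuous_continuous T0 cy tI.
have yn : \forall s \near t, y s != 0 by exact: (cvgr_neq0 (f := y) _ cyt yt0).
have /nbhs_ballP[e /= e0 be] : \forall s \near t, y s != 0 /\ s \in `]0, T[.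
  by near=> s; split; near: s; [exact: yn|exact: near_in_itvoo].
have : mu.-negligible (ball t e : set (measurableTypeR R)).
  apply: negligibleS yae => s /be[ys sI] /= /(_ sI) ys0.
  by rewrite ys0 eqxx in ys.
rewrite negligibleP; last exact: measurable_ball.
have := @lebesgue_measure_ball R t e (ltW e0); rewrite /= => -> /eqP.
by rewrite eqe mulrn_eq0/= gt_eqF.
Unshelve. all: by end_near. Qed.

End continuous_on_interval.

Section L2_operations.
Context (R : realType).
Local Notation RT := (measurableTypeR R).
Local Notation mu := (@lebesgue_measure R).

Lemma L2_le (X Y : normedModType R) (a b M : R) (f : R -> X) (g : R -> Y) :
  strongly_measurable (T := RT) `]a, b[ g -> 0 <= M ->
  (forall t, `|g t| <= M * `|f t|) -> L2 a b f -> L2 a b g.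
Proof.
move=> sg M0 gf [sf intf]; split => //.
have mg := strongly_measurable_norm (measurable_itv `]a, b[) sg.
have mf := strongly_measurable_norm (measurable_itv `]a, b[) sf.
apply: (@le_lt_trans _ _ (\int[mu]_(t in `]a, b[) ((M ^+ 2)%:E * (`|f t| ^+ 2)%:E))%E).
  apply: ge0_le_integral => //=.
  - by apply/measurable_EFinP; exact: measurable_funX.
  - apply/measurable_EFinP; apply: measurable_funM => //; exact: measurable_funX.
  - by move=> t _; rewrite -EFinM lee_fin -exprMn lerXn2r ?nnegrE ?mulr_ge0.
rewrite ge0_integralZl//=.
- by rewrite lte_mul_pinfty// lee_fin sqr_ge0.
- by apply/measurable_EFinP; exact: measurable_funX.
- by rewrite lee_fin sqr_ge0.
Qed.

Lemma L2B (X : normedModType R) (a b : R) (f g : R -> X) :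
  L2 a b f -> L2 a b g -> L2 a b (f \- g).
Proof.
move=> [sf intf] [sg intg]; have sfg := strongly_measurableB sf sg; split => //.
have mfg := strongly_measurable_norm (measurable_itv `]a, b[) sfg.
have mf := strongly_measurable_norm (measurable_itv `]a, b[) sf.
have mg := strongly_measurable_norm (measurable_itv `]a, b[) sg.
have m2 (X' : normedModType R) (h : R -> X') : measurable_fun `]a, b[ (fun t : RT => `|h t|) ->
    measurable_fun `]a, b[ (fun t : RT => 2%:E * (`|h t| ^+ 2)%:E)%E.
  move=> mh; apply/measurable_EFinP; apply: measurable_funM => //; exact: measurable_funX.
apply: (@le_lt_trans _ _ (\int[mu]_(t in `]a, b[)
    (2%:E * (`|f t| ^+ 2)%:E + 2%:E * (`|g t| ^+ 2)%:E))%E).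
  apply: ge0_le_integral => //=.
  - by apply/measurable_EFinP; exact: measurable_funX.
  - by apply: emeasurable_funD; exact: m2.
  - move=> t _; rewrite -!EFinM -EFinD lee_fin.
    apply: (@le_trans _ _ ((`|f t| + `|g t|) ^+ 2)).
      by rewrite lerXn2r ?nnegrE ?addr_ge0// ler_normB.
    have := sqr_ge0 (`|f t| - `|g t|); rewrite !expr2; lra.
rewrite ge0_integralD//=; [|exact: m2|exact: m2].
rewrite !ge0_integralZl//=; first last.
- by apply/measurable_EFinP; exact: measurable_funX.
- by apply/measurable_EFinP; exact: measurable_funX.
by rewrite lte_add_pinfty// lte_mul_pinfty.
Qed.

End L2_operations.

Section weak_derivative.
Context (R : realType) (V H : hilbertType R) (i : dense_embedding V H).
Context (T : R) (T0 : 0 < T).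
Local Notation RT := (measurableTypeR R).
Local Notation mu := (@lebesgue_measure R).
Implicit Types (u : R -> V) (w : R -> dual V).

Lemma embed_bounded : exists2 N : R, 0 <= N & forall v, `|i v| <= N * `|v|.
Proof.
have /linear_boundedP[N [_ /(_ (`|N| + 1))]] : bounded_near i (nbhs (0 : V)).
  by apply: continuous_linear_bounded; exact: embed_continuous.
rewrite (le_lt_trans (ler_norm N)) ?ltrDl// => /(_ isT) iN.
by exists (`|N| + 1) => //; rewrite addr_ge0.
Qed.

Lemma gelfand_bounded : exists2 N : R, 0 <= N & forall x y,
  `|gelfand i (i x) - gelfand i (i y)| <= N * `|x - y|.
Proof.
have [N N0 iN] := embed_bounded; exists (N * N); first by rewrite mulr_ge0.
move=> x y; apply: dual_norm_le_mul => [|v]; first by rewrite !mulr_ge0.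
have -> : (gelfand i (i x) - gelfand i (i y)) v = inner (i (x - y)) (i v).
  by rewrite linearB innerBl.
apply: le_trans (inner_normM _ _) _.
apply: (le_trans (ler_pM (normr_ge0 _) (normr_ge0 _) (iN _) (iN v))).
by rewrite !mulrA (mulrAC N).
Qed.

Lemma L2_gelfand u : L2 0 T u -> L2 0 T (fun t => gelfand i (i (u t))).
Proof.
have [N N0 iN] := gelfand_bounded.
have g0 : gelfand i (i 0) = 0.
  apply: val_inj; apply/funext => v /=; rewrite linear0.
  by have := innerBl 0 0 (i v); rewrite !subrr.
move=> L2u; apply: (L2_le _ N0 _ L2u); last first.
  by move=> t; have := iN (u t) 0; rewrite g0 !subr0.
case: L2u => su _.
apply: (@strongly_measurable_comp _ RT _ _ _ (fun v => gelfand i (i v)) _ _ _ su).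
exact: (lipschitz_continuous N0 iN).
Qed.

Lemma bochner_dual_smul (phi : R -> R^o) w v : continuous phi -> L2 0 T w ->
  bochner mu `]0, T[ (fun t => phi t *: w t) v = \int[mu]_(t in `]0, T[) (phi t * w t v).
Proof.
move=> cphi L2w; have [sw _] := L2w.
have [M M0 phiM] := continuous_bounded_itv (ltW T0) cphi.
have mphi : measurable_fun `]0, T[%classic (phi : RT -> R).
  by apply: measurable_funTS; exact: continuous_measurable_fun.
have mI : measurable (`]0, T[%classic : set RT) by exact: measurable_itv.
have sphi : strongly_measurable `]0, T[%classic (fun t : RT => phi t *: w t).
  exact: strongly_measurableZ.
rewrite bochner_dualE//.
  have := @lebesgue_measure_itv R `]0, T[; rewrite /= lte_fin T0 => ->.
  by rewrite -EFinB ltry.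
have mw := strongly_measurable_norm mI sw.
apply: (@le_lt_trans _ _ (\int[mu]_(t in `]0%R, T[) (M%:E * `|w t|%:E))%E).
  apply: ge0_le_integral => //=.
  - by apply/measurable_EFinP; exact: strongly_measurable_norm.
  - by apply/measurable_EFinP; apply: measurable_funM.
  - move=> t tI; rewrite -EFinM lee_fin normrZ ler_wpM2r// phiM//.
    exact: subset_itv_oo_cc.
rewrite ge0_integralZl//=.
  by rewrite lte_mul_pinfty//; exact: L2_integral_norm.
by apply/measurable_EFinP.
Qed.

Lemma integrable_smul_app (phi : R -> R^o) w v : continuous phi -> L2 0 T w ->
  mu.-integrable `]0, T[ (fun t => (phi t * w t v)%:E).
Proof.
move=> cphi L2w; have [sw _] := L2w.
have [M M0 phiM] := continuous_bounded_itv (ltW T0) cphi.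
have iw : mu.-integrable `]0, T[ (fun t => (M * (w t v))%:E).
  rewrite (_ : (fun _ => _) = (fun t => M%:E * (w t v)%:E)%E)//.
  by apply: integrableZl => //; apply: integrable_dual_app => //; exact: L2_integral_norm.
apply: (le_integrable _ _ _ iw) => //=.
  apply/measurable_EFinP; apply: measurable_funM.
    by apply: measurable_funTS; exact: continuous_measurable_fun.
  have : mu.-integrable `]0, T[ (fun t => (w t v)%:E).
    by apply: integrable_dual_app => //; exact: L2_integral_norm.
  by case/integrableP => /measurable_EFinP.
move=> t tI; rewrite lee_fin !normrM (ger0_norm M0) ler_wpM2r// phiM//.
exact: subset_itv_oo_cc.
Qed.

Lemma dual_ext (f g : dual V) : (forall v, f v = g v) -> f = g.
Proof. by move=> fg; apply: val_inj; apply/funext. Qed.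

Lemma weak_derivative_app u w (phi : R -> R^o) v : L2 0 T u -> L2 0 T w ->
  is_weak_derivative i T u w -> test_function T phi ->
  \int[mu]_(t in `]0, T[) (derive1 phi t * inner (i (u t)) (i v)) =
  - \int[mu]_(t in `]0, T[) (phi t * w t v).
Proof.
move=> L2u L2w uw tphi; have [cphi cphi'] := test_function_continuous tphi.
have := congr1 (fun f : dual V => f v) (uw _ tphi).
rewrite (bochner_dual_smul v cphi' (L2_gelfand L2u)) => ->.
by rewrite -(bochner_dual_smul v cphi L2w).
Qed.

Lemma weak_derivativeB u1 u2 w1 w2 : L2 0 T u1 -> L2 0 T u2 -> L2 0 T w1 ->
  L2 0 T w2 -> is_weak_derivative i T u1 w1 -> is_weak_derivative i T u2 w2 ->
  is_weak_derivative i T (u1 \- u2) (w1 \- w2).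
Proof.
move=> L2u1 L2u2 L2w1 L2w2 d1 d2 phi tphi.
have [cphi cphi'] := test_function_continuous tphi.
have L2u := L2_gelfand (L2B L2u1 L2u2); apply: dual_ext => v.
transitivity (\int[mu]_(t in `]0, T[) (derive1 phi t * inner (i (u1 t - u2 t)) (i v))).
  exact: (bochner_dual_smul v cphi' L2u).
transitivity (- \int[mu]_(t in `]0, T[) (phi t * (w1 t v - w2 t v))); last first.
  by apply/esym; congr (- _); exact: (bochner_dual_smul v cphi (L2B L2w1 L2w2)).
under eq_Rintegral do rewrite /= linearB innerBl mulrBr.
under [in RHS]eq_Rintegral do rewrite mulrBr.
rewrite !RintegralB//; try exact: integrable_smul_app.
- rewrite (weak_derivative_app v L2u1 L2w1 d1 tphi).
  by rewrite (weak_derivative_app v L2u2 L2w2 d2 tphi) opprB opprK addrC.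
- exact: (integrable_smul_app v cphi' (L2_gelfand L2u1)).
- exact: (integrable_smul_app v cphi' (L2_gelfand L2u2)).
Qed.

(** The integrated form of the weak derivative that the energy identity takes as hypothesis. The
    continuous representative replaces [u] under the test integral, where they agree almost
    everywhere. *)
Lemma weak_derivative_increments u w c v a b : L2 0 T u -> L2 0 T w ->
  is_weak_derivative i T u w -> is_continuous_rep i T u c ->
  0 < a -> a < b -> b < T ->
  \int[mu]_(t in `]a, b]) w t v = inner (c b) (i v) - inner (c a) (i v).
Proof.
move=> L2u L2w uw [cc cu] a0 ab bT; have [sw _] := L2w.
have cin : {within `[0, T], continuous (fun t => inner (c t) (i v))}.
  move=> t; exact: (continuous_comp (cc t) (@innerl_continuous _ _ (i v) _)).
apply: (integral_test_functions a0 ab bT cin).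
  by apply: integrable_dual_app => //; exact: L2_integral_norm.
move=> phi tphi; rewrite -(weak_derivative_app v L2u L2w uw tphi).
have [_ cphi'] := test_function_continuous tphi.
congr fine; apply: ae_eq_integral => //.
- by have /integrableP[] := integrable_continuous_mul cin cphi'.
- by have /integrableP[] := integrable_smul_app v cphi' (L2_gelfand L2u).
- by apply: ae_imply cu => t ct tI; rewrite ct.
Qed.

Lemma eq0_dense (f : dual V) (D : set V) : dense D -> (forall v, D v -> f v = 0) -> f = 0.
Proof.
move=> dD fD; apply: val_inj; apply/funext => v /=; apply/eqP/negPn/negP => fv0.
have : open [set x | f x != 0].
  apply: (@open_comp _ _ (f : V -> R^o) [set x | x != 0]).
    by move=> x _; exact: dual_continuous.
  exact: open_neq.
move=> /(dD _ (ex_intro _ v fv0))[x [/= + Dx]].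
by rewrite fD// eqxx.
Qed.

(** Each v has its own null set. A countable dense set of v leaves a single one, and a functional
    vanishing on a dense set is zero. *)
Lemma weak_derivative_unique u w1 w2 : separable V -> L2 0 T u -> L2 0 T w1 -> L2 0 T w2 ->
  is_weak_derivative i T u w1 -> is_weak_derivative i T u w2 ->
  {ae mu, forall t, t \in `]0, T[ -> w1 t = w2 t}.
Proof.
move=> [D [/pcard_surjP[g sg] dD]] L2u L2w1 L2w2 d1 d2.
have L2w := L2B L2w1 L2w2; have [sw _] := L2w.
have wn n : {ae mu, forall t, t \in `]0, T[ -> (w1 \- w2) t (g n) = 0}.
  apply: ae_eq0_increments => [|a b a0 ab bT].
    by apply: integrable_dual_app => //; exact: L2_integral_norm.
  (* The difference of the two candidates is a weak derivative of 0, so its increments are those of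
     a constant. *)
  rewrite (@integral_test_functions R T a b (cst 0))//.
  - by rewrite subrr.
  - exact: cst_continuous.
  - by apply: integrable_dual_app => //; exact: L2_integral_norm.
  move=> phi tphi; have [cphi _] := test_function_continuous tphi.
  under eq_Rintegral do rewrite mulr0.
  rewrite /Rintegral integral0 -/(Rintegral _ _ _).
  under eq_Rintegral do rewrite /= -[(_ - _) (g n)]/(w1 _ (g n) - w2 _ (g n)) mulrBr.
  rewrite RintegralB//; try exact: integrable_smul_app.
  apply/esym/eqP; rewrite oppr_eq0 subr_eq0 -eqr_opp.
  rewrite -(weak_derivative_app (g n) L2u L2w1 d1 tphi).
  by rewrite -(weak_derivative_app (g n) L2u L2w2 d2 tphi).
apply: ae_imply (ae_foralln wn) => t wt tI; apply/eqP; rewrite -subr_eq0.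
by apply/eqP; apply: (eq0_dense dD) => v /sg[n _ <-]; exact: wt.
Qed.

Lemma weak_derivativeP u : in_W i T u ->
  L2 0 T (weak_derivative i T u) /\ is_weak_derivative i T u (weak_derivative i T u).
Proof. by move=> [_ /(xgetPex (fun=> 0))]. Qed.

Lemma in_WB u1 u2 : in_W i T u1 -> in_W i T u2 -> in_W i T (u1 \- u2).
Proof.
move=> W1 W2; have [L2w1 d1] := weak_derivativeP W1.
have [L2w2 d2] := weak_derivativeP W2; split; first exact: L2B W1.1 W2.1.
exists (weak_derivative i T u1 \- weak_derivative i T u2); split; first exact: L2B.
exact: weak_derivativeB W1.1 W2.1 _ _ _ _.
Qed.

(** [weak_derivative] picks a representative for each function separately, so linearity holds only
    almost everywhere. *)
Lemma ae_weak_derivativeB u1 u2 : separable V -> in_W i T u1 -> in_W i T u2 ->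
  {ae mu, forall t, t \in `]0, T[ -> weak_derivative i T (u1 \- u2) t =
    weak_derivative i T u1 t - weak_derivative i T u2 t}.
Proof.
move=> sepV W1 W2; have W := in_WB W1 W2.
have [L2w d] := weak_derivativeP W.
have [L2w1 d1] := weak_derivativeP W1; have [L2w2 d2] := weak_derivativeP W2.
apply: (weak_derivative_unique sepV W.1 L2w _ d); first exact: L2B.
exact: weak_derivativeB W1.1 W2.1 _ _ _ _.
Qed.

(** The representatives c1 and c2 carry the initial values, while [continuous_rep] makes its own
    choice; continuity forces equality at every point of [0, T], in particular at 0. *)
Lemma continuous_repB u1 u2 c1 c2 : is_continuous_rep i T u1 c1 ->
  is_continuous_rep i T u2 c2 ->
  is_continuous_rep i T (u1 \- u2) (continuous_rep i T (u1 \- u2)) /\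
  forall t, t \in `[0, T] -> continuous_rep i T (u1 \- u2) t = c1 t - c2 t.
Proof.
move=> [cc1 cu1] [cc2 cu2].
have cB : is_continuous_rep i T (u1 \- u2) (c1 \- c2).
  split; first by move=> t; exact: (cvgB (cc1 t) (cc2 t)).
  apply: ae_imply (ae_conj cu1 cu2) => t [h1 h2] tI /=.
  by rewrite linearB h1// h2.
have [cc cu] : is_continuous_rep i T (u1 \- u2) (continuous_rep i T (u1 \- u2)).
  exact: (xgetPex (fun=> 0) (ex_intro _ _ cB)).
split=> //; apply: eq_continuous_ae => //; first exact: cB.1.
by apply: ae_imply (ae_conj cu cB.2) => t [h1 h2] tI; rewrite h1// -h2.
Qed.

End weak_derivative.

(** * Exponentially weighted estimates *)

Lemma measurable_expRN (R : realType) (k : R) (A : set (measurableTypeR R)) :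
  measurable_fun A (fun t => expR (- (k * t))).
Proof.
apply: measurable_funTS; apply: continuous_measurable_fun => t.
apply: continuous_comp; last exact: continuous_expR.
by apply: cvgN; apply: cvgMr; exact: cvg_id.
Qed.

Section weighted_primitive.
Context (R : realType).
Local Notation mu := (@lebesgue_measure R).
Variables (g : R -> R) (T k : R).
Hypothesis intg : mu.-integrable `]0, T] (EFin \o g).
Hypothesis k0 : 0 <= k.
Hypothesis g0 : forall t : R, 0 < t -> t <= T -> 0 <= \int[mu]_(r in `]0, t]) g r.

Let rho (t : R) := expR (- (k * t)).

Let mrho (A : set (measurableTypeR R)) : measurable_fun A rho.
Proof. exact: measurable_expRN. Qed.

Let rho_le1 t : 0 <= t -> `|rho t| <= 1.
Proof.
by move=> t0; rewrite ger0_norm ?expR_ge0// -[leRHS]expR0 ler_expR oppr_le0 mulr_ge0.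
Qed.

Let intg_itv (a b : R) : 0 <= a -> b <= T -> mu.-integrable `]a, b] (EFin \o g).
Proof.
move=> a0 bT; apply: (integrableS _ _ _ intg) => // t /=.
by rewrite !in_itv/= => /andP[at0 tb]; rewrite (le_lt_trans a0 at0) (le_trans tb bT).
Qed.

Let intrg_itv (a b : R) : 0 <= a -> b <= T -> mu.-integrable `]a, b] (EFin \o (rho \* g)).
Proof.
move=> a0 bT; apply: (le_integrable _ _ _ (intg_itv a0 bT)) => //.
  apply/measurable_EFinP; apply: measurable_funM => //.
  by case/integrableP : (intg_itv a0 bT) => /measurable_EFinP.
move=> t /=; rewrite in_itv/= => /andP[at0 _]; rewrite lee_fin normrM ler_piMl//.
by rewrite rho_le1// (le_trans a0)// ltW.
Qed.

Let Psi (t : R) := rho t * (\int[mu]_(r in `]0, t]) g r) - \int[mu]_(r in `]0, t]) (rho r * g r).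

(* Since rho decreases and the primitive of g is nonnegative, Psi can only increase
   through the variation of rho inside the step, which is at most k * h. *)
Let Psi_step (r h : R) : 0 <= r -> 0 < h -> r + h <= T ->
  Psi (r + h) - Psi r <= k * h * \int[mu]_(t in `]r, r + h]) `|g t|.
Proof.
move=> r0 h0 rhT.
have rr : r <= r + h by rewrite lerDl ltW.
have rT : r <= T := le_trans rr rhT.
have ig := intg_itv r0 rhT; have irg := intrg_itv r0 rhT.
rewrite /Psi (Rintegral_itv_chasles r0 rr (intg_itv (lexx 0) rhT)).
rewrite (Rintegral_itv_chasles r0 rr (intrg_itv (lexx 0) rhT)).
have G0 : 0 <= \int[mu]_(t in `]0, r]) g t.
  have [->|rn0] := eqVneq r 0; first by rewrite set_itvoc0 Rintegral_set0.
  by apply: g0 => //; rewrite lt_neqAle eq_sym rn0.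
have rho_decr s : r <= s -> rho s <= rho r.
  by move=> rs; rewrite ler_expR lerN2 ler_wpM2l.
have rho_diff s : r <= s -> s <= r + h -> `|rho (r + h) - rho s| <= k * h.
  move=> rs sh; rewrite distrC ger0_norm; last first.
    by rewrite subr_ge0 ler_expR lerN2 ler_wpM2l.
  have -> : rho (r + h) = rho s * expR (- (k * (r + h - s))).
    by rewrite /rho -expRD; congr expR; ring.
  rewrite -[X in X - _]mulr1 -mulrBr.
  apply: (@le_trans _ _ (1 * (k * (r + h - s)))).
    apply: ler_pM; rewrite ?expR_ge0//.
    - by rewrite subr_ge0 -[leRHS]expR0 ler_expR oppr_le0 mulr_ge0// subr_ge0.
    - by have := rho_le1 (le_trans r0 rs); rewrite ger0_norm ?expR_ge0.
    - by rewrite lerBlDr addrC -lerBlDr; exact: expR_ge1Dx.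
  rewrite mul1r ler_wpM2l//; lra.
have -> : rho (r + h) * (\int[mu]_(t in `]0, r]) g t + \int[mu]_(t in `]r, r + h]) g t) -
    (\int[mu]_(t in `]0, r]) (rho t * g t) + \int[mu]_(t in `]r, r + h]) (rho t * g t)) -
    (rho r * \int[mu]_(t in `]0, r]) g t - \int[mu]_(t in `]0, r]) (rho t * g t)) =
    (rho (r + h) - rho r) * \int[mu]_(t in `]0, r]) g t +
    (rho (r + h) * \int[mu]_(t in `]r, r + h]) g t -
     \int[mu]_(t in `]r, r + h]) (rho t * g t)) by ring.
apply: (@le_trans _ _ (0 + k * h * \int[mu]_(t in `]r, r + h]) `|g t|)); last by rewrite add0r.
apply: lerD; first by rewrite mulr_le0_ge0// subr_le0 rho_decr.
have iz : mu.-integrable `]r, r + h] (fun t => (rho (r + h) * g t)%:E).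
  rewrite (_ : (fun _ => _) = (fun t => (rho (r + h))%:E * (g t)%:E)%E)//.
  exact: integrableZl.
have iN : mu.-integrable `]r, r + h] (fun t => (`|g t|)%:E).
  exact: (integrable_norm ig).
rewrite -RintegralZl// -RintegralB// -RintegralZl//.
apply: le_Rintegral => //.
- exact: (integrableB _ iz irg).
- rewrite (_ : _ \o _ = (fun t => (k * h)%:E * `|g t|%:E)%E)//.
  exact: integrableZl.
move=> t /=; rewrite in_itv/= => /andP[rt th].
rewrite (le_trans (ler_norm _))// -mulrBl normrM ler_wpM2r//.
by rewrite rho_diff// ltW.
Qed.

(** Integration by parts with a decreasing weight and a nonnegative primitive: the boundary term is
    kept, the other has a favourable sign. For a merely integrable [g] this is done by n + 1 equal
    steps, with total error of order 1 / (n + 1). *)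
Lemma weighted_primitive_le t : 0 <= t -> t <= T ->
  expR (- (k * t)) * (\int[mu]_(r in `]0, t]) g r) <=
  \int[mu]_(r in `]0, t]) (expR (- (k * r)) * g r).
Proof.
move=> t0 tT; rewrite -subr_le0 -/(Psi t).
have [->|tn0] := eqVneq t 0.
  by rewrite /Psi set_itvoc0 !Rintegral_set0 mulr0 subr0.
have {tn0}t_gt0 : 0 < t by rewrite lt_neqAle eq_sym tn0.
have Psin (h : R) n : 0 < h -> h * n%:R <= T ->
    Psi (h * n%:R) <= k * h * \int[mu]_(t in `]0, h * n%:R]) `|g t|.
  move=> h0; elim: n => [_|n IH].
    by rewrite mulr0 /Psi set_itvoc0 !Rintegral_set0 !mulr0 subr0.
  rewrite -addn1 natrD mulrDr mulr1 => hT.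
  have hn : 0 <= h * n%:R by rewrite mulr_ge0// ltW.
  have hh : h * n%:R <= h * n%:R + h by rewrite lerDl ltW.
  have iN : mu.-integrable `]0, h * n%:R + h] (fun t => (`|g t|)%:E).
    exact: (integrable_norm (intg_itv (lexx 0) hT)).
  rewrite (Rintegral_itv_chasles hn hh iN) mulrDr -[leLHS](subrK (Psi (h * n%:R))).
  by rewrite addrC lerD ?IH ?Psi_step// (le_trans hh).
set I := \int[mu]_(t in `]0, t]) `|g t|.
have Psile n : Psi t <= k * t * I * n.+1%:R^-1.
  have := @Psin (t / n.+1%:R) n.+1; rewrite divfK ?pnatr_eq0// => /(_ _ tT).
  rewrite divr_gt0// => /(_ isT); rewrite -/I => h; apply: (le_trans h).
  by rewrite le_eqVlt; apply/orP; left; apply/eqP; ring.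
have c0 : k * t * I * n.+1%:R^-1 @[n --> \oo] --> 0.
  by rewrite -(mulr0 (k * t * I)); apply: cvgMl_tmp; exact: cvg_harmonic.
rewrite -(cvg_lim (@Rhausdorff R) c0); apply: limr_ge; first by apply/cvg_ex; exists 0.
by near=> n; exact: Psile.
Unshelve. all: by end_near. Qed.

End weighted_primitive.

(** * Weighted Young inequality for delayed products *)

Section delay_mean.
Context (R : realType).
Local Notation RT := (measurableTypeR R).
Local Notation mu := (@lebesgue_measure R).
Variable tau : R.
Implicit Types (m : {finite_measure set RT -> \bar R}) (g z : R -> R).

(** Extended-valued, hence defined and measurable for every t, although for an L^2 function
    finiteness is known only for almost every t. *)
Definition delay_mean m g (t : R) : \bar R :=
  (\int[m]_(s in `[0%R, tau]) (g (t - s)%R)%:E)%E.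

Lemma delay_mean_ge0 m g t : (forall s, 0 <= g s) -> (0 <= delay_mean m g t)%E.
Proof. by move=> g0; apply: integral_ge0 => s _; rewrite lee_fin. Qed.

Lemma delay_meanE m g t :
  delay_mean m g t = (\int[m]_s ((\1_(`[0%R, tau]%classic) s) * g (t - s)%R)%:E)%E.
Proof.
rewrite /delay_mean integral_mkcond; apply: eq_integral => s _.
by rewrite patchE indicE; case: ifP; rewrite ?mul1r ?mul0r.
Qed.

Lemma measurable_delay_mean m g : measurable_fun setT g -> (forall s, 0 <= g s) ->
  measurable_fun [set: R] (delay_mean m g).
Proof.
move=> mg g0.
pose F (ts : R * RT) := (\1_(`[0%R, tau]%classic) ts.2 * g (ts.1 - ts.2))%:E.
rewrite (_ : delay_mean m g = fun t => (\int[m]_s F (t, s))%E); last first.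
  by apply/funext => t; rewrite delay_meanE.
apply: (@measurable_fun_fubini_tonelli_F _ _ _ _ R m F); last first.
  by move=> x; rewrite lee_fin mulr_ge0.
apply/measurable_EFinP; apply: measurable_funM.
  have mi : measurable_fun [set: RT] (\1_(`[0%R, tau]%classic) : RT -> R).
    exact: measurable_indic.
  exact: (measurableT_comp mi measurable_snd).
by apply: (measurableT_comp mg); apply: measurable_funB.
Qed.

(* The weight is split as exp (- beta t) = exp (- beta s) exp (- beta (t - s)). *)
Lemma weighted_delay_le m g z (beta K G Z t0 : R) :
  measurable_fun setT g -> measurable_fun setT z ->
  (forall s, 0 <= g s) -> (forall s, 0 <= z s) -> 0 <= G -> 0 <= Z ->
  (\int[m]_(s in `[0%R, tau]) (expR (- (beta * s)))%:E <= K%:E)%E ->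
  (\int[mu]_(t in `]-oo, t0]) ((expR (- (beta * t)) * g t) ^+ 2)%:E <= (G ^+ 2)%:E)%E ->
  (\int[mu]_(t in `]0%R, t0]) ((expR (- (beta * t)) * z t) ^+ 2)%:E <= (Z ^+ 2)%:E)%E ->
  (\int[mu]_(t in `]0%R, t0])
    (delay_mean m g t * (expR (- (beta * t)) ^+ 2 * z t)%:E) <= (K * (G * Z))%:E)%E.
Proof.
move=> mg mz g0 z0 G0 Z0 hK hG hZ.
pose e t : R := expR (- (beta * t)).
have me : measurable_fun [set: R] e by exact: measurable_expRN.
have mi (A : set R) : measurable (A : set RT) -> measurable_fun [set: R] (\1_A : R -> R).
  by move=> mA; exact: (@measurable_indic _ RT).
pose p s : R := \1_(`[0, tau]%classic) s * e s.
(* Causality: for s >= 0 and t <= t0 the argument t - s stays below t0, so this cut changes nothing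
   and the bound involves only the past of t0. *)
pose h t : R := \1_(`]-oo, t0]%classic) t * (e t * g t).
pose y t : R := \1_(`]0, t0]%classic) t * (e t * z t).
have mp : measurable_fun [set: R] p by apply: measurable_funM => //; exact: mi.
have mh : measurable_fun [set: R] h.
  by apply: measurable_funM; [exact: mi|exact: measurable_funM].
have my : measurable_fun [set: R] y.
  by apply: measurable_funM; [exact: mi|exact: measurable_funM].
have sqr_indic (A : set RT) (f : R -> R) : (\int[mu]_t ((\1_A t * f t) ^+ 2)%:E =
    \int[mu]_(t in A) (f t ^+ 2)%:E)%E.
  rewrite [RHS]integral_mkcond; apply: eq_integral => t _.
  by rewrite patchE indicE; case: ifP; rewrite ?mul1r// mul0r expr0n.
have hp : (\int[m]_s (p s)%:E <= K%:E)%E.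
  apply: le_trans hK; rewrite [leRHS]integral_mkcond le_eqVlt.
  apply/orP; left; apply/eqP; apply: eq_integral => s _.
  by rewrite patchE /p indicE; case: ifP; rewrite ?mul1r// mul0r.
have hh : (\int[mu]_t (h t ^+ 2)%:E <= (G ^+ 2)%:E)%E by rewrite sqr_indic.
have hy : (\int[mu]_t (y t ^+ 2)%:E <= (Z ^+ 2)%:E)%E by rewrite sqr_indic.
have p0 s : 0 <= p s by rewrite mulr_ge0 ?expR_ge0.
have h0 s : 0 <= h s by rewrite !mulr_ge0 ?expR_ge0.
have y0 s : 0 <= y s by rewrite !mulr_ge0 ?expR_ge0.
apply: le_trans (delay_bilinear_le mp mh my p0 h0 y0 G0 Z0 hp hh hy).
rewrite integral_mkcond le_eqVlt; apply/orP; left; apply/eqP; apply: eq_integral => t _.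
rewrite patchE; case: ifPn => tI; last by rewrite /y indicE (negbTE tI) mul0r mule0.
have tt0 : t <= t0 by move: tI; rewrite inE/= in_itv/= => /andP[].
rewrite /y indicE tI mul1r delay_meanE.
have -> : (\int[m]_s (p s * h (t - s)%R)%:E =
    (e t)%:E * \int[m]_s (\1_(`[0%R, tau]%classic) s * g (t - s)%R)%:E)%E.
  rewrite -ge0_integralZl_EFin ?expR_ge0//; first last.
  - apply/measurable_EFinP; apply: measurable_funM; first exact: mi.
    by apply: (measurableT_comp mg); exact: measurable_funB.
  - by move=> s _; rewrite lee_fin mulr_ge0.
  apply: eq_integral => s _; rewrite -EFinM /p /h !indicE; congr EFin.
  have [|_] := boolP (s \in _); last by rewrite !mul0r mulr0.
  rewrite inE/= in_itv/= => /andP[s0 _].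
  rewrite mem_set/= ?in_itv/= ?(le_trans _ tt0) ?gerBl// !mul1r mulrA; congr (_ * _).
  by rewrite -expRD; congr expR; ring.
rewrite [RHS]muleAC [RHS]muleC; congr (_ * _)%E.
by rewrite -EFinM expr2 -mulrA.
Qed.

End delay_mean.

(** Made for an energy density [f] without sign and a bound [h] that may be infinite: passing to the
    positive part of [f] allows comparison in the extended reals. *)
Lemma le_Rintegral_bound d (T : measurableType d) (R : realType)
    (mu : {measure set T -> \bar R}) (D : set T) (f : T -> R) (h : T -> \bar R) (B : R) :
  measurable D -> mu.-integrable D (EFin \o f) -> measurable_fun D h ->
  (forall t, D t -> (0 <= h t)%E) ->
  {ae mu, forall t, D t -> ((f t)%:E <= h t)%E} ->
  (\int[mu]_(t in D) h t <= B%:E)%E -> \int[mu]_(t in D) f t <= B.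
Proof.
move=> mD intf mh h0 fh hB.
rewrite -lee_fin fineK; last exact: integrable_fin_num.
have /measurable_EFinP mf : measurable_fun D (EFin \o f) by case/integrableP : intf.
have mf0 : measurable_fun D (fun t => (Num.max (f t) 0)%:E).
  by apply/measurable_EFinP; exact: measurable_funrpos.
apply: (@le_trans _ _ (\int[mu]_(t in D) (Num.max (f t) 0)%:E)%E).
  apply: le_integral => //.
    apply: (le_integrable _ _ _ intf) => // t _ /=; rewrite lee_fin.
    by rewrite ger0_norm ?le_max ?lexx ?orbT// ge_max ler_norm normr_ge0.
  by move=> t _; rewrite /= lee_fin le_max lexx.
apply: le_trans hB; apply: ae_ge0_le_integral => //.
- by move=> t _; rewrite lee_fin le_max lexx orbT.
- apply: ae_imply fh => t + Dt => /(_ Dt) fht.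
  by rewrite EFin_max ge_max fht h0.
Qed.

(** * Scalar form of the energy and derivative estimates *)

Section delay_energy.
Context (R : realType).
Local Notation RT := (measurableTypeR R).
Local Notation mu := (@lebesgue_measure R).
(** In the application [m] and [md] are the variations of nu1 and nu1 - nu2; [x] and [y] are the
    norms of the difference w and of its derivative, extended by zero; [xd] is the norm of the
    difference of the joined trajectories, [gm] that of the second joined trajectory, and [g] is 2
    <w', w>. [xd] and [x] may differ at t = 0, where a joined trajectory takes the value of the
    solution. *)
Variables (T tau beta alpha L0 L1 K M Y : R).
Variables (m md : {finite_measure set RT -> \bar R}) (x xd y gm g : R -> R).
Hypotheses (T0 : 0 < T) (beta0 : 0 <= beta) (L00 : 0 <= L0) (L10 : 0 <= L1) (M0 : 0 <= M)
  (K0 : 0 <= K) (Y0 : 0 <= Y).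
Hypothesis mK : (\int[m]_(s in `[0%R, tau]) (expR (- (beta * s)))%:E <= K%:E)%E.
Hypothesis mdM : (md `[0%R, tau]%classic <= M%:E)%E.
Hypotheses (mx : measurable_fun [set: R] x) (mxd : measurable_fun [set: R] xd)
  (my : measurable_fun [set: R] y) (mgm : measurable_fun [set: R] gm).
Hypotheses (x0 : forall t, 0 <= x t) (xd0 : forall t, 0 <= xd t)
  (y0 : forall t, 0 <= y t) (gm0 : forall t, 0 <= gm t).
Hypotheses (x_fin : (\int[mu]_t (x t ^+ 2)%:E < +oo)%E)
  (y_fin : (\int[mu]_t (y t ^+ 2)%:E < +oo)%E)
  (gm_le : (\int[mu]_t (gm t ^+ 2)%:E <= (Y ^+ 2)%:E)%E).
Hypothesis xdx : {ae mu, forall t, xd t = x t}.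
Hypothesis x_neg : forall t, t <= 0 -> x t = 0.

Let e (t : R) := expR (- (beta * t)).
Let N t := (delay_mean tau m xd t + delay_mean tau md gm t)%E.

Definition weighted_norm (z : R -> R) (t : R) : R :=
  Num.sqrt (fine (\int[mu]_(r in `]0%R, t]) ((expR (- (beta * r)) * z r) ^+ 2)%:E)%E).

Let me : measurable_fun [set: R] e.
Proof. exact: measurable_expRN. Qed.

Let e_le1 t : 0 <= t -> e t <= 1.
Proof. by move=> t0; rewrite -[leRHS]expR0 ler_expR oppr_le0 mulr_ge0. Qed.

Let mez2 (z : R -> R) (A : set RT) : measurable_fun [set: R] z ->
  measurable_fun A (fun t => ((e t * z t) ^+ 2)%:E).
Proof.
move=> mz; apply/measurable_EFinP; apply: measurable_funTS.
by apply: measurable_funX; exact: measurable_funM.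
Qed.

Lemma weighted_normP (z : R -> R) t : measurable_fun [set: R] z ->
  (\int[mu]_t (z t ^+ 2)%:E < +oo)%E ->
  (\int[mu]_(r in `]0%R, t]) ((expR (- (beta * r)) * z r) ^+ 2)%:E = (weighted_norm z t ^+ 2)%:E)%E.
Proof.
move=> mz fz.
have p0 : (0 <= \int[mu]_(r in `]0%R, t]) ((e r * z r) ^+ 2)%:E)%E.
  by apply: integral_ge0 => r _; rewrite lee_fin sqr_ge0.
rewrite sqr_sqrtr ?fine_ge0// fineK// ge0_fin_numE//; apply: le_lt_trans fz.
apply: (@le_trans _ _ (\int[mu]_(r in `]0%R, t]) (z r ^+ 2)%:E)%E).
  apply: ge0_le_integral => //=.
  - by move=> r _; rewrite lee_fin sqr_ge0.
  - exact: mez2.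
  - by apply/measurable_EFinP; apply: measurable_funTS; exact: measurable_funX.
  - move=> r; rewrite in_itv/= => /andP[r0 _]; rewrite lee_fin exprMn ler_piMl ?sqr_ge0//.
    by rewrite expr_le1 ?expR_ge0// e_le1// ltW.
apply: ge0_subset_integral => //=.
by apply/measurable_EFinP; exact: measurable_funX.
by move=> r _; rewrite lee_fin sqr_ge0.
Qed.

Let N0 t : (0 <= N t)%E.
Proof. by apply: adde_ge0; exact: delay_mean_ge0. Qed.

Let mN : measurable_fun [set: R] N.
Proof. by apply: emeasurable_funD; exact: measurable_delay_mean. Qed.

Let mNz (z : R -> R) (A : set RT) : measurable_fun [set: R] z ->
  measurable_fun A (fun t => N t * (e t ^+ 2 * z t)%:E)%E.
Proof.
move=> mz; apply: measurable_funTS; apply: emeasurable_funM => //.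
apply/measurable_EFinP; apply: measurable_funM => //; exact: measurable_funX.
Qed.

Lemma delay_sum_le (z : R -> R) t : measurable_fun [set: R] z -> (forall r, 0 <= z r) ->
  (\int[mu]_t (z t ^+ 2)%:E < +oo)%E ->
  (\int[mu]_(r in `]0%R, t]) ((delay_mean tau m xd r + delay_mean tau md gm r) *
     (expR (- (beta * r)) ^+ 2 * z r)%:E) <=
   (K * (weighted_norm x t * weighted_norm z t) + M * (Y * weighted_norm z t))%:E)%E.
Proof.
move=> mz z0 fz.
have mN1 (m' : {finite_measure set RT -> \bar R}) (f : R -> R) : measurable_fun [set: R] f ->
    (forall t, 0 <= f t) -> measurable_fun `]0, t]%classic
      (fun r => delay_mean tau m' f r * (e r ^+ 2 * z r)%:E)%E.
  move=> mf f0; apply: measurable_funTS; apply: emeasurable_funM.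
    exact: measurable_delay_mean.
  by apply/measurable_EFinP; apply: measurable_funM => //; exact: measurable_funX.
under eq_integral => r _.
  rewrite ge0_muleDl; [over|exact: delay_mean_ge0..].
have Ez0 r : (0 <= (e r ^+ 2 * z r)%:E)%E by rewrite lee_fin mulr_ge0 ?sqr_ge0.
rewrite ge0_integralD//=; first last.
- exact: mN1.
- by move=> r _; apply: mule_ge0; [exact: delay_mean_ge0|exact: Ez0].
- exact: mN1.
- by move=> r _; apply: mule_ge0; [exact: delay_mean_ge0|exact: Ez0].
rewrite EFinD; apply: leeD.
  apply: weighted_delay_le => //; rewrite ?sqrtr_ge0//; last by rewrite weighted_normP.
  (* The common history cancels: the weighted norm over ]-oo, t] reduces to the one over ]0, t]. *)
  rewrite -(weighted_normP t mx x_fin) integral_mkcond [leRHS]integral_mkcond.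
  rewrite le_eqVlt; apply/orP; left; apply/eqP; apply: ae_eq_integral => //.
  - by apply/(measurable_restrictT _ _).1 => //; exact: mez2.
  - by apply/(measurable_restrictT _ _).1 => //; exact: mez2.
  apply: ae_imply xdx => r xr _; rewrite !patchE !mem_setE xr.
  rewrite !in_itv/=; have [r0|r0] := leP r 0; last by [].
  by case: ifP => // _; rewrite x_neg// mulr0 expr0n.
(* The source term is estimated with exponent 0: the whole weight goes to the test function, and its
   square is at most the weight since r > 0. Weighting [gm] instead would enlarge it at negative
   times. Hence the unweighted norm and the full mass M. *)
have h0 (r : R) : expR (- (0 * r)) = 1 by rewrite mul0r oppr0 expR0.
apply: (@le_trans _ _ (\int[mu]_(r in `]0%R, t]) (delay_mean tau md gm r *
    (expR (- (0 * r)) ^+ 2 * (e r ^+ 2 * z r))%:E))%E).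
  rewrite le_eqVlt; apply/orP; left; apply/eqP; apply: eq_integral => r _.
  by rewrite h0 expr1n mul1r.
apply: weighted_delay_le => //.
- by apply: measurable_funM => //; exact: measurable_funX.
- exact: sqrtr_ge0.
- under eq_integral do rewrite h0.
  by rewrite integral_cst//= mul1e.
- under eq_integral do rewrite h0 mul1r.
  apply: le_trans gm_le; apply: ge0_subset_integral => //=.
  by apply/measurable_EFinP; exact: measurable_funX.
  by move=> r _; rewrite lee_fin sqr_ge0.
- rewrite -weighted_normP//; apply: ge0_le_integral => //=.
  + by move=> r _; rewrite lee_fin sqr_ge0.
  + apply/measurable_EFinP; apply: measurable_funTS; apply: measurable_funX.
    apply: measurable_funM.
      rewrite (_ : (fun _ => _) = cst 1); [exact: measurable_cst|exact/funext].
    by apply: measurable_funM => //; exact: measurable_funX.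
  + exact: mez2.
  + move=> r; rewrite in_itv/= => /andP[r0 _]; rewrite h0 mul1r lee_fin.
    rewrite lerXn2r ?nnegrE ?mulr_ge0 ?sqr_ge0 ?expR_ge0// ler_wpM2r//.
    by rewrite expr2 ler_piMr ?expR_ge0// e_le1// ltW.
Qed.

Hypothesis intg : mu.-integrable `]0, T] (EFin \o g).
Hypothesis g0 : forall t : R, 0 < t -> t <= T -> 0 <= \int[mu]_(r in `]0, t]) g r.
Hypothesis g_le : {ae mu, forall t, ((g t + 2 * alpha * x t ^+ 2)%:E <=
  (2 * L1)%:E * ((delay_mean tau m xd t + delay_mean tau md gm t) * (x t)%:E))%E}.
Hypothesis y_le : {ae mu, forall t, ((y t)%:E <=
  (L0 * x t)%:E + L1%:E * (delay_mean tau m xd t + delay_mean tau md gm t))%E}.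

(** The pointwise energy inequality is multiplied by e^(-2 beta t) and integrated. The delay term
    contributes 2 L1 K X^2, which moves to the left and reduces the coercivity constant. *)
Theorem delay_energy_le t : 0 < t -> t <= T ->
  expR (- (2 * beta * t)) * (\int[mu]_(r in `]0, t]) g r) +
    2 * (alpha - L1 * K) * weighted_norm x t ^+ 2 <=
  2 * (L1 * M * Y) * weighted_norm x t.
Proof.
move=> t0 tT; set X := weighted_norm x t.
have b2 : 0 <= 2 * beta by rewrite mulr_ge0.
have e2 r : expR (- (2 * beta * r)) = e r ^+ 2.
  by rewrite /e expr2 -expRD; congr expR; ring.
have ig : mu.-integrable `]0, t] (EFin \o g).
  apply: (integrableS _ _ _ intg) => // r /=; rewrite !in_itv/= => /andP[-> rt].
  exact: le_trans tT.
have ieg : mu.-integrable `]0, t] (fun r => (expR (- (2 * beta * r)) * g r)%:E).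
  apply: (le_integrable _ _ _ ig) => //.
    apply/measurable_EFinP; apply: measurable_funM.
      rewrite (_ : (fun _ => _) = (fun r => e r ^+ 2)); last exact/funext.
      by apply: measurable_funTS; exact: measurable_funX.
    by case/integrableP : ig => /measurable_EFinP.
  move=> r /=; rewrite in_itv/= => /andP[r0 _]; rewrite lee_fin normrM ler_piMl//.
  by rewrite e2 ger0_norm ?sqr_ge0// expr_le1 ?expR_ge0// e_le1// ltW.
have ix : mu.-integrable `]0, t] (fun r => ((e r * x r) ^+ 2)%:E).
  apply/integrableP; split; first exact: mez2.
  under eq_integral do rewrite /= ger0_norm ?sqr_ge0//.
  by rewrite weighted_normP// ltry.
have EX : \int[mu]_(r in `]0, t]) ((e r * x r) ^+ 2) = X ^+ 2.
  by rewrite /Rintegral weighted_normP.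
have iax : mu.-integrable `]0, t] (fun r => (2 * alpha * (e r * x r) ^+ 2)%:E).
  rewrite (_ : (fun _ => _) = (fun r => (2 * alpha)%:E * ((e r * x r) ^+ 2)%:E)%E)//.
  exact: integrableZl.
have hB : \int[mu]_(r in `]0, t])
    (expR (- (2 * beta * r)) * g r + 2 * alpha * (e r * x r) ^+ 2) <=
    2 * L1 * (K * (X * X) + M * (Y * X)).
  apply: (@le_Rintegral_bound _ _ _ mu _
     (fun r => expR (- (2 * beta * r)) * g r + 2 * alpha * (e r * x r) ^+ 2)
     (fun r => (2 * L1)%:E * (N r * (e r ^+ 2 * x r)%:E))%E) => //.
  - have mI : measurable (`]0, t]%classic : set RT) by exact: measurable_itv.
    exact: (integrableD mI ieg iax).
  - by apply: measurable_funeM; exact: mNz.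
  - move=> r _; rewrite mule_ge0//; first by rewrite lee_fin mulr_ge0.
    by rewrite mule_ge0// lee_fin mulr_ge0// sqr_ge0.
  - apply: ae_imply g_le => r gr _; rewrite e2.
    have -> : e r ^+ 2 * g r + 2 * alpha * (e r * x r) ^+ 2 =
      e r ^+ 2 * (g r + 2 * alpha * x r ^+ 2) by ring.
    have -> : ((2 * L1)%:E * (N r * (e r ^+ 2 * x r)%:E) =
      (e r ^+ 2)%:E * ((2 * L1)%:E * (N r * (x r)%:E)))%E.
      by rewrite [(e r ^+ 2 * x r)%:E]EFinM (muleCA (N r)) [LHS]muleCA.
    by rewrite EFinM; apply: lee_wpmul2l => //; rewrite lee_fin sqr_ge0.
  rewrite ge0_integralZl//=; first last.
  - by rewrite lee_fin mulr_ge0.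
  - by move=> r _; rewrite mule_ge0// lee_fin mulr_ge0// sqr_ge0.
  - exact: mNz.
  rewrite [leRHS]EFinM; apply: lee_wpmul2l; first by rewrite lee_fin mulr_ge0.
  exact: delay_sum_le.
have W := weighted_primitive_le intg b2 g0 (ltW t0) tT.
move: hB; rewrite RintegralD// RintegralZl// EX.
move: W; set a := expR _ * _; set b := Rintegral _ _ _ => W hB.
rewrite -subr_ge0; set rhs := (X in 0 <= X).
have -> : rhs = (2 * L1 * (K * (X * X) + M * (Y * X)) - (b + 2 * alpha * X ^+ 2)) + (b - a).
  by rewrite /rhs; ring.
by rewrite addr_ge0 ?subr_ge0.
Qed.

(** Testing the pointwise bound with the weighted [y] itself reuses the bilinear delay estimate, in
    place of an L^2 bound for the convolution; one factor of the norm of [y] is then cancelled, the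
    case of norm 0 being separate. *)
Theorem delay_derivative_le :
  weighted_norm y T <= (L0 + L1 * K) * weighted_norm x T + L1 * M * Y.
Proof.
set Z := weighted_norm y T; set X := weighted_norm x T.
have Z0 : 0 <= Z := sqrtr_ge0 _; have X0 : 0 <= X := sqrtr_ge0 _.
have mxy : measurable_fun [set: R] (fun r => L0 * ((e r * x r) * (e r * y r))).
  apply: measurable_funM => //; apply: measurable_funM; exact: measurable_funM.
suff : Z ^+ 2 <= ((L0 + L1 * K) * X + L1 * M * Y) * Z.
  move: Z0; rewrite le_eqVlt => /predU1P[<- _|Z0].
    by rewrite addr_ge0// mulr_ge0 ?addr_ge0 ?mulr_ge0.
  by rewrite expr2 ler_pM2r.
rewrite -lee_fin -weighted_normP//.
apply: (@le_trans _ _ (\int[mu]_(r in `]0%R, T]) ((L0 * ((e r * x r) * (e r * y r)))%:E +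
    L1%:E * (N r * (e r ^+ 2 * y r)%:E)))%E).
  apply: ae_ge0_le_integral => //.
  - by move=> r _; rewrite lee_fin sqr_ge0.
  - exact: mez2.
  - move=> r _; rewrite adde_ge0//; first by rewrite lee_fin !mulr_ge0 ?expR_ge0.
    by rewrite mule_ge0// ?lee_fin// mule_ge0// lee_fin mulr_ge0// sqr_ge0.
  - apply: emeasurable_funD; first by apply/measurable_EFinP; exact: measurable_funTS.
    by apply: measurable_funeM; exact: mNz.
  - apply: ae_imply y_le => r yr _.
    have -> : ((e r * y r) ^+ 2)%:E = ((e r ^+ 2 * y r)%:E * (y r)%:E)%E.
      by rewrite -EFinM; congr EFin; ring.
    apply: le_trans (lee_wpmul2l _ yr) _.
      by rewrite lee_fin mulr_ge0 ?sqr_ge0.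
    rewrite ge0_muleDr; [|by rewrite lee_fin mulr_ge0|by rewrite mule_ge0 ?lee_fin ?N0].
    apply: leeD.
      by rewrite -EFinM lee_fin le_eqVlt; apply/orP; left; apply/eqP; ring.
    by rewrite muleCA [(_ * (_ + _))%E]muleC.
rewrite ge0_integralD//=; first last.
- by apply: measurable_funeM; exact: mNz.
- by move=> r _; rewrite mule_ge0// ?lee_fin// mule_ge0// lee_fin mulr_ge0// sqr_ge0.
- by apply/measurable_EFinP; exact: measurable_funTS.
- by move=> r _; rewrite lee_fin !mulr_ge0 ?expR_ge0.
have -> : ((L0 + L1 * K) * X + L1 * M * Y) * Z =
  L0 * (X * Z) + L1 * (K * (X * Z) + M * (Y * Z)) by ring.
rewrite EFinD; apply: leeD.
  under eq_integral do rewrite EFinM.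
  rewrite ge0_integralZl//=; first last.
  - by move=> r _; rewrite lee_fin !mulr_ge0 ?expR_ge0.
  - apply/measurable_EFinP; apply: measurable_funTS.
    by apply: measurable_funM; exact: measurable_funM.
  rewrite [leRHS]EFinM; apply: lee_wpmul2l; first by rewrite lee_fin.
  apply: cauchy_schwarz_le => //.
  - by apply: measurable_funTS; exact: measurable_funM.
  - by apply: measurable_funTS; exact: measurable_funM.
  - by move=> r _; rewrite mulr_ge0 ?expR_ge0.
  - by move=> r _; rewrite mulr_ge0 ?expR_ge0.
  - by rewrite weighted_normP.
  - by rewrite weighted_normP.
rewrite ge0_integralZl//=; first last.
- by move=> r _; rewrite mule_ge0// lee_fin mulr_ge0// sqr_ge0.
- exact: mNz.
rewrite [leRHS]EFinM; apply: lee_wpmul2l; first by rewrite lee_fin.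
exact: delay_sum_le.
Qed.

End delay_energy.

(** * Joined trajectories and the delay operator *)

Section joined_trajectory.
Context (R : realType) (V : hilbertType R).
Local Notation RT := (measurableTypeR R).
Local Notation mu := (@lebesgue_measure R).
Variables (T tau : R) (T0 : 0 < T) (tau0 : 0 < tau).
Implicit Types psi u : R -> V.

Lemma L2_joined psi u : L2 (- tau) 0 psi -> L2 0 T u -> L2 (- tau) T (joined psi u).
Proof.
move=> [spsi ipsi] [su iu].
have mI (i : interval R) : measurable ([set` i] : set RT) by exact: measurable_itv.
have sj : strongly_measurable (`]- tau, T[%classic : set RT) (joined psi u).
  (* The point t = 0 lies in neither open interval where strong measurability is given, hence the
     constant branch [u 0]. *)
  pose f (t : RT) : V := if t \in (`]- tau, 0[%classic : set RT) then psi t else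
    if t \in (`]0, T[%classic : set RT) then u t else u 0.
  apply: (@eq_strongly_measurable _ RT R V _ f).
    move=> t; rewrite inE/= in_itv/= => /andP[t1 t2].
    rewrite /f /joined !mem_setE !in_itv/= t1 t2 andbT.
    by have [//|t0|->] := ltgtP t 0; rewrite ?ltxx.
  apply: strongly_measurable_ifset => //.
    by apply: strongly_measurableS spsi => t [].
  apply: strongly_measurable_ifset => //.
    by apply: strongly_measurableS su => t [].
  exact: strongly_measurable_cst.
split => //.
have mj : measurable_fun (`]- tau, T[%classic : set RT) (fun t => (`|joined psi u t| ^+ 2)%:E).
  apply/measurable_EFinP; apply: measurable_funX.
  exact: strongly_measurable_norm.
have jE : `]- tau, T[%classic = `]- tau, 0[ `|` `[0, T[ :> set RT.
  apply/seteqP; split=> t /=; rewrite !in_itv/=.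
    by move=> /andP[t1 t2]; have [t0|t0] := ltP t 0; [left|right]; rewrite ?t1 ?t2.
  by case=> /andP[t1 t2]; rewrite ?t1 ?t2 ?andbT/= ?(lt_trans t2) ?(lt_le_trans _ t1) ?oppr_lt0.
have dj : [disjoint `]- tau, 0[%classic & (`[0, T[%classic : set RT)].
  by apply: lt_disjoint => x y; rewrite !in_itv/= => /andP[_ x0] /andP[y0 _]; exact: lt_le_trans y0.
rewrite jE ge0_integral_setU//=; last by rewrite -jE.
rewrite lte_add_pinfty//.
  rewrite (eq_integral (fun t : RT => (`|psi t| ^+ 2)%:E))// => t; rewrite inE/= in_itv/=.
  by rewrite /joined => /andP[_ ->].
rewrite -integral_itv_obnd_cbnd; last first.
  apply: measurable_funS mj => //; rewrite -?jE//.
  by move=> t /=; rewrite !in_itv/= => /andP[t1 ->]; rewrite (lt_trans _ t1)// oppr_lt0.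
rewrite (eq_integral (fun t : RT => (`|u t| ^+ 2)%:E))// => t; rewrite inE/= in_itv/=.
by rewrite /joined => /andP[t0 _]; rewrite ltNge ltW.
Qed.

End joined_trajectory.

Section delay_scalarisation.
Context (R : realType) (V : hilbertType R).
Local Notation RT := (measurableTypeR R).
Local Notation mu := (@lebesgue_measure R).
Local Notation total_variation := Defs.total_variation.
Variables (tau L : R) (a : {bilinear V -> V -> R^o}) (A : V -> dual V).
Hypotheses (L0 : 0 <= L) (a_bounded : forall w v, `|a w v| <= L * `|w| * `|v|)
  (AE : forall w v, A w v = a w v).
Implicit Types (nu : {charge set RT -> \bar R}) (G : RT -> V).

Lemma operatorB x y : A x - A y = A (x - y).
Proof. by apply: dual_ext => v; rewrite AE linearBl -!AE. Qed.

Lemma operator_le x : `|A x| <= L * `|x|.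
Proof.
by apply: dual_norm_le_mul => [|v]; rewrite ?mulr_ge0// AE.
Qed.

Lemma operator_continuous : continuous A.
Proof.
by apply: (lipschitz_continuous L0) => x y; rewrite operatorB operator_le.
Qed.

Lemma le_integral_parts nu (D : set RT) (f : RT -> \bar R) : measurable D ->
  measurable_fun D f -> (forall t, D t -> (0 <= f t)%E) ->
  (\int[positive_part nu]_(t in D) f t <= \int[total_variation nu]_(t in D) f t)%E /\
  (\int[negative_part nu]_(t in D) f t <= \int[total_variation nu]_(t in D) f t)%E.
Proof.
move=> mD mf f0; rewrite total_variation_integral//.
by split; [rewrite leeDl|rewrite leeDr]; rewrite ?integral_ge0.
Qed.

Section one_charge.
Variables (nu : {charge set RT -> \bar R}) (G : RT -> V) (t : R).
Hypothesis sG : strongly_measurable setT G.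
Hypothesis G_fin : (delay_mean tau (tv_measure nu) (fun s => `|G s|%R) t < +oo)%E.

Let sGt : strongly_measurable setT (fun s : RT => G (t - s)).
Proof.
apply: (@strongly_measurable_precomp _ _ RT RT R V (fun s => t - s) setT G) => //.
exact: measurable_funB.
Qed.

Let mI : measurable (`[0, tau]%classic : set RT).
Proof. exact: measurable_itv. Qed.

Lemma integrable_delay v :
  (total_variation nu).-integrable `[0, tau] (fun s => (a (G (t - s)) v)%:E).
Proof.
have mn : measurable_fun (`[0, tau]%classic : set RT) (fun s : RT => `|G (t - s)|).
  by apply: strongly_measurable_norm => //; exact: strongly_measurableS sGt.
have ma : measurable_fun (`[0, tau]%classic : set RT) (fun s : RT => a (G (t - s)) v).
  rewrite (_ : (fun _ => _) = (fun s => A (G (t - s)) v)); last first.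
    by apply/funext => s; rewrite AE.
  apply: (@strongly_measurable_measurable _ RT) => //.
  apply: (@strongly_measurable_comp _ RT R V R^o (fun x => A x v) _ (fun s => G (t - s))).
    move=> x; apply: (@continuous_comp _ _ _ A (fun f : dual V => f v : R^o)).
      exact: operator_continuous.
    exact: dual_app_continuous.
  exact: strongly_measurableS sGt.
apply/integrableP; split; first exact/measurable_EFinP.
apply: (@le_lt_trans _ _ ((L * `|v|)%:E *
    \int[total_variation nu]_(s in `[0%R, tau]) (`|G (t - s)%R|)%:E)%E).
  rewrite -ge0_integralZl//=; last 2 first.
  - exact/measurable_EFinP.
  - by rewrite lee_fin mulr_ge0.
  apply: ge0_le_integral => //=.
  - by apply/measurable_EFinP; exact: measurableT_comp.
  - by apply/measurable_EFinP; apply: measurable_funM.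
  - by move=> s _; rewrite lee_fin mulrAC.
by rewrite lte_mul_pinfty// lee_fin mulr_ge0.
Qed.

(** [G] is the zero extension of the trajectory [g]; the two need to agree only at the delayed times
    t - s. [G_fin] provides the integrability at this particular t, for both Jordan parts at
    once. *)
Lemma delay_app (g : R -> V) v : (forall s, s \in `[0, tau] -> g (t - s) = G (t - s)) ->
  delay tau A nu g t v = charge_integral nu `[0, tau] (fun s => a (G (t - s)) v).
Proof.
move=> gG.
have sAg : strongly_measurable (`[0, tau]%classic : set RT) (fun s : RT => A (g (t - s))).
  apply: (@eq_strongly_measurable _ RT R _ _ (fun s : RT => A (G (t - s)))).
    by move=> s; rewrite inE/= => /gG ->.
  apply: (@strongly_measurable_comp _ RT R _ _ A _ (fun s => G (t - s))).
    exact: operator_continuous.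
  exact: strongly_measurableS sGt.
have mn := strongly_measurable_norm mI sAg.
have fin : (\int[total_variation nu]_(s in `[0%R, tau]) (`|A (g (t - s)%R)|)%:E < +oo)%E.
  apply: (@le_lt_trans _ _ (L%:E *
    \int[total_variation nu]_(s in `[0%R, tau]) (`|G (t - s)%R|)%:E)%E).
    rewrite -ge0_integralZl//=; last first.
      apply/measurable_EFinP; apply: strongly_measurable_norm => //.
      exact: strongly_measurableS sGt.
    apply: ge0_le_integral => //=.
    - exact/measurable_EFinP.
    - apply/measurable_EFinP; apply: measurable_funM => //.
      by apply: strongly_measurable_norm => //; exact: strongly_measurableS sGt.
    - by move=> s /gG ->; rewrite lee_fin operator_le.
  by rewrite lte_mul_pinfty.
have [pos neg] := le_integral_parts nu mI (iffRL (measurable_EFinP _ _) mn)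
  (fun s _ => normr_ge0 _ : (0 <= (`|A (g (t - s))|)%:E)%E).
have E (m : {measure set RT -> \bar R}) : \int[m]_(s in `[0, tau]) A (g (t - s)) v =
    \int[m]_(s in `[0, tau]) a (G (t - s)) v.
  by apply: eq_Rintegral => s; rewrite inE/= => /gG ->; rewrite AE.
rewrite /delay /charge_bochner /charge_integral -!E.
transitivity (bochner (positive_part nu) `[0, tau] (fun s => A (g (t - s))) v -
  bochner (negative_part nu) `[0, tau] (fun s => A (g (t - s))) v) => //.
rewrite !bochner_dualE//.
- by rewrite ltey_eq fin_num_measure.
- exact: le_lt_trans neg fin.
- by rewrite ltey_eq fin_num_measure.
- exact: le_lt_trans pos fin.
Qed.

Lemma charge_integral_delay_le v :
  ((`|charge_integral nu `[0%R, tau] (fun s => a (G (t - s)) v)|)%:E <=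
   (L * `|v|)%:E * delay_mean tau (tv_measure nu) (fun s => `|G s|%R) t)%E.
Proof.
have iG := integrable_delay v; apply: le_trans (le_charge_integral mI iG) _.
have mn : measurable_fun (`[0, tau]%classic : set RT) (fun s : RT => `|G (t - s)|).
  by apply: strongly_measurable_norm => //; exact: strongly_measurableS sGt.
have /measurable_EFinP ma : measurable_fun (`[0, tau]%classic : set RT)
    (EFin \o (fun s : RT => a (G (t - s)) v)) by case/integrableP : iG.
rewrite /delay_mean -ge0_integralZl//=; last 2 first.
- exact/measurable_EFinP.
- by rewrite lee_fin mulr_ge0.
apply: ge0_le_integral => //=.
- by apply/measurable_EFinP; exact: measurableT_comp.
- by apply/measurable_EFinP; exact: measurable_funM.
- by move=> s _; rewrite lee_fin mulrAC.
Qed.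

End one_charge.

(** The delay estimate with exponent 0 and the constant 1 as test function shows that the delay mean
    is integrable over ]0, T], hence finite almost everywhere. *)
Lemma ae_delay_mean_fin (m : {finite_measure set RT -> \bar R}) (g : R -> R) (T : R) :
  measurable_fun setT g -> (forall s, 0 <= g s) -> (\int[mu]_t (g t ^+ 2)%:E < +oo)%E ->
  {ae mu, forall t, t \in `]0, T[ -> (delay_mean tau m g t < +oo)%E}.
Proof.
move=> mg g0 gfin.
have h0 (r : R) : expR (- (0 * r)) = 1 by rewrite mul0r oppr0 expR0.
have mI : measurable (`]0, T]%classic : set RT) by exact: measurable_itv.
have TI : (mu (`]0%R, T]%classic : set RT) < +oo)%E.
  have := @lebesgue_measure_itv R `]0, T]; rewrite /= => ->.
  by case: ifP => // _; rewrite -EFinB ltry.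
have I0 : (0 <= \int[mu]_t (g t ^+ 2)%:E)%E.
  by apply: integral_ge0 => t _; rewrite lee_fin sqr_ge0.
have mc : measurable_fun [set: R] (cst (1 : R)) by exact: measurable_cst.
have B := @weighted_delay_le R tau m g (cst 1) 0 (fine (m `[0%R, tau]%classic))
  (Num.sqrt (fine (\int[mu]_t (g t ^+ 2)%:E)%E)) (Num.sqrt (fine (mu (`]0%R, T]%classic : set RT)))) T
  mg mc g0 (fun=> ler01) (sqrtr_ge0 _) (sqrtr_ge0 _).
have : mu.-integrable `]0, T] (delay_mean tau m g).
  apply/integrableP; split.
    by apply: measurable_funTS; exact: measurable_delay_mean.
  under eq_integral do rewrite gee0_abs ?delay_mean_ge0//.
  apply: (@le_lt_trans _ _ (\int[mu]_(t in `]0%R, T])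
      (delay_mean tau m g t * (expR (- (0 * t)) ^+ 2 * cst 1 t)%:E))%E).
    rewrite le_eqVlt; apply/orP; left; apply/eqP; apply: eq_integral => t _.
    by rewrite h0 expr1n mul1r mule1.
  apply: le_lt_trans (B _ _ _) (ltry _).
  - under eq_integral do rewrite h0.
    by rewrite integral_cst// mul1e fineK// fin_num_measure.
  - under eq_integral do rewrite h0 mul1r.
    rewrite sqr_sqrtr ?fine_ge0// fineK ?ge0_fin_numE//.
    apply: ge0_subset_integral => //=.
      by apply/measurable_EFinP; exact: measurable_funX.
    by move=> r _; rewrite lee_fin sqr_ge0.
  - under eq_integral do rewrite h0 mul1r expr1n.
    by rewrite integral_cst// mul1e sqr_sqrtr ?fine_ge0// fineK ?ge0_fin_numE.
move=> /(integrable_ae mI); apply: ae_imply => t tf tI.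
have : `]0, T]%classic t by exact: subset_itv_oo_oc.
by move=> /tf /fin_numPlt/andP[].
Qed.

(** The splitting K_nu1 g1 - K_nu2 g2 = K_nu1 (g1 - g2) + K_(nu1 - nu2) g2. The exceptional set
    collects only finiteness conditions on delay means, so it does not depend on v. *)
Lemma ae_delayB nu1 nu2 (G1 G2 : RT -> V) (g1 g2 : R -> V) (T : R) :
  strongly_measurable setT G1 -> strongly_measurable setT G2 ->
  (\int[mu]_t (`|G1 t| ^+ 2)%:E < +oo)%E -> (\int[mu]_t (`|G2 t| ^+ 2)%:E < +oo)%E ->
  (\int[mu]_t (`|G1 t - G2 t| ^+ 2)%:E < +oo)%E ->
  (forall t s, t \in `]0, T[ -> s \in `[0, tau] ->
    g1 (t - s) = G1 (t - s) /\ g2 (t - s) = G2 (t - s)) ->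
  {ae mu, forall t, t \in `]0, T[ -> forall v,
    ((`|(delay tau A nu1 g1 t - delay tau A nu2 g2 t) v|)%:E <= (L * `|v|)%:E *
     (delay_mean tau (tv_measure nu1) (fun s => `|G1 s - G2 s|%R) t +
      delay_mean tau (tv_measure (cadd nu1 (copp nu2))) (fun s => `|G2 s|%R) t))%E}.
Proof.
move=> s1 s2 f1 f2 fd gG; have sd := strongly_measurableB s1 s2.
have fin nu (G : RT -> V) : strongly_measurable setT G ->
    (\int[mu]_t (`|G t| ^+ 2)%:E < +oo)%E ->
    {ae mu, forall t, t \in `]0, T[ ->
      (delay_mean tau (tv_measure nu) (fun s => `|G s|%R) t < +oo)%E}.
  move=> sG fG; apply: ae_delay_mean_fin => //.
  exact: (@strongly_measurable_norm _ RT).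
have h1 := fin nu1 _ s1 f1; have h2 := fin nu1 _ s2 f2; have h3 := fin nu2 _ s2 f2.
have h4 := fin (cadd nu1 (copp nu2)) _ s2 f2; have h5 := fin nu1 _ sd fd.
apply: ae_imply (ae_conj (ae_conj h1 h2) (ae_conj h3 (ae_conj h4 h5))) => t.
move=> [[k1 k2] [k3 [k4 k5]]] tI v; move: {k1 k2 k3 k4 k5}(k1 tI) (k2 tI) (k3 tI) (k4 tI) (k5 tI).
move=> k1 k2 k3 k4 k5.
have d1 := delay_app s1 k1 v (fun s sI => (gG t s tI sI).1).
have d2 := delay_app s2 k3 v (fun s sI => (gG t s tI sI).2).
have -> : (delay tau A nu1 g1 t - delay tau A nu2 g2 t) v =
    charge_integral nu1 `[0, tau] (fun s => a (G1 (t - s)) v) -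
    charge_integral nu2 `[0, tau] (fun s => a (G2 (t - s)) v).
  exact: (f_equal2 (fun p q : R => p - q) d1 d2).
have -> : charge_integral nu1 `[0, tau] (fun s => a (G1 (t - s)) v) =
    charge_integral nu1 `[0, tau] (fun s => a ((G1 \- G2) (t - s)) v) +
    charge_integral nu1 `[0, tau] (fun s => a (G2 (t - s)) v).
  rewrite -charge_integralD//; first last.
  - exact: integrable_delay.
  - exact: integrable_delay.
  by congr charge_integral; apply/funext => s; rewrite /= -linearDl subrK.
rewrite -addrA charge_integral_cadd//; try exact: integrable_delay.
rewrite ge0_muleDr ?delay_mean_ge0//.
apply: le_trans (leeD (charge_integral_delay_le sd k5 v) (charge_integral_delay_le s2 k4 v)).
by rewrite -EFinD lee_fin ler_normD.
Qed.

End delay_scalarisation.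

(** * The weighted mass [kappa] and its stability *)

Section kappa.
Context (R : realType).
Local Notation RT := (measurableTypeR R).
Local Notation total_variation := Defs.total_variation.
Variables (tau : R).
Implicit Types (nu mu : {charge set RT -> \bar R}).

Let mI : measurable (`[0, tau]%classic : set RT).
Proof. exact: measurable_itv. Qed.

Let mexp (beta : R) (A : set RT) : measurable_fun A (fun s : RT => (expR (- beta * s))%:E).
Proof.
apply/measurable_EFinP; apply: measurable_funTS; apply: continuous_measurable_fun => t.
by apply: continuous_comp; [apply: cvgMr; exact: cvg_id|exact: continuous_expR].
Qed.

Lemma normME nu : (total_variation nu `[0%R, tau]%classic = (normM tau nu)%:E)%E.
Proof. by rewrite /normM fineK// total_variation_fin. Qed.

Lemma normM_ge0 nu : 0 <= normM tau nu.
Proof. by rewrite fine_ge0. Qed.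

Let expR_le1 (beta s : R) : 0 <= beta -> `[0, tau]%classic s -> expR (- beta * s) <= 1.
Proof.
move=> b0 /=; rewrite in_itv/= => /andP[s0 _].
by rewrite -expR0 ler_expR mulNr oppr_le0 mulr_ge0.
Qed.

Let integral_expR_le nu (beta : R) : 0 <= beta ->
  (\int[total_variation nu]_(s in `[0%R, tau]) (expR (- beta * s))%:E <= (normM tau nu)%:E)%E.
Proof.
move=> b0; apply: (@le_trans _ _ (\int[total_variation nu]_(s in `[0%R, tau]) 1)%E).
  apply: ge0_le_integral => //= s sI.
  by rewrite lee_fin expR_le1.
by rewrite integral_cst// mul1e normME.
Qed.

Lemma kappaE nu (beta : R) : 0 <= beta ->
  (\int[total_variation nu]_(s in `[0%R, tau]) (expR (- beta * s))%:E =
   (kappa tau nu beta)%:E)%E.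
Proof.
move=> b0; rewrite /kappa fineK// ge0_fin_numE.
  exact: le_lt_trans (integral_expR_le nu b0) (ltry _).
by apply: integral_ge0 => s _; rewrite lee_fin expR_ge0.
Qed.

Lemma kappa_ge0 nu (beta : R) : 0 <= kappa tau nu beta.
Proof. by apply: fine_ge0; apply: integral_ge0 => s _; rewrite lee_fin expR_ge0. Qed.

(** The variation of nu is at most that of mu plus that of nu - mu, and the exponential weight is at
    most 1 on [0, tau]. *)
Lemma kappa_le nu mu (beta : R) : 0 <= beta ->
  kappa tau nu beta <= kappa tau mu beta + normM tau (cadd nu (copp mu)).
Proof.
move=> b0; rewrite -lee_fin EFinD -!kappaE//.
apply: (@le_trans _ _ (\int[total_variation mu]_(s in `[0%R, tau]) (expR (- beta * s))%:E +
    \int[total_variation (cadd nu (copp mu))]_(s in `[0%R, tau]) (expR (- beta * s))%:E)%E).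
  rewrite -ge0_integral_measure_add//.
  apply: ge0_le_measure_integral => //= A mA.
  rewrite [leRHS](measure_addE (total_variation mu) (total_variation (cadd nu (copp mu)))).
  exact: total_variation_addB.
by rewrite leeD2l// integral_expR_le.
Qed.

Lemma normM_triangle nu1 nu2 mu :
  normM tau (cadd nu1 (copp nu2)) <=
  normM tau (cadd nu1 (copp mu)) + normM tau (cadd nu2 (copp mu)).
Proof. by rewrite -lee_fin EFinD -!normME total_variationB. Qed.

End kappa.

Section weighted_norms.
Context (R : realType).
Local Notation RT := (measurableTypeR R).
Local Notation mu := (@lebesgue_measure R).

Lemma L2norm_sqr (X : normedModType R) (a b : R) (f : R -> X) : L2 a b f ->
  (\int[mu]_(t in `]a, b[) (`|f t| ^+ 2)%:E = (L2norm a b f ^+ 2)%:E)%E.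
Proof.
move=> [_ fin]; have p0 : (0 <= \int[mu]_(t in `]a, b[) (`|f t| ^+ 2)%:E)%E.
  by apply: integral_ge0 => t _; rewrite lee_fin sqr_ge0.
by rewrite sqr_sqrtr ?fine_ge0// fineK// ge0_fin_numE.
Qed.

(** Source of the factor e^(beta T): on ]0, T[ the weight is at least e^(-beta T). *)
Lemma L2norm_le_weighted (X : normedModType R) (T beta : R) (f : R -> X) : 0 <= beta ->
  0 <= T -> L2 0 T f ->
  L2norm 0 T f <= expR (beta * T) * weighted_norm beta (fun t => `|zext `]0, T[ f t|) T.
Proof.
move=> b0 T0 L2f; have [sf fin] := L2f.
have mI : measurable (`]0, T[%classic : set RT) by exact: measurable_itv.
have mz : measurable_fun [set: R] (fun t => `|zext `]0, T[ f t|).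
  by apply: (@strongly_measurable_norm _ RT) => //; exact: strongly_measurable_zext.
have finz : (\int[mu]_t (`|zext `]0%R, T[ f t| ^+ 2)%:E < +oo)%E.
  by rewrite integral_zext_sqr.
rewrite -(@ler_pXn2r _ 2)// ?nnegrE ?mulr_ge0 ?expR_ge0 ?sqrtr_ge0//.
rewrite -lee_fin -L2norm_sqr// exprMn EFinM.
rewrite -(weighted_normP b0 _ mz finz) -ge0_integralZl//=; first last.
- apply/measurable_EFinP; apply: measurable_funTS; apply: measurable_funX.
  by apply: measurable_funM => //; exact: measurable_expRN.
rewrite -integral_zext_sqr [leRHS]integral_mkcond.
have mq : measurable_fun [set: R] (fun t => ((expR (beta * T) ^+ 2)%:E *
    ((expR (- (beta * t)) * `|zext `]0%R, T[ f t|) ^+ 2)%:E)%E).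
  apply/measurable_EFinP; apply: measurable_funM => //; apply: measurable_funX.
  by apply: measurable_funM => //; exact: measurable_expRN.
apply: ge0_le_integral => //=.
- by apply/measurable_EFinP; exact: measurable_funX.
- by apply/(measurable_restrictT _ _).1 => //; exact: measurable_funTS.
move=> t _; rewrite patchE; have [tI|tI] := boolP (t \in (`]0, T[%classic : set RT)); last first.
  rewrite /zext (negbTE tI) normr0 expr0n/=; case: ifP => // _.
  by rewrite mulr0 expr0n mule0.
have tI' : t \in `]0, T] by move: tI; rewrite inE/=; exact: subset_itv_oo_oc.
rewrite mem_set// -EFinM lee_fin -exprMn mulrA -expRD.
rewrite lerXn2r ?nnegrE ?mulr_ge0 ?expR_ge0// ler_peMl//.
rewrite -[leLHS]expR0 ler_expR -mulrBr mulr_ge0// subr_ge0.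
by move: tI'; rewrite in_itv/= => /andP[].
Qed.

End weighted_norms.

(** * Difference of two solutions *)

Lemma subr_equations (Z : zmodType) (w1 w2 x1 x2 d1 d2 f : Z) :
  w1 + x1 + d1 = f -> w2 + x2 + d2 = f -> w1 - w2 + (x1 - x2) = - (d1 - d2).
Proof.
move=> e1 e2; rewrite addrACA -opprD -[w1 + x1](addrK d1) e1 -[w2 + x2](addrK d2) e2.
by rewrite !opprB addrC addrA subrK.
Qed.

Section solution_difference.
Context (R : realType) (V H : hilbertType R) (i : dense_embedding V H).
Local Notation RT := (measurableTypeR R).
Local Notation mu := (@lebesgue_measure R).
Hypothesis sepV : separable V.
Variables (T tau : R) (a0 a1 : {bilinear V -> V -> R^o}) (Lambda0 Lambda1 alpha0 : R).
Hypotheses (T_gt0 : 0 < T) (tau_gt0 : 0 < tau) (Lambda0_gt0 : 0 < Lambda0)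
  (Lambda1_gt0 : 0 < Lambda1) (alpha0_gt0 : 0 < alpha0).
Hypothesis a0_bounded : forall w v, `|a0 w v| <= Lambda0 * `|w| * `|v|.
Hypothesis a1_bounded : forall w v, `|a1 w v| <= Lambda1 * `|w| * `|v|.
Hypothesis a0_coercive : forall v, a0 v v >= alpha0 * `|v| ^+ 2.
Variables (A0 A1 : V -> dual V).
Hypothesis A0E : forall w v, A0 w v = a0 w v.
Hypothesis A1E : forall w v, A1 w v = a1 w v.
Variables (h0 : H) (f : R -> dual V) (psi : R -> V).
Hypothesis L2psi : L2 (- tau) 0 psi.
Variables (nu1 nu2 : {charge set RT -> \bar R}) (u1 u2 : R -> V) (beta : R).
Hypothesis sol1 : weak_solution i T tau A0 A1 nu1 h0 f psi u1.
Hypothesis sol2 : weak_solution i T tau A0 A1 nu2 h0 f psi u2.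
Hypothesis beta0 : 0 <= beta.

Let u := u1 \- u2.
Let w := weak_derivative i T u.
Let c := continuous_rep i T u.
Let G1 : RT -> V := zext `]- tau, T[ (joined psi u1).
Let G2 : RT -> V := zext `]- tau, T[ (joined psi u2).
Let x (t : R) := `|zext `]0, T[ u t|.
Let y (t : R) := `|zext `]0, T[ w t|.
Let xd (t : R) := `|G1 t - G2 t|.
Let gm (t : R) := `|G2 t|.
Let m := tv_measure nu1.
Let md := tv_measure (cadd nu1 (copp nu2)).
Let N (t : R) := (delay_mean tau m xd t + delay_mean tau md gm t)%E.

Let W1 : in_W i T u1. Proof. by case: sol1. Qed.
Let W2 : in_W i T u2. Proof. by case: sol2. Qed.
Let Wu : in_W i T u. Proof. exact: in_WB. Qed.
Let L2u : L2 0 T u. Proof. exact: Wu.1. Qed.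
Let L2w : L2 0 T w. Proof. by case: (weak_derivativeP Wu). Qed.
Let L2j1 : L2 (- tau) T (joined psi u1). Proof. exact: L2_joined W1.1. Qed.
Let L2j2 : L2 (- tau) T (joined psi u2). Proof. exact: L2_joined W2.1. Qed.

Let sG1 : strongly_measurable setT G1.
Proof. by apply: strongly_measurable_zext => //; case: L2j1. Qed.

Let sG2 : strongly_measurable setT G2.
Proof. by apply: strongly_measurable_zext => //; case: L2j2. Qed.

Let fG1 : (\int[mu]_t (`|G1 t| ^+ 2)%:E < +oo)%E.
Proof. by rewrite integral_zext_sqr; case: L2j1. Qed.

Let fG2 : (\int[mu]_t (`|G2 t| ^+ 2)%:E < +oo)%E.
Proof. by rewrite integral_zext_sqr; case: L2j2. Qed.

Let fGd : (\int[mu]_t (`|G1 t - G2 t| ^+ 2)%:E < +oo)%E.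
Proof.
have [_] := L2B L2j1 L2j2; rewrite -integral_zext_sqr.
apply: le_lt_trans; rewrite le_eqVlt; apply/orP; left; apply/eqP.
apply: eq_integral => t _; rewrite /G1 /G2 /zext; case: ifP => // _.
by rewrite subr0.
Qed.

Let gG t s : t \in `]0, T[ -> s \in `[0, tau] ->
  joined psi u1 (t - s) = G1 (t - s) /\ joined psi u2 (t - s) = G2 (t - s).
Proof.
rewrite !in_itv/= => /andP[t0 tT] /andP[s0 st].
have h : `]- tau, T[%classic (t - s).
  rewrite /= in_itv/= (le_lt_trans _ tT) ?gerBl// andbT ltrBrDr.
  by rewrite (le_lt_trans _ t0)// addrC subr_le0.
by rewrite /G1 /G2 !zext_in.
Qed.

(** A single exceptional set for all v: the energy bound takes v = u(t), which depends on t, and the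
    derivative bound takes all v at once. *)
Let equation : {ae mu, forall t, t \in `]0, T[ -> forall v,
  ((`|w t v + a0 (u t) v|)%:E <= (Lambda1 * `|v|)%:E * N t)%E}.
Proof.
have [_ _ e1] := sol1; have [_ _ e2] := sol2.
have aeW := ae_weak_derivativeB T_gt0 sepV W1 W2.
have aeD := @ae_delayB R V tau Lambda1 a1 A1 (ltW Lambda1_gt0) a1_bounded A1E nu1 nu2
  _ _ _ _ T sG1 sG2 fG1 fG2 fGd gG.
apply: ae_imply (ae_conj (ae_conj e1 e2) (ae_conj aeW aeD)).
move=> t [[h1 h2] [hW hD]] tI v; apply: le_trans (hD tI v).
have E := subr_equations (h1 tI) (h2 tI).
rewrite (operatorB A0E) -(hW tI) in E.
have Ev : w t v + a0 (u t) v = - ((delay tau A1 nu1 (joined psi u1) t -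
    delay tau A1 nu2 (joined psi u2) t) v).
  by rewrite -A0E; exact: (congr1 (fun F : dual V => F v) E).
by rewrite Ev normrN.
Qed.

Let T_ge0 : 0 <= T. Proof. exact: ltW. Qed.

Let mx : measurable_fun [set: R] x.
Proof.
apply: (@strongly_measurable_norm _ RT) => //; apply: strongly_measurable_zext => //.
by case: L2u.
Qed.

Let my : measurable_fun [set: R] y.
Proof.
apply: (@strongly_measurable_norm _ RT) => //; apply: strongly_measurable_zext => //.
by case: L2w.
Qed.

Let mxd : measurable_fun [set: R] xd.
Proof. by apply: (@strongly_measurable_norm _ RT) => //; exact: strongly_measurableB. Qed.

Let mgm : measurable_fun [set: R] gm.
Proof. exact: (@strongly_measurable_norm _ RT). Qed.

Let fx : (\int[mu]_t (x t ^+ 2)%:E < +oo)%E.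
Proof. by rewrite integral_zext_sqr; case: L2u. Qed.

Let fy : (\int[mu]_t (y t ^+ 2)%:E < +oo)%E.
Proof. by rewrite integral_zext_sqr; case: L2w. Qed.

Let xdx : {ae mu, forall t, xd t = x t}.
Proof.
exists [set 0]; split => //; first exact: lebesgue_measure_set1.
move=> t /= h; apply: contrapT => t0; apply: h.
rewrite /xd /x /G1 /G2 /zext /joined !mem_setE !in_itv/=.
have [tn|tp|//] := ltgtP t 0.
  by rewrite subrr.
rewrite (lt_trans _ tp) ?oppr_lt0//=; case: ifP => // _.
by rewrite subrr.
Qed.

Let x_neg t : t <= 0 -> x t = 0.
Proof.
by move=> t0; rewrite /x zext_out ?normr0// => /=; rewrite in_itv/= ltNge t0.
Qed.

Let gm_le : (\int[mu]_t (gm t ^+ 2)%:E <= (L2norm (- tau) T (joined psi u2) ^+ 2)%:E)%E.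
Proof. by rewrite -L2norm_sqr// integral_zext_sqr. Qed.

Let mK : (\int[m]_(s in `[0%R, tau]) (expR (- (beta * s)))%:E <= (kappa tau nu1 beta)%:E)%E.
Proof.
rewrite -kappaE// le_eqVlt; apply/orP; left; apply/eqP; apply: eq_integral => s _.
by rewrite mulNr.
Qed.

Let mdM : (md `[0%R, tau]%classic <= (normM tau (cadd nu1 (copp nu2)))%:E)%E.
Proof. by rewrite -normME. Qed.

Let g (t : R) : R := 2 * zext `]0, T[ w t (zext `]0, T[ u t).

Let intg : mu.-integrable setT (EFin \o g).
Proof. exact: integrable_energy_density. Qed.

Let N0 t : (0 <= N t)%E.
Proof. by apply: adde_ge0; apply: delay_mean_ge0 => s; exact: normr_ge0. Qed.

Let g_le : {ae mu, forall t, ((g t + 2 * alpha0 * x t ^+ 2)%:E <=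
  (2 * Lambda1)%:E * (N t * (x t)%:E))%E}.
Proof.
apply: ae_imply equation => t ht; rewrite /g /x.
have [tI|tI] := boolP (t \in `]0, T[); last first.
  have tI' : ~ `]0, T[%classic t by exact/negP.
  have -> : 2 * zext `]0, T[ w t (zext `]0, T[ u t) = 0 by rewrite (zext_out w tI') mulr0.
  by rewrite (zext_out u tI') normr0 expr0n mulr0 addr0 !mule0.
rewrite !zext_in//; have hv := ht tI (u t).
have c0 := a0_coercive (u t).
have -> : ((2 * Lambda1)%:E * (N t * (`|u t|)%:E) = 2%:E * ((Lambda1 * `|u t|)%:E * N t))%E.
  by rewrite [(2 * _)%:E]EFinM [(Lambda1 * _)%:E]EFinM -!muleA [(_ * N t)%E]muleC.
apply: le_trans (lee_wpmul2l _ hv) => //.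
rewrite -EFinM lee_fin -mulrA -mulrDr ler_wpM2l//.
by rewrite (le_trans _ (ler_norm _))// lerD2l.
Qed.

Let y_le : {ae mu, forall t, ((y t)%:E <= (Lambda0 * x t)%:E + Lambda1%:E * N t)%E}.
Proof.
apply: ae_imply equation => t ht; rewrite /y /x.
have [tI|tI] := boolP (t \in `]0, T[); last first.
  rewrite !zext_out//=; try exact/negP.
  by rewrite !normr0 mulr0 add0e mule_ge0// ?lee_fin ?ltW.
rewrite !zext_in//; move: (N0 t) (ht tI); case: (N t) => [n n0 hv|_ _|//]; last first.
  by rewrite gt0_muley ?lte_fin// addey// leey.
rewrite -EFinM -EFinD lee_fin; apply: dual_norm_le_mul => [|v].
  by rewrite addr_ge0// mulr_ge0// ltW.
have := hv v; rewrite -EFinM lee_fin => hn.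
have := a0_bounded (u t) v => ha.
rewrite -[w t v](addrK (a0 (u t) v)) (le_trans (ler_normB _ _))//.
by rewrite mulrDl addrC lerD// mulrAC.
Qed.

Let crep : is_continuous_rep i T u c /\ c 0 = 0.
Proof.
have [_ [c1 r1 z1] _] := sol1; have [_ [c2 r2 z2] _] := sol2.
have [rc cE] := continuous_repB T_gt0 r1 r2; split=> //.
by rewrite /c cE ?in_itv/= ?lexx ?T_ge0// z1 z2 subrr.
Qed.

Let energy t : 0 <= t -> t <= T -> `|c t| ^+ 2 = \int[mu]_(r in `]0, t]) g r.
Proof.
move=> t0 tT; have [[cc cu] c0] := crep.
rewrite (energy_identity T_gt0 L2u L2w cc cu) ?in_itv/= ?t0//.
  rewrite c0 normr0 expr0n add0r -Rintegral_itv_obnd_cbnd//.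
  exact: (integrableS _ _ _ intg).
move=> v a b a_gt0 ab bT; apply: (weak_derivative_increments T_gt0 v L2u L2w _ crep.1 a_gt0 ab bT).
by case: (weak_derivativeP Wu).
Qed.

Let K := kappa tau nu1 beta.
Let d := alpha0 - Lambda1 * K.
Let Y := L2norm (- tau) T (joined psi u2).
Let M := normM tau (cadd nu1 (copp nu2)).
Let F := Lambda1 * M * Y.
Let X t := weighted_norm beta x t.

Let F0 : 0 <= F.
Proof. by rewrite !mulr_ge0 ?normM_ge0 ?sqrtr_ge0 ?ltW. Qed.

Let energy_estimate t : 0 < t -> t <= T ->
  (expR (- (beta * t)) * `|c t|) ^+ 2 + 2 * d * X t ^+ 2 <= 2 * F * X t.
Proof.
move=> t0 tT; have ig : mu.-integrable `]0, T] (EFin \o g).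
  exact: (integrableS _ _ _ intg).
have g0 (r : R) : 0 < r -> r <= T -> 0 <= \int[mu]_(s in `]0, r]) g s.
  by move=> r0 rT; rewrite -energy ?sqr_ge0// ltW.
have := delay_energy_le beta0 (ltW Lambda1_gt0) (sqrtr_ge0 _) mK mdM mx mxd mgm
  (fun=> normr_ge0 _) (fun=> normr_ge0 _) (fun=> normr_ge0 _) fx gm_le xdx x_neg
  ig g0 g_le t0 tT.
rewrite -energy ?(ltW t0)//; apply: le_trans.
rewrite lerD2r exprMn le_eqVlt; apply/orP; left; apply/eqP; congr (_ * _).
by rewrite expr2 -expRD; congr expR; ring.
Qed.

(** Each summand of the constant multiplies F / d: 1 comes from the L^2 norm of the difference,
    alpha0 + Lambda0 from its derivative, sqrt alpha0 from its sup norm in H. *)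
Lemma solution_difference_le : 0 < d -> normW i T u + normC i T u <=
  expR (beta * T) * ((1 + Num.sqrt alpha0 + alpha0 + Lambda0) / d) * F.
Proof.
move=> d0; have K0 : 0 <= K by exact: kappa_ge0.
have dle : d <= alpha0 by rewrite gerBl mulr_ge0// ltW.
have X0 t : 0 <= X t := sqrtr_ge0 _.
have Fd : 0 <= F / d by rewrite divr_ge0// ltW.
have EX : X T <= F / d.
  (* The squared H norm is dropped from the energy estimate and one factor X(T) is cancelled; X(T) =
     0 is treated apart. *)
  rewrite ler_pdivlMr//; have := energy_estimate T_gt0 (lexx T).
  have := sqr_ge0 (expR (- (beta * T)) * `|c T|); have := X0 T.
  rewrite le_eqVlt => /predU1P[<- _ _|XT h1 h2]; first by rewrite mul0r.
  have : 2 * d * X T ^+ 2 <= 2 * F * X T by apply: le_trans h2; rewrite lerDr.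
  by rewrite expr2 mulrA ler_pM2r// -mulrA ler_pM2l// mulrC.
have EZ : weighted_norm beta y T <= (Lambda0 + alpha0) * (F / d).
  have := delay_derivative_le T beta0 (ltW Lambda0_gt0) (ltW Lambda1_gt0) (normM_ge0 _ _)
    K0 (sqrtr_ge0 _) mK mdM mx mxd my mgm (fun=> normr_ge0 _) (fun=> normr_ge0 _)
    (fun=> normr_ge0 _) (fun=> normr_ge0 _) fx fy gm_le xdx x_neg y_le.
  move=> /le_trans; apply; rewrite -/K -/F.
  (* The source F equals d (F / d), and Lambda1 K + d = alpha0 by definition of d. *)
  have -> : (Lambda0 + alpha0) * (F / d) = (Lambda0 + Lambda1 * K) * (F / d) + d * (F / d).
    by rewrite -mulrDl /d; congr (_ * _); ring.
  rewrite [d * _]mulrC divfK ?gt_eqF// lerD2r ler_wpM2l//.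
  by rewrite addr_ge0// ?mulr_ge0// ltW.
have EC t : t \in `[0, T] -> `|c t| <= expR (beta * T) * (Num.sqrt alpha0 * (F / d)).
  rewrite in_itv/= le_eqVlt => /andP[/predU1P[<- _|t0 tT]].
    by rewrite (crep.2) normr0 mulr_ge0 ?expR_ge0// mulr_ge0 ?sqrtr_ge0.
  have hE := energy_estimate t0 tT.
  have h1 : expR (- (beta * t)) * `|c t| <= Num.sqrt alpha0 * (F / d).
    have q1 : 0 <= expR (- (beta * t)) * `|c t| by rewrite mulr_ge0 ?expR_ge0.
    have q2 : 0 <= Num.sqrt alpha0 * (F / d) by rewrite mulr_ge0 ?sqrtr_ge0.
    rewrite -(@ler_pXn2r _ 2)//.
    rewrite [leRHS]exprMn sqr_sqrtr ?(ltW alpha0_gt0)//.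
    (* With q = F / d, the gap between d q^2 and 2 F X - 2 d X^2 is d ((q - X)^2 + X^2) >= 0; then d
       <= alpha0 gives the square of sqrt(alpha0) q. *)
    apply: (@le_trans _ _ (2 * F * X t - 2 * d * X t ^+ 2)); first by rewrite lerBrDr.
    apply: (@le_trans _ _ (d * (F / d) ^+ 2)); last by rewrite ler_wpM2r ?sqr_ge0.
    have -> : F = d * (F / d) by rewrite mulrC divfK// gt_eqF.
    set q := (F / d); rewrite -subr_ge0.
    have -> : d * ((d * q) / d) ^+ 2 - (2 * (d * q) * X t - 2 * d * X t ^+ 2) =
        d * ((q - X t) ^+ 2 + X t ^+ 2).
      by rewrite [d * q]mulrC mulfK ?gt_eqF//; ring.
    by rewrite mulr_ge0 ?(ltW d0)// addr_ge0 ?sqr_ge0.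
  apply: (@le_trans _ _ (expR (beta * t) * (Num.sqrt alpha0 * (F / d)))).
    rewrite -ler_pdivrMl ?expR_gt0// -expRN; exact: h1.
  apply: ler_wpM2r; first exact: mulr_ge0 (sqrtr_ge0 _) Fd.
  by rewrite ler_expR ler_wpM2l.
have NC : normC i T u <= expR (beta * T) * (Num.sqrt alpha0 * (F / d)).
  apply: ge_sup; first by exists `|c 0|, 0 => //=; rewrite in_itv/= lexx T_ge0.
  by move=> _ [t /= tI <-]; exact: EC.
have NW : normW i T u <= expR (beta * T) * (X T + weighted_norm beta y T).
  have b1 := L2norm_le_weighted beta0 T_ge0 L2u.
  have b2 := L2norm_le_weighted beta0 T_ge0 L2w.
  rewrite mulrDr; apply: le_trans (lerD b1 b2); rewrite /normW -/w.
  have p1 : 0 <= L2norm 0 T u := sqrtr_ge0 _.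
  have p2 : 0 <= L2norm 0 T w := sqrtr_ge0 _.
  rewrite -[leRHS]ger0_norm ?addr_ge0// -sqrtr_sqr ler_wsqrtr//.
  by rewrite sqrrD lerD2r lerDl mulrn_wge0// mulr_ge0.
apply: le_trans (lerD NW NC) _; rewrite -mulrDr -[leRHS]mulrA ler_wpM2l ?expR_ge0//.
apply: (@le_trans _ _ (F / d + (Lambda0 + alpha0) * (F / d) + Num.sqrt alpha0 * (F / d))).
  by rewrite lerD2r lerD.
rewrite [leRHS]mulrAC -[leRHS]mulrA le_eqVlt; apply/orP; left; apply/eqP.
by set q := F / d; clearbody q; ring.
Qed.

End solution_difference.

(** * Admissible exponents and comparison of norms *)

Section vanishing_kappa.
Context (R : realType).
Local Notation RT := (measurableTypeR R).
Local Notation total_variation := Defs.total_variation.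

(* The weights expR (- n s) tend to 0 except at s = 0, which carries no mass. *)
Lemma kappa_small (tau : R) (nu : {charge set RT -> \bar R}) (e : R) :
  total_variation nu [set 0] = 0%E -> 0 < e -> exists n, kappa tau nu n%:R < e.
Proof.
move=> nu0 e0.
have mI : measurable (`[0, tau]%classic : set RT) by exact: measurable_itv.
have mexp (b : R) : measurable_fun (`[0, tau]%classic : set RT) (fun s : RT => (expR (- b * s))%:E).
  apply/measurable_EFinP; apply: measurable_funTS; apply: continuous_measurable_fun => t.
  by apply: continuous_comp; [apply: cvgMr; exact: cvg_id|exact: continuous_expR].
have [] := @dominated_convergence _ RT R (tv_measure nu) `[0, tau]%classic mI
  (fun n s => (expR (- n%:R * s))%:E) (cst 0%E) (cst 1%E).
- by move=> n; exact: mexp.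
- exact: measurable_cst.
- exists [set 0]; split => // s /= h; apply: contrapT => s0; apply: h => sI.
  apply: cvg_EFin; first by apply: nearW.
  have -> : fine \o (fun n => (expR (- n%:R * s))%:E) = GRing.exp (expR (- s)).
    by apply/funext => n /=; rewrite mulNr -mulrN expRM_natl.
  apply: cvg_expr; rewrite ger0_norm ?expR_ge0// -expR0 ltr_expR oppr_lt0.
  move: sI; rewrite in_itv/= => /andP[]; rewrite le_eqVlt => /predU1P[s0'|//].
  by rewrite -s0' in s0.
- apply: finite_measure_integrable_cst => //.
- apply: aeW => s /= n; rewrite in_itv/= => /andP[s0 _].
  by rewrite lee_fin ger0_norm ?expR_ge0// -expR0 ler_expR mulNr oppr_le0 mulr_ge0.
move=> _ _; rewrite integral0 => /fine_cvgP[_ /cvgr0Pnorm_lt /(_ _ e0)[n _ /(_ n (leqnn n))]] h.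
by exists n; rewrite (le_lt_trans (ler_norm _)).
Qed.

End vanishing_kappa.

Section norms.
Context (R : realType) (V H : hilbertType R) (i : dense_embedding V H).
Local Notation RT := (measurableTypeR R).
Local Notation mu := (@lebesgue_measure R).

(** The function is arbitrary here, so the set of values may be unbounded; [sup] then has the
    default value 0. *)
Lemma normC_ge0 (T : R) (u : R -> V) : 0 <= normC i T u.
Proof.
rewrite /normC; set S := [set _ | _ in _].
have [hS|/sup_out->//] := pselect (has_sup S).
have [[z zS] ub] := hS; apply: (@le_trans _ _ z); first by case: zS => t _ <-.
exact: ub_le_sup.
Qed.

Lemma L2norm_le_normW (T : R) (u : R -> V) : L2norm 0 T u <= normW i T u.
Proof.
have p : 0 <= L2norm 0 T u := sqrtr_ge0 _.
rewrite -[leLHS]ger0_norm// -sqrtr_sqr ler_wsqrtr// lerDl sqr_ge0//.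
Qed.

(** Only finiteness of the constant matters for the local Lipschitz bound: squaring the pointwise
    triangle inequality costs a factor 2 and replaces Minkowski's inequality. *)
Lemma L2norm_joined_le (T tau : R) (psi u v : R -> V) : 0 < T -> 0 < tau ->
  L2 (- tau) 0 psi -> L2 0 T u -> L2 0 T v ->
  L2norm (- tau) T (joined psi u) <=
  2 * (L2norm (- tau) T (joined psi v) + L2norm 0 T (u \- v)).
Proof.
move=> T0 tau0 L2psi L2u L2v.
have L2ju := L2_joined T0 tau0 L2psi L2u; have L2jv := L2_joined T0 tau0 L2psi L2v.
have L2d := L2B L2u L2v.
have p1 : 0 <= L2norm (- tau) T (joined psi u) := sqrtr_ge0 _.
have p2 : 0 <= L2norm (- tau) T (joined psi v) := sqrtr_ge0 _.
have p3 : 0 <= L2norm 0 T (u \- v) := sqrtr_ge0 _.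
suff : L2norm (- tau) T (joined psi u) ^+ 2 <=
    2 * L2norm (- tau) T (joined psi v) ^+ 2 + 2 * L2norm 0 T (u \- v) ^+ 2.
  move: p1 p2 p3; set a := L2norm _ _ _; set b := L2norm _ _ _; set d := L2norm _ _ _.
  clearbody a b d; move=> a0 b0 d0 h.
  rewrite -(@ler_pXn2r _ 2)// ?nnegrE ?mulr_ge0 ?addr_ge0//.
  have := mulr_ge0 b0 d0; have := sqr_ge0 b; have := sqr_ge0 d; move: h.
  rewrite !expr2; lra.
rewrite -lee_fin EFinD (EFinM 2 (L2norm (- tau) T (joined psi v) ^+ 2)).
rewrite (EFinM 2 (L2norm 0 T (u \- v) ^+ 2)) -!L2norm_sqr//.
have mI (a b : R) : measurable (`]a, b[%classic : set RT) by exact: measurable_itv.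
have mn (X : normedModType R) (a b : R) (f : R -> X) : L2 a b f ->
    measurable_fun (`]a, b[%classic : set RT) (fun t => (`|f t| ^+ 2)%:E).
  move=> [sf _]; apply/measurable_EFinP; apply: measurable_funX.
  exact: strongly_measurable_norm.
have mz : measurable_fun (`]- tau, T[%classic : set RT)
    (fun t => (`|zext `]0, T[ (u \- v) t| ^+ 2)%:E).
  apply: measurable_funTS; apply/measurable_EFinP; apply: measurable_funX.
  apply: (@strongly_measurable_norm _ RT) => //; apply: strongly_measurable_zext => //.
  by case: L2d.
rewrite -[X in (_ <= _ + _ * X)%E]integral_zext_sqr.
apply: (@le_trans _ _ (\int[mu]_(t in `](- tau)%R, T[)
   (2%:E * (`|joined psi v t| ^+ 2)%:E + 2%:E * (`|zext `]0%R, T[ (u \- v) t| ^+ 2)%:E))%E).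
  apply: ae_ge0_le_integral => //.
  - exact: mn.
  - by move=> t _; rewrite adde_ge0// mule_ge0// lee_fin sqr_ge0.
  - by apply: emeasurable_funD; apply: measurable_funeM => //; exact: mn.
  exists [set 0]; split => //; first exact: lebesgue_measure_set1.
  move=> t /= h; apply: contrapT => t0; apply: h.
  rewrite in_itv/= => /andP[t1 t2]; rewrite -!EFinM -EFinD lee_fin /joined.
  have [tn|tp|//] := ltgtP t 0.
    rewrite zext_out ?normr0; last by rewrite /= in_itv/= ltNge (ltW tn).
    by rewrite expr0n mulr0 addr0 ler_peMl ?sqr_ge0// ler1n.
  rewrite zext_in; last by rewrite /= in_itv/= tp.
  rewrite /= -{1}(subrK (v t) (u t)).
  apply: (@le_trans _ _ ((`|u t - v t| + `|v t|) ^+ 2)).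
    by rewrite lerXn2r ?nnegrE ?addr_ge0// ler_normD.
  have := sqr_ge0 (`|u t - v t| - `|v t|); rewrite !expr2; lra.
rewrite ge0_integralD//=; first last.
- exact: measurable_funeM.
- by apply: measurable_funeM; exact: mn.
rewrite !ge0_integralZl//=; last exact: mn.
rewrite leeD2l// lee_wpmul2l//; apply: ge0_subset_integral => //=.
apply/measurable_EFinP; apply: measurable_funX.
apply: (@strongly_measurable_norm _ RT) => //; apply: strongly_measurable_zext => //.
by case: L2d.
Qed.

End norms.

Theorem corollary5p3 (R : realType) (V H : hilbertType R)
    (i : dense_embedding V H) (sepV : separable V) (sepH : separable H)
    (T tau : R) (T_gt0 : 0 < T) (tau_gt0 : 0 < tau)
    (a0 a1 : {bilinear V -> V -> R^o}) (Lambda0 Lambda1 alpha0 : R)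
    (Lambda0_gt0 : 0 < Lambda0) (Lambda1_gt0 : 0 < Lambda1)
    (alpha0_gt0 : 0 < alpha0)
    (a0_bounded : forall w v, `|a0 w v| <= Lambda0 * `|w| * `|v|)
    (a1_bounded : forall w v, `|a1 w v| <= Lambda1 * `|w| * `|v|)
    (a0_coercive : forall v, a0 v v >= alpha0 * `|v| ^+ 2)
    (A0 A1 : V -> dual V)
    (A0E : forall w v, A0 w v = a0 w v) (A1E : forall w v, A1 w v = a1 w v)
    (u0 : H) (f : R -> dual V) (psi : R -> V)
    (L2f : L2 0 T f) (L2psi : L2 (- tau) 0 psi) :
  (forall (mu : {charge set (measurableTypeR R) -> \bar R}) (beta r : R),
    in_M0 tau mu -> 0 <= beta ->
    let d := alpha0 - Lambda1 * kappa tau mu beta in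
    0 < d -> 0 < r -> Lambda1 * r <= d / 2 ->
    forall nu : {charge set (measurableTypeR R) -> \bar R},
    in_M0 tau nu -> normM tau (cadd nu (copp mu)) <= r ->
    forall u_nu u_mu : R -> V,
    weak_solution i T tau A0 A1 nu u0 f psi u_nu ->
    weak_solution i T tau A0 A1 mu u0 f psi u_mu ->
    normW i T (u_nu \- u_mu) + normC i T (u_nu \- u_mu) <=
      2 * expR (beta * T) *
      ((1 + Num.sqrt alpha0 + alpha0 + Lambda0) / d) * Lambda1 *
      L2norm (- tau) T (joined psi u_mu) * normM tau (cadd nu (copp mu))) /\
  (forall mu : {charge set (measurableTypeR R) -> \bar R}, in_M0 tau mu ->
    exists r L : R, [/\ 0 < r, 0 <= L &
      forall nu1 nu2 : {charge set (measurableTypeR R) -> \bar R},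
      in_M0 tau nu1 -> in_M0 tau nu2 ->
      normM tau (cadd nu1 (copp mu)) <= r ->
      normM tau (cadd nu2 (copp mu)) <= r ->
      forall u1 u2 : R -> V,
      weak_solution i T tau A0 A1 nu1 u0 f psi u1 ->
      weak_solution i T tau A0 A1 nu2 u0 f psi u2 ->
      normW i T (u1 \- u2) + normC i T (u1 \- u2) <=
        L * normM tau (cadd nu1 (copp nu2))]).
Proof.
pose S := 1 + Num.sqrt alpha0 + alpha0 + Lambda0.
have S0 : 0 <= S by rewrite !addr_ge0 ?sqrtr_ge0 ?ltW.
(* The roles are asymmetric: the margin is that of [nu], the trajectory in the bound that of [mu].
   Any positive lower bound k of the margin may stand for it; both parts use k = d / 2. *)
have estimate (mu nu : {charge set (measurableTypeR R) -> \bar R}) (beta k : R)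
    (u_nu u_mu : R -> V) : 0 <= beta -> 0 < k ->
    k <= alpha0 - Lambda1 * kappa tau nu beta ->
    weak_solution i T tau A0 A1 nu u0 f psi u_nu ->
    weak_solution i T tau A0 A1 mu u0 f psi u_mu ->
    normW i T (u_nu \- u_mu) + normC i T (u_nu \- u_mu) <=
    expR (beta * T) * (S / k) *
      (Lambda1 * normM tau (cadd nu (copp mu)) * L2norm (- tau) T (joined psi u_mu)).
  move=> beta0 k0 kd s_nu s_mu; have d0 := lt_le_trans k0 kd.
  apply: le_trans (solution_difference_le sepV T_gt0 tau_gt0 Lambda0_gt0 Lambda1_gt0
    alpha0_gt0 a0_bounded a1_bounded a0_coercive A0E A1E L2psi s_nu s_mu beta0 d0) _.
  apply: ler_wpM2r; first by rewrite !mulr_ge0 ?normM_ge0 ?sqrtr_ge0 ?ltW.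
  by rewrite ler_wpM2l ?expR_ge0// ler_wpM2l// lef_pV2 ?posrE.
(* Moving the kernel by r in total variation costs at most Lambda1 r of margin. *)
have coercive (mu nu : {charge set (measurableTypeR R) -> \bar R}) (beta r : R) : 0 <= beta ->
    normM tau (cadd nu (copp mu)) <= r ->
    alpha0 - Lambda1 * kappa tau mu beta - Lambda1 * r <= alpha0 - Lambda1 * kappa tau nu beta.
  move=> beta0 numu; rewrite -addrA -opprD lerD2l lerN2 -mulrDr ler_wpM2l ?(ltW Lambda1_gt0)//.
  by apply: le_trans (kappa_le tau nu mu beta0) _; rewrite lerD2l.
split=> [mu beta r Mmu beta0 d d0 r0 rd nu Mnu numu u_nu u_mu s_nu s_mu|mu Mmu].
  have d2 : 0 < d / 2 by rewrite divr_gt0.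
  have dnu : d / 2 <= alpha0 - Lambda1 * kappa tau nu beta.
    by apply: le_trans (coercive mu nu beta r beta0 numu); rewrite -/d lerBrDr; lra.
  apply: le_trans (estimate mu nu beta _ u_nu u_mu beta0 d2 dnu s_nu s_mu) _.
  rewrite le_eqVlt; apply/orP; left; apply/eqP; rewrite invf_div -/S.
  by rewrite mulrA; set q := d^-1; clearbody q; ring.
have [n kn] := kappa_small tau Mmu.2 (divr_gt0 alpha0_gt0 Lambda1_gt0).
set beta : R := n%:R in kn; have beta0 : 0 <= beta by exact: ler0n.
set d := alpha0 - Lambda1 * kappa tau mu beta.
have d0 : 0 < d by rewrite subr_gt0 mulrC -ltr_pdivlMr.
have d2 : 0 < d / 2 by rewrite divr_gt0.
(* The largest radius that keeps half of the margin on the whole ball. *)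
pose r := d / 2 / Lambda1.
have r0 : 0 < r by exact: divr_gt0.
have rd : Lambda1 * r = d / 2 by rewrite mulrC divfK// gt_eqF.
have dball nu : normM tau (cadd nu (copp mu)) <= r ->
    d / 2 <= alpha0 - Lambda1 * kappa tau nu beta.
  move=> numu; apply: le_trans (coercive mu nu beta r beta0 numu).
  by rewrite rd -/d lerBrDr -splitr.
pose sol u := exists2 nu : {charge set (measurableTypeR R) -> \bar R},
  normM tau (cadd nu (copp mu)) <= r & weak_solution i T tau A0 A1 nu u0 f psi u.
(* Existence of solutions is not at hand, not even for mu. Either no kernel of the ball has one and
   the bound is vacuous, or one of them is fixed as reference. *)
have [[u [nu numu s_nu]]|nosol] := pselect (exists u, sol u); last first.
  exists r, 0; split=> // nu1 nu2 _ _ b1 _ u1 u2 s1 _.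
  by case: nosol; exists u1, nu1.
pose C := expR (beta * T) * (S / (d / 2)) * Lambda1.
have C0 : 0 <= C.
  exact: mulr_ge0 (mulr_ge0 (expR_ge0 _) (divr_ge0 S0 (ltW d2))) (ltW Lambda1_gt0).
pose Y := L2norm (- tau) T (joined psi u).
have Y0 : 0 <= Y := sqrtr_ge0 _.
(* C times a bound for the joined trajectory of u2: Y is the norm of the reference trajectory, C (r
   + r) Y bounds the distance to it, since both kernels lie within r of mu, and 2 comes from
   [L2norm_joined_le]. *)
exists r, (C * (2 * (Y + C * (r + r) * Y))); split => //.
  have r2 : 0 <= r + r by rewrite addr_ge0// ltW.
  exact: mulr_ge0 C0 (mulr_ge0 (ler0n _ 2) (addr_ge0 Y0 (mulr_ge0 (mulr_ge0 C0 r2) Y0))).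
move=> nu1 nu2 _ _ b1 b2 u1 u2 s1 s2.
(* The estimate is used twice: against the reference, to bound the trajectory of u2 over the ball,
   then between u1 and u2. *)
have e2 := estimate nu nu2 beta _ u2 u beta0 d2 (dball _ b2) s2 s_nu.
have e1 := estimate nu2 nu1 beta _ u1 u2 beta0 d2 (dball _ b1) s1 s2.
apply: le_trans e1 _; set M := normM tau (cadd nu1 (copp nu2)).
have M0 : 0 <= M by exact: normM_ge0.
have -> : expR (beta * T) * (S / (d / 2)) * (Lambda1 * M * L2norm (- tau) T (joined psi u2)) =
  C * L2norm (- tau) T (joined psi u2) * M by rewrite /C; ring.
rewrite ler_wpM2r// ler_wpM2l//.
have [W2 _ _] := s2; have [W _ _] := s_nu.
apply: le_trans (L2norm_joined_le T_gt0 tau_gt0 L2psi W2.1 W.1) _.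
rewrite ler_wpM2l// lerD2l.
apply: le_trans (L2norm_le_normW i T (u2 \- u)) _.
apply: (@le_trans _ _ (normW i T (u2 \- u) + normC i T (u2 \- u))).
  by rewrite lerDl normC_ge0.
apply: le_trans e2 _; rewrite -/Y.
have -> : expR (beta * T) * (S / (d / 2)) * (Lambda1 * normM tau (cadd nu2 (copp nu)) * Y) =
  C * normM tau (cadd nu2 (copp nu)) * Y by rewrite /C; ring.
rewrite ler_wpM2r// ler_wpM2l//.
by apply: le_trans (normM_triangle tau nu2 nu mu) _; rewrite lerD.
Qed.
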